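(* Let $n\ge 2$ be an integer, $1<p<n$, and $\mu<\mu_1:=[(n-p)/p]^p$. Let $s\in(0,p)$ and $q>p^\star$. If $u\in D_1^p(\mathbb{R}^n)\cap L^\infty_{\mathrm{loc}}(\mathbb{R}^n\setminus\{0\})$ is a weak solution to $$-\Delta_p u-\mu\frac{|u|^{p-2}u}{|x|^p}=\frac{|u|^{p^\star(s)-2}u}{|x|^s}+|u|^{q-2}u\quad\text{in }\mathbb{R}^n,$$ then $u\equiv 0$.
   Context: $\Delta_p u:=\operatorname{div}(|\nabla u|^{p-2}\nabla u)$. The exponents are $p^\star:=\frac{np}{n-p}$ and $p^\star(s):=\frac{p(n-s)}{n-p}$. The space $D_1^p(\mathbb{R}^n)$ is the completion of $C_c^\infty(\mathbb{R}^n)$ for the norm $u\mapsto\|\nabla u\|_p$, where $\|\cdot\|_p$ is the norm of $L^p(\mathbb{R}^n)$. Weak solution: for $f\in L^1_{\mathrm{loc}}(\mathbb{R}^n)$, a function $u\in D_1^p(\mathbb{R}^n)$ is a weak solution of $-\Delta_p u=f$ in $\mathbb{R}^n$ if $\int_{\mathbb{R}^n}|\nabla u|^{p-2}(\nabla u,\nabla\varphi)\,dx=\int_{\mathbb{R}^n}f\varphi\,dx$ for all $\varphi\in C_c^\infty(\mathbb{R}^n)$. For the equation in the claim, $f=\mu\frac{|u|^{p-2}u}{|x|^p}+\frac{|u|^{p^\star(s)-2}u}{|x|^s}+|u|^{q-2}u$ (in particular, being a weak solution includes that this $f$ is in $L^1_{\mathrm{loc}}(\mathbb{R}^n)$). 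*)

(* Defs.v *)
From HB Require Import structures.
From mathcomp Require Import all_boot all_order all_algebra.
From mathcomp Require Import all_classical all_reals all_analysis.

Set Implicit Arguments.
Unset Strict Implicit.
Unset Printing Implicit Defensive.

Import Order.TTheory GRing.Theory Num.Theory.
Import numFieldNormedType.Exports.

Local Open Scope classical_set_scope.
Local Open Scope ring_scope.

(* R^n is ['rV[R]_n]; its sigma-algebra is generated by the coordinates, as the
   library does for tuples, and is thus the Borel one. *)

Definition measure_rV_display : measure_display -> measure_display.
Proof. exact. Qed.

Section measurable_rV.
Context {d} {T : measurableType d}.
Variable n : nat.

Let coors : 'I_n -> 'rV[T]_n -> T := fun i x => x ord0 i.

Let rV_set0 : g_sigma_preimage coors set0.
Proof. exact: sigma_algebra0. Qed.

Let rV_setC A : g_sigma_preimage coors A -> g_sigma_preimage coors (~` A).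
Proof. exact: sigma_algebraC. Qed.

Let rV_bigcup (F : (set 'rV[T]_n)^nat) :
  (forall i, g_sigma_preimage coors (F i)) ->
  g_sigma_preimage coors (\bigcup_i (F i)).
Proof. exact: sigma_algebra_bigcup. Qed.

HB.instance Definition _ := @isMeasurable.Build (measure_rV_display d)
  'rV[T]_n (g_sigma_preimage coors) rV_set0 rV_setC rV_bigcup.

End measurable_rV.

Lemma measurable_coord d (T : measurableType d) n (i : 'I_n) :
  measurable_fun [set: 'rV[T]_n] (fun x => x ord0 i).
Proof.
move=> _ Y mY; rewrite setTI; apply: sub_sigma_algebra => /=.
rewrite -bigcup_seq/=; exists i => /=; first by rewrite mem_index_enum.
by exists Y => //; rewrite setTI.
Qed.

Lemma measurable_fun_coordP d1 d2 (T1 : measurableType d1)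
    (T2 : measurableType d2) n (f : T1 -> 'rV[T2]_n) :
  measurable_fun [set: T1] f <->
  forall i, measurable_fun [set: T1] (fun x => f x ord0 i).
Proof.
split=> [mf i|mf].
  exact: (measurableT_comp (@measurable_coord _ _ n i) mf).
have H : forall A, measurable A -> measurable (f @^-1` A).
  apply: smallest_sub.
    split => /=.
    - by rewrite preimage_set0.
    - move=> A mA; rewrite setTD preimage_setC; exact: measurableC.
    - move=> F mF; rewrite preimage_bigcup; exact: bigcupT_measurable.
  rewrite -bigcup_seq => _ [i _ [B mB <-]] /=.
  rewrite setTI; have := mf i measurableT B mB.
  by rewrite setTI.
by move=> _ A mA; rewrite setTI; exact: H.
Qed.

Section lebesgue_rV.
Context {R : realType}.

Definition cons_rV n (x : measurableTypeR R * 'rV[R]_n) : 'rV[R]_n.+1 :=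
  row_mx (x.1%:M : 'rV_1) x.2.

Definition uncons_rV n (y : 'rV[R]_n.+1) : measurableTypeR R * 'rV[R]_n :=
  (y ord0 ord0, rsubmx (y : 'rV_(1 + n))).

Lemma cons_rVK n : cancel (@cons_rV n) (@uncons_rV n).
Proof.
case=> a v; congr pair; last exact: row_mxKr.
have -> : ord0 = lshift n (ord0 : 'I_1) :> 'I_(1 + n) by exact/val_inj.
by rewrite [LHS]row_mxEl mxE eqxx.
Qed.

Lemma measurable_cons_rV n : measurable_fun setT (@cons_rV n).
Proof.
apply/measurable_fun_coordP => i.
case: (@split_ordP 1 n i) => j ->.
  rewrite (_ : (fun _ => _) = fst); first exact: measurable_fst.
  by apply/funext => x; rewrite [LHS]row_mxEl mxE (ord1 j).
rewrite (_ : (fun _ => _) = (fun y : 'rV[R]_n => y ord0 j) \o snd).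
  exact: (measurableT_comp (@measurable_coord _ _ n j) measurable_snd).
by apply/funext => x; rewrite [LHS]row_mxEr.
Qed.

Lemma measurable_uncons_rV n : measurable_fun setT (@uncons_rV n).
Proof.
apply: measurable_fun_pair; first exact: measurable_coord.
apply/measurable_fun_coordP => i; under eq_fun do rewrite mxE.
exact: measurable_coord.
Qed.

Section step.
Variables (n : nat) (m : {sigma_finite_measure set 'rV[R]_n -> \bar R}).

Definition lebesgue_rV_step : set 'rV[R]_n.+1 -> \bar R :=
  pushforward (@lebesgue_measure R \x m)%E (@cons_rV n).

HB.instance Definition _ := Measure.copy lebesgue_rV_step
  (measure_function_pushforward__canonical__measure_function_Measure
    (@lebesgue_measure R \x m)%E (@measurable_cons_rV n)).

Let lebesgue_rV_step_sigma_finite : sigma_finite setT lebesgue_rV_step.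
Proof.
have /sigma_finiteP[F [FT ndF Foo]] := sigma_finiteT (@lebesgue_measure R).
have /sigma_finiteP[G [GT ndG Goo]] := sigma_finiteT m.
exists (fun k => @uncons_rV n @^-1` (F k `*` G k)).
  apply/esym; rewrite -subTset => y _.
  have : (\bigcup_k F k) (uncons_rV y).1 by rewrite -FT.
  have : (\bigcup_k G k) (uncons_rV y).2 by rewrite -GT.
  move=> [k _ Gk] [l _ Fl]; exists (maxn k l) => //; split.
  - by move: Fl; exact/subsetPset/ndF/leq_maxr.
  - by move: Gk; exact/subsetPset/ndG/leq_maxl.
move=> k; have [mF Fk] := Foo k; have [mG Gk] := Goo k.
split.
  rewrite -[X in measurable X]setTI.
  by apply: measurable_uncons_rV => //; exact: measurableX.
rewrite /lebesgue_rV_step /pushforward -comp_preimage.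
rewrite (_ : _ \o _ = id) ?preimage_id; last first.
  by apply/funext => x /=; rewrite cons_rVK.
by rewrite product_measure1E// lte_mul_pinfty// ge0_fin_numE.
Qed.

HB.instance Definition _ := Measure_isSigmaFinite.Build _ _ _
  lebesgue_rV_step lebesgue_rV_step_sigma_finite.

End step.

(* The n-fold product of the one-dimensional measure; see [lebesgue_rV_box]. *)
Fixpoint lebesgue_rV n : {sigma_finite_measure set 'rV[R]_n -> \bar R} :=
  match n with
  | 0 => \d_(0 : 'rV[R]_0)
  | n'.+1 => lebesgue_rV_step (lebesgue_rV n')
  end.

Lemma lebesgue_rV_box n (A : 'I_n -> set R) :
  (forall i, measurable (A i)) ->
  lebesgue_rV n [set x | forall i, A i (x ord0 i)] =
    (\prod_(i < n) @lebesgue_measure R (A i))%E.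
Proof.
elim: n A => [|n IHn] A mA.
  by rewrite big_ord0 /= diracE mem_set//; case.
rewrite big_ord_recl -IHn; last by move=> i; exact: mA.
have mB : measurable [set x : 'rV[R]_n | forall i, A (lift ord0 i) (x ord0 i)].
  rewrite (_ : mkset _ = \bigcap_(i in [set: 'I_n])
      ((fun x : 'rV[R]_n => x ord0 i) @^-1` A (lift ord0 i))); last first.
    by apply/seteqP; split=> [x xA i _|x xA i]; exact: xA.
  apply: fin_bigcap_measurable; first exact: finite_finset.
  move=> i _; rewrite -[X in measurable X]setTI.
  exact: measurable_coord.
rewrite -product_measure1E//; last exact: mA.
rewrite /= /lebesgue_rV_step /pushforward; congr (product_measure1 _ _ _).
have c0 (y : R * 'rV[R]_n) : cons_rV y ord0 ord0 = y.1.
  have -> : ord0 = lshift n (ord0 : 'I_1) :> 'I_(1 + n) by exact/val_inj.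
  by rewrite [LHS]row_mxEl mxE eqxx.
have cS (y : R * 'rV[R]_n) i : cons_rV y ord0 (lift ord0 i) = y.2 ord0 i.
  have -> : lift ord0 i = rshift 1 i :> 'I_(1 + n) by exact/val_inj.
  by rewrite [LHS]row_mxEr.
apply/seteqP; split=> [y /= yA|y /= [y1 y2] i].
  by split=> [|i]; [rewrite -c0|rewrite -cS]; exact: yA.
by case: (unliftP ord0 i) => [j|] ->; rewrite ?cS ?c0.
Qed.

End lebesgue_rV.
Arguments lebesgue_rV : clear implicits.

Section euclidean.
Context {R : realType} {n : nat}.
Implicit Types (x y : 'rV[R]_n) (f phi u : 'rV[R]_n -> R).

(* The library norm [`|x|] on matrices is the sup norm. *)
Definition dot x y : R := \sum_(i < n) x ord0 i * y ord0 i.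

Definition enorm x : R := Num.sqrt (dot x x).

Definition partial (i : 'I_n) f : 'rV[R]_n -> R :=
  fun x => 'D_(delta_mx ord0 i) f x.

Definition grad f : 'rV[R]_n -> 'rV[R]_n := fun x => \row_i partial i f x.

(* All iterated partial derivatives exist and are continuous; [s] lists the
   variables of differentiation. *)
Definition smooth f : Prop :=
  forall s : seq 'I_n, let g := foldr partial f s in
    continuous g /\ forall i x, derivable g x (delta_mx ord0 i).

Definition test_function phi : Prop :=
  smooth phi /\ compact (closure [set x | phi x != 0]).

End euclidean.

Section D1p.
Context {R : realType} {n : nat}.
Implicit Types (p : R) (u f : 'rV[R]_n -> R) (G : 'rV[R]_n -> 'rV[R]_n).

Local Notation leb := (lebesgue_rV R n).

Definition crit_exp_s (p s : R) : R := p * (n%:R - s) / (n%:R - p).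

Definition crit_exp (p : R) : R := n%:R * p / (n%:R - p).

Definition hardy_constant (p : R) : R := ((n%:R - p) / p) `^ p.

(* For 1 < p < n, the Sobolev inequality makes every sequence of test functions
   that is Cauchy for [phi |-> || grad phi ||_p] Cauchy in L^{p*}; the completion
   is thereby realized as a space of functions, a Cauchy sequence being
   identified with its L^{p*} limit [u].  The gradient [G] of [u] is the L^p
   limit of the gradients. *)
Definition D1p_gradient p u G : Prop :=
  [/\ measurable_fun setT u, measurable_fun setT G &
   exists phi : nat -> 'rV[R]_n -> R,
     [/\ forall k, test_function (phi k),
      Lnorm leb (crit_exp p)%:E (fun x => (phi k x - u x)%:E)
        @[k --> \oo] --> 0%E &
      Lnorm leb p%:E (fun x => (enorm (grad (phi k) x - G x))%:E)
        @[k --> \oo] --> 0%E]].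

Definition D1p p u : Prop := exists G, D1p_gradient p u G.

Definition locally_L1 f : Prop :=
  measurable_fun setT f /\
  forall K, compact K -> (\int[leb]_(x in K) `|f x|%:E < +oo)%E.

Definition Linfty_loc_punctured u : Prop :=
  measurable_fun setT u /\
  forall K : set 'rV[R]_n, compact K -> ~ K 0 ->
    exists M : R, {ae leb, forall x, K x -> `|u x| <= M}.

(* [powR] is total at 0, so the flux |G|^{p-2} G is 0 where G = 0, also when
   p < 2.  Both integrands below are integrable, so the integrals are finite. *)
Definition weak_solution p u f : Prop :=
  locally_L1 f /\
  exists2 G, D1p_gradient p u G &
    forall phi, test_function phi ->
      (\int[leb]_x (enorm (G x) `^ (p - 2) * dot (G x) (grad phi x))%:E =
       \int[leb]_x (f x * phi x)%:E)%E.

End D1p.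
Arguments crit_exp_s {R} n p s.
Arguments crit_exp {R} n p.
Arguments hardy_constant {R} n p.

(* Main.v *)
Require Import Defs.
From HB Require Import structures.
From mathcomp Require Import all_boot all_order all_algebra.
From mathcomp Require Import all_classical all_reals all_analysis.
From mathcomp Require Import measurable_realfun ring lra.

Set Implicit Arguments.
Unset Strict Implicit.
Unset Printing Implicit Defensive.

Import Order.TTheory GRing.Theory Num.Theory.
Import numFieldNormedType.Exports.

Local Open Scope classical_set_scope.
Local Open Scope ring_scope.

(* For a function u on R^n write u_l(x) = u(l x), and let eta be a smooth cutoff
   supported in an annulus around the origin, where u is bounded.  Testing the
   equation with eta u gives, up to an error carried by the two ends of the
   annulus,
     int |grad u|^p = mu int |u|^p/|x|^p + int |u|^r/|x|^s + int |u|^q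
   with r = p*(s).  Testing it with eta (u_l - u), where l decreases to 1,
   replaces the Pohozaev multiplier x . grad u, which would require second
   derivatives of u: convexity of t |-> t^p bounds
   |grad u|^{p-2} (grad u, grad u_l - grad u) by (|grad u_l|^p - |grad u|^p)/p,
   and a scaling of the integrals, divided by l - 1, then yields
     (n-p)/p (int |grad u|^p - mu int |u|^p/|x|^p - int |u|^r/|x|^s)
       <= n/q int |u|^q,
   since the first three terms scale with the same exponent.
   Subtracting, ((n-p)/p - n/q) int |u|^q <= 0, and the first factor is positive
   because q > p*.  The error terms tend to 0 since all the densities are
   integrable: for |u|^p/|x|^p this is Hardy's inequality, and for the last two
   it is Fatou's lemma in the first identity. *)

(** * Lebesgue measure and dilations *)

Section measure_rV.
Context {R : realType}.

(** The solution is only known to lie in [D1p] and to be bounded on annuli, so x . grad u need not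
    be an admissible test function, whereas u_l - u stays in the same space. What makes it as good
    as a derivative is that the integral of (|u_l - u|/|x|)^p is of order (l - 1)^p, by the
    fundamental theorem of calculus along rays. Since p > 1, this turns the Taylor remainders of the
    powers of u into o(l - 1) wherever u is bounded. The order of the limits shapes the statements.
    A precision e and a cutoff of parameter N are fixed, and l decreases to 1. The errors that
    remain of order l - 1, apart from e itself, all come from the cutoff: they are integrals of a
    fixed integrable density against the weight [cutoff_tail N], with constants that may depend on e
    but not on N. The weight is bounded and tends to 0 pointwise, so these errors vanish as N grows;
    e tends to 0 last. Dilations are taken with l > 1: the convexity inequality is one-sided and
    must keep its direction under division by l - 1, and the Jacobian factors are then at most 1. *)

Lemma lebesgue_measure_dilation (l : R) (A : set R) : 0 < l -> measurable A ->
  (@lebesgue_measure R A =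
   l%:E * @lebesgue_measure R ((fun x => l * x)%R @^-1` A))%E.
Proof.
move=> l0 mA.
have mphi : measurable_fun [set: measurableTypeR R]
    ((fun x => l * x) : measurableTypeR R -> measurableTypeR R).
  exact: measurable_funM.
pose nu := mscale (NngNum (ltW l0)) (pushforward (@lebesgue_measure R)
    ((fun x => l * x) : measurableTypeR R -> measurableTypeR R)).
pose P := measure_function_pushforward__canonical__measure_function_Measure
    (@lebesgue_measure R) mphi.
rewrite (@lebesgue_measure_unique R (mscale (NngNum (ltW l0)) P))//.
move=> _ [[a b]] _ <-.
change (lebesgue_measure `]a, b]%classic = l%:E *
  lebesgue_measure ((fun x => l * x)%R @^-1` `]a, b]%classic))%E.
rewrite (_ : _ @^-1` _ = `](l^-1 * a), (l^-1 * b)]%classic); last first.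
  by apply/seteqP; split=> x /=; rewrite !in_itv/= ltr_pdivrMl// ler_pdivlMl.
rewrite !lebesgue_measure_itv/= !lte_fin ltr_pM2l ?invr_gt0//.
case: ifPn => _; last by rewrite mule0.
by rewrite -!EFinB -EFinM -mulrBr mulrA mulfV ?gt_eqF// mul1r.
Qed.

Lemma ge0_integral_dilation1 (l : R) (F : R -> \bar R) : 0 < l ->
  measurable_fun setT F -> (forall x, (0 <= F x)%E) ->
  (\int[@lebesgue_measure R]_x F x =
   l%:E * \int[@lebesgue_measure R]_x F (l * x)%R)%E.
Proof.
move=> l0 mF F0.
have mphi : measurable_fun [set: measurableTypeR R]
    ((fun x => l * x) : measurableTypeR R -> measurableTypeR R).
  exact: measurable_funM.
pose P := measure_function_pushforward__canonical__measure_function_Measure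
    (@lebesgue_measure R) mphi.
have -> : (\int[@lebesgue_measure R]_x F (l * x)%R =
   \int[P]_x F x)%E.
  by rewrite [RHS]ge0_integral_pushforward.
rewrite -(ge0_integral_mscale P measurableT (NngNum (ltW l0)))//.
apply: eq_measure_integral => A mA _ /=.
by rewrite /mscale /= -lebesgue_measure_dilation.
Qed.

Lemma scale_cons_rV n (l a : R) (v : 'rV[R]_n) :
  l *: cons_rV (a, v) = cons_rV (l * a, l *: v).
Proof.
apply/rowP => i; rewrite mxE.
case: (@split_ordP 1 n i) => j ->.
  by rewrite [X in l * X = _]row_mxEl [RHS]row_mxEl !mxE (ord1 j) eqxx.
by rewrite [X in l * X = _]row_mxEr [RHS]row_mxEr mxE.
Qed.

Lemma measurable_scale_rV n (l : R) :
  measurable_fun setT (fun x : 'rV[R]_n => l *: x).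
Proof.
apply/measurable_fun_coordP => i; under eq_fun do rewrite mxE.
by apply: measurable_funM => //; exact: measurable_coord.
Qed.

Lemma integral_lebesgue_rVS n (F : 'rV[R]_n.+1 -> \bar R) :
  measurable_fun setT F -> (forall x, (0 <= F x)%E) ->
  (\int[lebesgue_rV R n.+1]_x F x =
   \int[@lebesgue_measure R]_a \int[lebesgue_rV R n]_v F (cons_rV (a, v)))%E.
Proof.
move=> mF F0.
rewrite [LHS](ge0_integral_pushforward (@measurable_cons_rV R n)
  (@lebesgue_measure R \x lebesgue_rV R n)%E)//.
rewrite preimage_setT (fubini_tonelli1 (F \o @cons_rV R n))//; last first.
  by move=> z; exact: F0.
by apply: measurableT_comp => //; exact: measurable_cons_rV.
Qed.

(** Induction on the dimension: Tonelli's theorem splits off one coordinate, which contributes one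
    factor [l]. The identity holds in the extended reals, so that it also transfers
    integrability. *)
Lemma ge0_integral_dilation n (l : R) (F : 'rV[R]_n -> \bar R) : 0 < l ->
  measurable_fun setT F -> (forall x, (0 <= F x)%E) ->
  (\int[lebesgue_rV R n]_x F x =
   (l ^+ n)%:E * \int[lebesgue_rV R n]_x F (l *: x)%R)%E.
Proof.
move=> l0; elim: n F => [|n IHn] F mF F0.
  rewrite expr0 mul1e; apply: eq_integral => x _.
  by congr F; apply/rowP => -[].
have mFl : measurable_fun setT (fun x : 'rV[R]_n.+1 => F (l *: x)).
  by apply: measurableT_comp => //; exact: measurable_scale_rV.
rewrite !integral_lebesgue_rVS//.
have mc (G : 'rV[R]_n.+1 -> \bar R) : measurable_fun setT G ->
    measurable_fun setT (G \o @cons_rV R n).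
  by move=> mG; apply: measurableT_comp => //; exact: measurable_cons_rV.
rewrite (ge0_integral_dilation1 l0); first last.
- by move=> x; exact: integral_ge0.
- apply: (measurable_fun_fubini_tonelli_F (F \o @cons_rV R n)).
    exact: mc.
  by move=> z; exact: F0.
rewrite exprS EFinM -muleA; congr (_ * _)%E.
rewrite -ge0_integralZl//; first last.
- by rewrite lee_fin exprn_ge0// ltW.
- by move=> x _; exact: integral_ge0.
- apply: (measurable_fun_fubini_tonelli_F
    ((fun x : 'rV[R]_n.+1 => F (l *: x)) \o @cons_rV R n)).
    exact: mc.
  by move=> z; exact: F0.
apply: eq_integral => a _; rewrite IHn//; first last.
  apply: (measurableT_comp (mc _ mF)) => /=.
  exact: measurable_fun_pair.
by congr (_ * _)%E; apply: eq_integral => v _; rewrite scale_cons_rV.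
Qed.

Lemma measurable_ball_rV n (q : 'rV[R]_n) (e : R) : measurable (ball q e).
Proof.
have [e0|e0] := ltP 0 e; last first.
  rewrite (_ : ball q e = set0) //; apply/seteqP; split=> // x [].
  by rewrite ltNge e0.
rewrite (_ : ball q e = \bigcap_(i in [set: 'I_n])
    ((fun x : 'rV[R]_n => x ord0 i) @^-1` ball (q ord0 i) e)).
  apply: fin_bigcap_measurable; first exact: finite_finset.
  move=> i _; rewrite -[X in measurable X]setTI; apply: measurable_coord => //.
  exact: measurable_ball.
apply/seteqP; split=> [x [_ qx] i _|x qx]; first exact: qx.
by split=> // i j; rewrite (ord1 i); exact: qx.
Qed.

(** The sigma-algebra is generated by the coordinates, so an open set is exhibited as a countable
    union of balls with rational centre; for the sup norm these are boxes. *)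
Lemma open_measurable_rV n (U : set 'rV[R]_n) : open U -> measurable U.
Proof.
move=> oU.
pose r (q : 'rV[rat]_n) : 'rV[R]_n := map_mx ratr q.
pose D := [set qk : 'rV[rat]_n * nat | ball (r qk.1) (qk.2.+1%:R^-1) `<=` U].
have -> : U = \bigcup_(qk in D) ball (r qk.1) (qk.2.+1%:R^-1).
  apply/seteqP; split=> [x Ux|x [qk Dqk] /Dqk//].
  have /nbhs_ballP[e /= e0 eU] : nbhs x U by exact: open_nbhs_nbhs.
  (* With a radius below e / 2, a ball that contains [x] lies in the ball of radius e about [x]. *)
  have [k] : exists k, 0 + k.+1%:R^-1 < e / 2.
    by apply: ltr_add_invr; rewrite divr_gt0.
  rewrite add0r => ke.
  have k0 : (0 : R) < k.+1%:R^-1 by rewrite invr_gt0.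
  have /(_ _)/cid-/all_tag[q qP] : forall i : 'I_n, exists q : rat,
      ball (x ord0 i) (k.+1%:R^-1 : R) (ratr q).
    move=> i; have [||y [xy [q _ qy]]] :=
      @dense_rat R (ball (x ord0 i) (k.+1%:R^-1 : R)).
    - by exists (x ord0 i); exact: ballxx.
    - exact: ball_open.
    - by exists q; rewrite qy.
  have xq : ball x (k.+1%:R^-1) (r (\row_i q i)).
    split=> // i j; rewrite (ord1 i) !mxE; exact: qP.
  exists (\row_i q i, k) => /=; last exact: ball_sym.
  move=> y qy; apply: eU; rewrite (splitr e).
  apply: (@ball_triangle _ _ (r (\row_i q i))).
    by apply: (le_ball (ltW ke)); exact: xq.
  by apply: (le_ball (ltW ke)); exact: qy.
rewrite bigcup_mkcond; apply: countable_bigcupT_measurable => // qk.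
by case: ifP => // _; exact: measurable_ball_rV.
Qed.

Lemma continuous_measurable_rV n (f : 'rV[R]_n -> R) :
  continuous f -> measurable_fun setT f.
Proof.
move=> /continuousP cf.
apply: (measurability _ (RGenOpens.measurableE R)).
move=> _ [_ [a [b ->]] <-]; rewrite setTI; apply: open_measurable_rV.
by apply: cf; exact: interval_open.
Qed.

End measure_rV.

(** * Differential calculus *)

Section directional_derivative.
Context {R : realType}.

(** A derivative along [v] is the derivative at 0 of a function of one real variable; the chain rule
    and the mean value theorem are transported through this equivalence. *)
Lemma is_derive_lineP (V : normedModType R) (f : V -> R) (x v : V) (df : R) :
  is_derive x v f df <-> is_derive (0 : R) 1 (fun t : R => f (t *: v + x)) df.
Proof.
have E : (fun h : R => h^-1 *: ((f \o shift x) (h *: v) - f x)) =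
    (fun h : R => h^-1 *: (((fun t : R => f (t *: v + x)) \o shift 0)
       (h *: (1 : R)) - (fun t : R => f (t *: v + x)) 0)).
  by apply/funext => h /=; rewrite addr0 scale0r add0r /GRing.scale /= mulr1.
split=> [[dfx <-]|[dfx <-]]; split.
- by rewrite /derivable -E.
- by rewrite /derive -E.
- by rewrite /derivable E.
- by rewrite /derive E.
Qed.

Context {V : normedModType R}.
Implicit Types (f : V -> R) (x v : V).

Lemma is_derive_line f x v (t df : R) : is_derive (t *: v + x) v f df ->
  is_derive t 1 (fun t : R => f (t *: v + x)) df.
Proof.
move=> /is_derive_lineP H; apply: (proj2 (@is_derive_lineP R _ t 1 df)).
rewrite (_ : (fun _ => _) = (fun t0 : R => f (t0 *: v + (t *: v + x))))//.
apply/funext => s /=; rewrite (_ : s%:A = s); last exact: mulr1.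
by rewrite scalerDl addrA.
Qed.

Lemma is_derive_comp_real f (h : R -> R) x v (df dh : R) :
  is_derive x v f df -> is_derive (f x) 1 h dh ->
  is_derive x v (h \o f) (dh * df).
Proof.
move=> /is_derive_lineP Hf Hh; apply/is_derive_lineP.
apply: (@is_derive1_comp _ h (fun t : R => f (t *: v + x))).
by rewrite scale0r add0r.
Qed.

Lemma is_derive_dilation f x v (l df : R) : is_derive (l *: x) v f df ->
  is_derive x v (fun y => f (l *: y)) (l * df).
Proof.
move=> /is_derive_lineP H; apply/is_derive_lineP.
rewrite (_ : (fun _ => _) =
    (fun t : R => f (t *: v + l *: x)) \o (fun t => l * t)); last first.
  by apply/funext => s /=; rewrite scalerDr scalerA.
rewrite mulrC; apply: is_derive1_comp; first by rewrite mulr0.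
apply: is_derive_eq; by rewrite /GRing.scale /= mulr1.
Qed.

Lemma MVT_line f w v (d : R) : (forall x, derivable f x v) ->
  exists2 c : R, `|c| <= `|d| &
    f (d *: v + w) - f w = d * 'D_v f (c *: v + w).
Proof.
move=> dfv.
have dl (t : R) : is_derive (t : R) (1 : R) (fun t : R => f (t *: v + w)) ('D_v f (t *: v + w)).
  by apply: is_derive_line; exact: derivableP.
have cl : continuous (fun t : R => f (t *: v + w)).
  move=> t; apply: differentiable_continuous; apply/derivable1_diffP.
  by have [] := dl t.
have [d0|d0|->] := ltgtP d 0.
- have [c] := @MVT R (fun t : R => f (t *: v + w))
    (fun t : R => 'D_v f (t *: v + w)) _ _ d0 (fun (t : R) _ => dl t)
    (continuous_subspaceT cl).
  rewrite in_itv/= => /andP[dc c0] E; exists c.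
    by rewrite !ler0_norm ?lerN2 ltW.
  by move: E; rewrite scale0r !add0r => E; rewrite mulrC -[RHS]opprK -mulrN -E opprB.
- have [c] := @MVT R (fun t : R => f (t *: v + w))
    (fun t : R => 'D_v f (t *: v + w)) _ _ d0 (fun (t : R) _ => dl t)
    (continuous_subspaceT cl).
  rewrite in_itv/= => /andP[c0 cd] E; exists c.
    by rewrite !ger0_norm ltW.
  by move: E; rewrite scale0r add0r subr0 mulrC.
- by exists 0 => //; rewrite scale0r add0r subrr mul0r.
Qed.

End directional_derivative.

(** * Functions with continuous partial derivatives *)

Section C1.
Context {R : realType} {n : nat}.
Implicit Types (f : 'rV[R]_n -> R) (x v : 'rV[R]_n).

(** Corners of the staircase from 0 to [v] that moves one coordinate at a time. *)
Let trunc (k : nat) v : 'rV[R]_n := \row_j (if (j < k)%N then v ord0 j else 0).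

Let truncS (k : 'I_n) v :
  trunc k.+1 v = v ord0 k *: delta_mx ord0 k + trunc k v.
Proof.
apply/rowP => j; rewrite !mxE eqxx /= ltnS.
have [->|jk] := eqVneq j k; first by rewrite leqnn ltnn mulr1 addr0.
by rewrite mulr0 add0r ltn_neqAle jk.
Qed.

Lemma rV_norm_le v (M : R) : 0 <= M -> (forall i, `|v ord0 i| <= M) -> `|v| <= M.
Proof.
move=> M0 vM; rewrite [leLHS]/Num.norm /= mx_normrE.
by apply: bigmax_le => // -[i j] _ /=; rewrite (ord1 i).
Qed.

Lemma le_rV_norm v i : `|v ord0 i| <= `|v|.
Proof.
rewrite [leRHS]/Num.norm /= mx_normrE.
exact: (@le_bigmax _ _ _ _ (fun ij => `|v ij.1 ij.2|) (ord0, i)).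
Qed.

(** [smooth] speaks of coordinate directions only. The increment of f along h v telescopes over the
    staircase [trunc]; the mean value theorem on each edge gives a partial derivative at a point
    [xi] that tends to x with h, and continuity of the partial derivatives concludes. *)
Lemma C1_is_derive f x v :
  (forall i, continuous (partial i f)) ->
  (forall i x, derivable f x (delta_mx ord0 i)) ->
  is_derive x v f (dot v (grad f x)).
Proof.
move=> cf df.
have step (h : R) (k : 'I_n) : exists xi : 'rV[R]_n, `|xi - x| <= `|h| * `|v| /\
    f (h *: trunc k.+1 v + x) - f (h *: trunc k v + x) =
    h * (v ord0 k * partial k f xi).
  have [c chv E] := @MVT_line R _ f (h *: trunc k v + x) (delta_mx ord0 k)
     (h * v ord0 k) (df k).
  exists (c *: delta_mx ord0 k + (h *: trunc k v + x)); split.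
    rewrite addrA addrK; apply: rV_norm_le => [|j]; first exact: mulr_ge0.
    rewrite !mxE eqxx /=.
    have [->|jk] := eqVneq j k.
      rewrite ltnn mulr0 addr0 mulr1 (le_trans chv)// normrM.
      by rewrite ler_wpM2l// le_rV_norm.
    rewrite mulr0 add0r normrM ler_wpM2l//.
    by case: ifP => _; rewrite ?normr0// le_rV_norm.
  by rewrite truncS scalerDr scalerA -addrA E mulrA.
pose xi h k := projT1 (cid (step h k)).
have xiP h k : `|xi h k - x| <= `|h| * `|v| /\
    f (h *: trunc k.+1 v + x) - f (h *: trunc k v + x) =
    h * (v ord0 k * partial k f (xi h k)) by exact: projT2 (cid (step h k)).
have E (h : R) : f (h *: v + x) - f x = h * \sum_k v ord0 k * partial k f (xi h k).
  rewrite mulr_sumr; under eq_bigr do rewrite -(xiP h _).2.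
  rewrite -(big_mkord xpredT
    (fun k => f (h *: trunc k.+1 v + x) - f (h *: trunc k v + x))).
  rewrite telescope_sumr//; congr (f (h *: _ + x) - f _).
    by apply/rowP => j; rewrite mxE ltn_ord.
  rewrite (_ : trunc 0 v = 0) ?scaler0 ?add0r//.
  by apply/rowP => j; rewrite !mxE ltn0.
have xicvg k : xi h k @[h --> (0 : R)^'] --> x.
  apply/cvgrPdist_le => e e0; near=> h.
  rewrite distrC (le_trans (xiP h k).1)//.
  have : `|h| * (`|v| + 1) <= e.
    rewrite -ler_pdivlMr ?ltr_wpDl//.
    near: h; apply: dnbhs0_le; by rewrite divr_gt0// ltr_wpDl.
  apply: le_trans; by rewrite ler_wpM2l// lerDl.
have Q : h^-1 *: ((f \o shift x) (h *: v) - f x) @[h --> (0 : R)^'] -->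
    dot v (grad f x).
  have Q0 : \sum_k v ord0 k * partial k f (xi h k) @[h --> (0 : R)^'] -->
     dot v (grad f x).
    rewrite /dot; under eq_bigr do rewrite mxE.
    apply: cvg_big => [|k _]; first exact: add_continuous.
    apply: cvgM; first exact: cvg_cst.
    by apply: cvg_comp (xicvg k) _; exact: cf.
  apply: cvg_trans Q0; apply: near_eq_cvg; near=> h.
  rewrite /= E /GRing.scale /= mulrA mulVf ?mul1r//.
  by near: h; exact: nbhs_dnbhs_neq.
split; last exact/cvg_lim.
by apply/cvg_ex; exists (dot v (grad f x)).
Unshelve. all: by end_near. Qed.

End C1.

(** * Calculus of smooth functions *)

Section smooth.
Context {R : realType} {n : nat}.
Implicit Types (f g : 'rV[R]_n -> R) (x v : 'rV[R]_n).

(** A recursive form of k-fold continuous differentiability, so that closure properties follow by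
    induction on k. It peels off the derivative taken first, which is the last entry of the list in
    [smooth]. *)
Fixpoint Cn k f : Prop := continuous f /\
  if k is k'.+1 then
    forall i, (forall x, derivable f x (delta_mx ord0 i)) /\ Cn k' (partial i f)
  else True.

Lemma smoothP f : smooth f <-> forall k, Cn k f.
Proof.
split.
  move=> sf k; elim: k f sf => [|k IHk] f sf /=.
    by split => //; have [] := sf [::].
  split; first by have [] := sf [::].
  move=> i; split; first by have [_ /(_ i)] := sf [::].
  by apply: IHk => s; have := sf (rcons s i); rewrite foldr_rcons.
move=> Cf s; elim/last_ind: s f Cf => [|s i IHs] f Cf.
  by have [/= cf d] := Cf 1%N; split => // i; have [] := d i.
rewrite foldr_rcons; apply: IHs => k.
by have [_ /(_ i)[]] := Cf k.+1.
Qed.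

Lemma CnW k f : Cn k.+1 f -> Cn k f.
Proof.
elim: k f => [f [cf _]//|k IHk] f [cf df]; split=> // i.
by have [dfi Cfi] := df i; split=> //; exact: IHk.
Qed.

Lemma Cn_continuous k f : Cn k f -> continuous f.
Proof. by case: k => [|k] []. Qed.

Lemma partial_cst i (c : R) : partial i (fun _ : 'rV[R]_n => c) = fun=> 0.
Proof. by apply/funext => x; rewrite /partial derive_cst. Qed.

Lemma Cn_cst k (c : R) : Cn k (fun=> c).
Proof.
elim: k c => [|k IHk] c; first by split => // ?; exact: cst_continuous.
split; first by move=> ?; exact: cst_continuous.
by move=> i; split; [move=> x; exact: derivable_cst|rewrite partial_cst].
Qed.

Lemma partialD i f g x : derivable f x (delta_mx ord0 i) ->
  derivable g x (delta_mx ord0 i) ->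
  partial i (fun x => f x + g x) x = partial i f x + partial i g x.
Proof. move=> df dg; rewrite /partial.
exact: (deriveD df dg). Qed.

Lemma partialM i f g x : derivable f x (delta_mx ord0 i) ->
  derivable g x (delta_mx ord0 i) ->
  partial i (fun x => f x * g x) x = f x * partial i g x + g x * partial i f x.
Proof. move=> df dg; rewrite /partial.
exact: (deriveM df dg). Qed.

Lemma CnD k f g : Cn k f -> Cn k g -> Cn k (fun x => f x + g x).
Proof.
elim: k f g => [|k IHk] f g [cf df] [cg dg].
  by split=> // x; apply: continuousD; [exact: cf|exact: cg].
split; first by move=> x; apply: continuousD; [exact: cf|exact: cg].
move=> i; have [dfi Cfi] := df i; have [dgi Cgi] := dg i; split.
  by move=> x; exact: derivableD.
rewrite (_ : partial i _ = fun x => partial i f x + partial i g x).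
  exact: IHk.
by apply/funext => x; rewrite partialD.
Qed.

Lemma CnM k f g : Cn k f -> Cn k g -> Cn k (fun x => f x * g x).
Proof.
elim: k f g => [|k IHk] f g Cf Cg; have cf := Cn_continuous Cf;
    have cg := Cn_continuous Cg.
  by split=> // x; apply: continuousM; [exact: cf|exact: cg].
split; first by move=> x; apply: continuousM; [exact: cf|exact: cg].
move=> i; have [dfi Cfi] := Cf.2 i; have [dgi Cgi] := Cg.2 i; split.
  by move=> x; exact: derivableM.
rewrite (_ : partial i _ =
    fun x => f x * partial i g x + g x * partial i f x).
  by apply: CnD; apply: IHk => //; exact: CnW.
by apply/funext => x; rewrite partialM.
Qed.

Lemma derivable_coord (i j : 'I_n) x :
  is_derive x (delta_mx ord0 i) (fun x : 'rV[R]_n => x ord0 j) (i == j)%:R.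
Proof.
apply/is_derive_lineP; under eq_fun do rewrite !mxE eqxx /=.
rewrite eq_sym; apply: is_derive_eq.
by rewrite addr0 scaler0 add0r /GRing.scale/= mulr1.
Qed.

Lemma Cn_coord k (j : 'I_n) : Cn k (fun x => x ord0 j).
Proof.
have cj : continuous (fun x : 'rV[R]_n => x ord0 j) by exact: coord_continuous.
case: k => [//|k]; split => // i; split.
  by move=> x; have [] := derivable_coord i j x.
rewrite (_ : partial i _ = fun=> (i == j)%:R); first exact: Cn_cst.
by apply/funext => x; apply: derive_val; exact: derivable_coord.
Qed.

Lemma Cn_sum k (I : Type) (r : seq I) (F : I -> 'rV[R]_n -> R) :
  (forall i, Cn k (F i)) -> Cn k (fun x => \sum_(i <- r) F i x).
Proof.
move=> CF; elim: r => [|i r IHr].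
  rewrite (_ : (fun _ => _) = fun=> 0); first exact: Cn_cst.
  by apply/funext => x; rewrite big_nil.
rewrite (_ : (fun _ => _) = fun x => F i x + \sum_(i <- r) F i x).
  exact: CnD.
by apply/funext => x; rewrite big_cons.
Qed.

Lemma Cn_dot k : Cn k (fun x => dot x x).
Proof. by apply: Cn_sum => i; apply: CnM; exact: Cn_coord. Qed.

Lemma partial_dilation (l : R) i f x : derivable f (l *: x) (delta_mx ord0 i) ->
  partial i (fun x => f (l *: x)) x = l * partial i f (l *: x).
Proof.
by move=> df; apply: derive_val; apply: is_derive_dilation; exact: derivableP.
Qed.

Lemma Cn_dilation k (l : R) f : Cn k f -> Cn k (fun x => f (l *: x)).
Proof.
have cl f0 : continuous f0 -> continuous (fun x : 'rV[R]_n => f0 (l *: x)).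
  move=> cf0 x; apply: (@cvg_comp _ _ _ (fun x : 'rV[R]_n => l *: x)).
    exact: scaler_continuous.
  exact: cf0.
elim: k f => [|k IHk] f [cf df]; first by split => //; exact: cl.
split; first exact: cl.
move=> i; have [dfi Cfi] := df i; split.
  move=> x; have : is_derive (l *: x) (delta_mx ord0 i) f
    ('D_(delta_mx ord0 i) f (l *: x)) by exact: derivableP.
  by move=> /is_derive_dilation [].
rewrite (_ : partial i _ = fun x => (fun=> l) x * partial i f (l *: x)).
  by apply: CnM; [exact: Cn_cst|exact: IHk].
by apply/funext => x; rewrite partial_dilation.
Qed.

Lemma smooth_continuous f : smooth f -> continuous f.
Proof. by move=> /(_ [::]) []. Qed.

Lemma smooth_derivable f i x : smooth f -> derivable f x (delta_mx ord0 i).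
Proof. by move=> /(_ [::]) [_]. Qed.

Lemma smooth_partial i f : smooth f -> smooth (partial i f).
Proof. by move=> sf s; rewrite -foldr_rcons; exact: sf. Qed.

Lemma smooth_is_derive f x v : smooth f -> is_derive x v f (dot v (grad f x)).
Proof.
move=> sf; apply: C1_is_derive => [i|i y]; last exact: smooth_derivable.
by apply: smooth_continuous; exact: smooth_partial.
Qed.

Lemma gradM f g x : smooth f -> smooth g ->
  grad (fun x => f x * g x) x = f x *: grad g x + g x *: grad f x.
Proof.
move=> sf sg; apply/rowP => i; rewrite !mxE partialM//; exact: smooth_derivable.
Qed.

Lemma grad_dilation (l : R) f x : smooth f ->
  grad (fun x => f (l *: x)) x = l *: grad f (l *: x).
Proof.
move=> sf; apply/rowP => i; rewrite !mxE partial_dilation//.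
exact: smooth_derivable.
Qed.

End smooth.

(** * Euclidean norm and cutoff functions *)

Section euclidean_norm.
Context {R : realType} {n : nat}.
Implicit Types (x y : 'rV[R]_n) (l : R).

Lemma dotC x y : dot x y = dot y x.
Proof. by apply: eq_bigr => i _; rewrite mulrC. Qed.

Lemma dotDl x y z : dot (x + y) z = dot x z + dot y z.
Proof. by rewrite /dot -big_split; apply: eq_bigr => i _; rewrite mxE mulrDl. Qed.

Lemma dotZl l x y : dot (l *: x) y = l * dot x y.
Proof. by rewrite /dot mulr_sumr; apply: eq_bigr => i _; rewrite mxE mulrA. Qed.

Lemma dotDr x y z : dot z (x + y) = dot z x + dot z y.
Proof. by rewrite dotC dotDl !(dotC z). Qed.

Lemma dotZr l x y : dot x (l *: y) = l * dot x y.
Proof. by rewrite dotC dotZl dotC. Qed.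

Lemma dotNl x y : dot (- x) y = - dot x y.
Proof. by rewrite -scaleN1r dotZl mulN1r. Qed.

Lemma dotBr x y z : dot z (x - y) = dot z x - dot z y.
Proof. by rewrite dotDr (dotC z (- y)) dotNl (dotC y). Qed.

Lemma dot_ge0 x : 0 <= dot x x.
Proof. by apply: sumr_ge0 => i _; rewrite -expr2 sqr_ge0. Qed.

Lemma enorm_ge0 x : 0 <= enorm x. Proof. exact: sqrtr_ge0. Qed.

Lemma sqr_enorm x : enorm x ^+ 2 = dot x x.
Proof. by rewrite sqr_sqrtr// dot_ge0. Qed.

Lemma enorm_eq0 x : (enorm x == 0) = (x == 0).
Proof.
apply/eqP/eqP => [x0|->]; last first.
  by rewrite /enorm /dot big1 ?sqrtr0// => i _; rewrite mxE mul0r.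
have : dot x x = 0 by rewrite -sqr_enorm x0 expr0n.
move=> /eqP; rewrite psumr_eq0 => [|i _]; last by rewrite -expr2 sqr_ge0.
move=> /allP H; apply/rowP => i; rewrite mxE.
by have /(_ (mem_index_enum i)) := H i; rewrite mulf_eq0 orbb => /eqP.
Qed.

Lemma enorm0 : enorm (0 : 'rV[R]_n) = 0.
Proof. by apply/eqP; rewrite enorm_eq0. Qed.

Lemma enormZ l x : enorm (l *: x) = `|l| * enorm x.
Proof.
by rewrite /enorm dotZl dotZr mulrA -expr2 sqrtrM ?sqr_ge0// sqrtr_sqr.
Qed.

Lemma enormN x : enorm (- x) = enorm x.
Proof. by rewrite -scaleN1r enormZ normrN1 mul1r. Qed.

(** Cauchy-Schwarz: the squared norm of |y| x - |x| y is non-negative, and it expands to 2 |x| |y|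
    (|x| |y| - x . y). *)
Lemma dot_le_enorm x y : dot x y <= enorm x * enorm y.
Proof.
have [x0|x0] := eqVneq (enorm x) 0.
  rewrite x0 mul0r; move/eqP: x0; rewrite enorm_eq0 => /eqP ->.
  by rewrite /dot big1// => i _; rewrite mxE mul0r.
have [y0|y0] := eqVneq (enorm y) 0.
  rewrite y0 mulr0; move/eqP: y0; rewrite enorm_eq0 => /eqP ->.
  by rewrite /dot big1// => i _; rewrite mxE mulr0.
have xp : 0 < enorm x by rewrite lt_def x0 enorm_ge0.
have yp : 0 < enorm y by rewrite lt_def y0 enorm_ge0.
have := dot_ge0 (enorm y *: x - enorm x *: y).
rewrite dotBr !(dotC (_ - _)) !dotBr !dotZl !dotZr !(dotC y x) -!sqr_enorm.
set a := enorm x; set b := enorm y; set d := dot x y => H.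
have : (a * b) * d <= (a * b) * (a * b) by nra.
by rewrite ler_pM2l// mulr_gt0.
Qed.

Lemma normr_dot x y : `|dot x y| <= enorm x * enorm y.
Proof.
rewrite ler_norml dot_le_enorm andbT lerNl -dotNl -(enormN x).
exact: dot_le_enorm.
Qed.

Lemma ler_enormD x y : enorm (x + y) <= enorm x + enorm y.
Proof.
rewrite -(@ler_pXn2r _ 2)// ?nnegrE ?addr_ge0 ?enorm_ge0//.
rewrite sqr_enorm dotDl !dotDr (dotC y x) -!sqr_enorm.
by have := dot_le_enorm x y; nra.
Qed.

Lemma rV_norm_enorm x : `|x| <= enorm x.
Proof.
apply: rV_norm_le => [|i]; first exact: enorm_ge0.
rewrite -(@ler_pXn2r _ 2)// ?nnegrE ?enorm_ge0// sqr_enorm /dot (bigD1 i)//=.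
rewrite -normrX ger0_norm ?sqr_ge0// expr2 lerDl.
by apply: sumr_ge0 => j _; rewrite -expr2 sqr_ge0.
Qed.

Lemma measurable_dot d (T : measurableType d) (f g : T -> 'rV[R]_n) :
  measurable_fun setT f -> measurable_fun setT g ->
  measurable_fun setT (fun z => dot (f z) (g z)).
Proof.
move=> /measurable_fun_coordP mf /measurable_fun_coordP mg.
by apply: measurable_sum => i; exact: measurable_funM.
Qed.

Lemma measurable_enorm d (T : measurableType d) (f : T -> 'rV[R]_n) :
  measurable_fun setT f -> measurable_fun setT (fun z => enorm (f z)).
Proof.
move=> mf; apply: (@measurableT_comp _ _ _ _ _ _ (@Num.sqrt R)).
  apply: continuous_measurable_fun; exact: sqrt_continuous.
exact: measurable_dot.
Qed.

End euclidean_norm.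

(** * Smooth functions vanishing on a half-line *)

Section flat.
Context {R : realType}.
Implicit Types (t y : R).

(* Up to linear combinations, the family [flat] is closed under
   differentiation, so that all its members are smooth. *)
Definition flat (k : nat) t : R :=
  if 0 < t then t^-1 ^+ k * expR (- t^-1) else 0.

Lemma flat_ge0 k t : 0 <= flat k t.
Proof.
rewrite /flat; case: ifPn => // t0.
by rewrite mulr_ge0 ?expR_ge0// exprn_ge0// invr_ge0 ltW.
Qed.

Lemma flat_le0 k t : t <= 0 -> flat k t = 0.
Proof. by move=> t0; rewrite /flat ltNge t0. Qed.

Lemma flat0_le1 t : flat 0 t <= 1.
Proof.
rewrite /flat; case: ifPn => // t0; rewrite expr0 mul1r -expR0 ler_expR.
by rewrite lerNl oppr0 invr_ge0 ltW.
Qed.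

(** With z = y/(k+1), the bound z <= e^z is raised to the power k, and e^(k z) <= e^y. *)
Lemma exprn_le_expR k y : 0 <= y -> y ^+ k <= k.+1%:R ^+ k * expR y.
Proof.
move=> y0; have -> : expR y = expR (y / k.+1%:R) ^+ k.+1.
  by rewrite -expRM_natl mulrC divfK.
have yk : 0 <= y / k.+1%:R by rewrite divr_ge0.
have e1 : 1 + y / k.+1%:R <= expR (y / k.+1%:R) by exact: expR_ge1Dx.
have : (y / k.+1%:R) ^+ k <= expR (y / k.+1%:R) ^+ k.+1.
  apply: (@le_trans _ _ (expR (y / k.+1%:R) ^+ k)).
    apply: lerXn2r; rewrite ?nnegrE ?expR_ge0//.
    by apply: le_trans e1; rewrite lerDr.
  by rewrite exprS ler_peMl ?exprn_ge0 ?expR_ge0//; apply: le_trans e1; rewrite lerDl.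
rewrite expr_div_n ler_pdivrMr ?exprn_gt0// mulrC//.
Qed.

(** Quadratic decay makes the difference quotient of [flat k] at the origin tend to 0. *)
Lemma flat_le_sqr k t : 0 < t -> flat k t <= k.+3%:R ^+ k.+2 * t ^+ 2.
Proof.
move=> t0; rewrite /flat t0.
have y0 : 0 < t^-1 by rewrite invr_gt0.
have := @exprn_le_expR k.+2 t^-1 (ltW y0).
rewrite -ler_pdivrMr ?expR_gt0// -expRN => H.
rewrite (_ : t^-1 ^+ k = t^-1 ^+ k.+2 * t ^+ 2); last first.
  by rewrite -[k.+2]addn2 exprD -mulrA -exprMn mulVf ?gt_eqF// expr1n mulr1.
by rewrite mulrAC ler_wpM2r// exprn_ge0// ltW.
Qed.

(** With y = 1/t this reads (1 + y)^2 <= 4 e^y, a consequence of 1 + y/2 <= e^(y/2). The bound fits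
    both ends of the cutoff, with r = |x|^2: it is at most 4 at t = 1 - r/N for r < N, and equals
    4/(N r)^2 at t = N r - 1. *)
Lemma flat2_le t : -1 < t -> flat 2 t <= 4 / (1 + t) ^+ 2.
Proof.
move=> t1; have [t0|t0] := ltP 0 t; last first.
  by rewrite flat_le0// divr_ge0// sqr_ge0.
rewrite /flat t0; set y := t^-1.
have y0 : 0 < y by rewrite invr_gt0.
have -> : t = y^-1 by rewrite invrK.
have E : (1 + y) ^+ 2 <= 4 * expR y.
  have -> : expR y = expR (y / 2) ^+ 2 by rewrite -expRM_natl mulrC divfK.
  have := expR_ge1Dx (y / 2); set e := expR _ => He; nra.
rewrite expRN ler_pdivrMr ?expR_gt0// mulrAC ler_pdivlMr; last first.
  by rewrite exprn_gt0// addr_gt0// invr_gt0.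
have -> : y ^+ 2 * (1 + y^-1) ^+ 2 = (1 + y) ^+ 2.
  by rewrite -exprMn mulrDr mulr1 mulfV ?gt_eqF// addrC.
exact: E.
Qed.

Lemma is_derive_flat k t :
  is_derive t 1 (flat k) (flat k.+2 t - k%:R * flat k.+1 t).
Proof.
have [t0|t0|->] := ltgtP t 0.
- rewrite !flat_le0 ?mulr0 ?subrr; try exact: ltW.
  apply: (@near_eq_is_derive _ _ _ (fun=> 0)).
  - near=> z; rewrite flat_le0// ltW//.
    by near: z; exact: lt_nbhsl.
- rewrite /flat t0.
  apply: (@near_eq_is_derive _ _ _ (fun t => t^-1 ^+ k * expR (- t^-1))).
  - near=> z; rewrite (_ : 0 < z)//.
    by near: z; exact: lt_nbhsr.
  have tn0 : t != 0 by rewrite gt_eqF.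
  have dV : is_derive t 1 (fun t : R => t^-1) (- t ^- 2).
    apply: is_derive_eq; first exact: is_deriveV.
    by rewrite /GRing.scale /= mulr1.
  have dE : is_derive t 1 (fun t : R => expR (- t^-1)) (expR (- t^-1) * t ^- 2).
    apply: (@is_derive1_comp _ expR (fun t : R => - t^-1)).
    by rewrite -[X in is_derive _ _ _ X]opprK; exact: is_deriveN.
  have dX : is_derive t 1 (fun t : R => t^-1 ^+ k) (k%:R * t^-1 ^+ k.-1 * - t ^- 2).
    apply: (@is_derive1_comp _ (fun t : R => t ^+ k) (fun t : R => t^-1)).
    case: k => [|k]; first by rewrite mul0r; exact: is_derive_cst.
    split; first exact: exprn_derivable.
    by rewrite exp_derive /GRing.scale /= mulr1.
  apply: (@is_derive_eq _ _ _ _ _ _ _ _ (is_deriveM dX dE)).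
  rewrite /GRing.scale /= -exprVn.
  set a := t^-1; set e := expR _.
  case: k {dX} => [|k /=]; first by rewrite /=; ring.
  by rewrite /= !exprS; ring.
- rewrite !flat_le0// mulr0 subrr.
  have H : h^-1 *: ((flat k \o shift 0) (h *: (1 : R)) - flat k 0)
      @[h --> (0 : R)^'] --> (0 : R).
    rewrite flat_le0//; apply/cvgrPdist_le => e e0; near=> h.
    rewrite /= addr0 sub0r normrN subr0.
    rewrite [h *: 1]mulr1 normrM.
    have hn0 : h != 0 by near: h; exact: nbhs_dnbhs_neq.
    have hC : `|h| * (k.+3%:R ^+ k.+2) <= e.
      rewrite -ler_pdivlMr ?exprn_gt0//.
      by near: h; apply: dnbhs0_le; rewrite divr_gt0// exprn_gt0.
    have [h0|h0] := ltP 0 h; last by rewrite flat_le0// normr0 mulr0 ltW.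
    have hi : 0 <= h^-1 by rewrite invr_ge0 ltW.
    rewrite (ger0_norm (flat_ge0 _ _)) (ger0_norm hi).
    apply: le_trans hC; rewrite mulrC ler_pdivrMr// (gtr0_norm h0).
    by apply: le_trans (flat_le_sqr k h0) _; rewrite expr2; lra.
  split; last exact/cvg_lim.
  by apply/cvg_ex; exists 0.
Unshelve. all: by end_near. Qed.

Lemma continuous_flat k : continuous (flat k).
Proof.
move=> t; apply: differentiable_continuous; apply/derivable1_diffP.
by have [] := is_derive_flat k t.
Qed.

Lemma Cn_flat_comp n k j (L : 'rV[R]_n -> R) : (forall k, Cn k L) ->
  Cn k (fun x => flat j (L x)).
Proof.
move=> CL; have cL := Cn_continuous (CL 0%N).
have cF j' : continuous (fun x => flat j' (L x)).
  move=> x; apply: (@cvg_comp _ _ _ L); first exact: cL.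
  exact: continuous_flat.
elim: k j => [|k IHk] j; first by split.
have dL i x : derivable L x (delta_mx ord0 i).
  by have [_ /(_ i)[]] := CL 1%N.
have D i x : is_derive x (delta_mx ord0 i) (fun x => flat j (L x))
    ((flat j.+2 (L x) - j%:R * flat j.+1 (L x)) * partial i L x).
  apply: is_derive_comp_real; last exact: is_derive_flat.
  exact: derivableP.
split => // i; split; first by move=> x; have [] := D i x.
rewrite (_ : partial i _ = fun x =>
    (flat j.+2 (L x) + (fun=> - j%:R) x * flat j.+1 (L x)) * partial i L x).
  apply: CnM; last by have [_ /(_ i)[]] := CL k.+1.
  by apply: CnD; [exact: IHk|apply: CnM; [exact: Cn_cst|exact: IHk]].
by apply/funext => x; rewrite mulNr; apply: derive_val; exact: D.
Qed.

End flat.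

(** * Radial cutoff functions *)

Section cutoff.
Context {R : realType} {n : nat}.
Implicit Types (x y : 'rV[R]_n) (N : R).

(* The factor [expR 1] makes [cutoff N x] tend to 1 as N tends to infinity,
   for [x != 0]; the support lies in the annulus 1/N <= |x|^2 <= N. *)
Definition cutoff N x : R :=
  expR 1 * flat 0 (1 - dot x x / N) * flat 0 (N * dot x x - 1).

(* Dominates the dilation errors of [cutoff N]; it tends to 0 pointwise as [N]
   tends to infinity. *)
Definition cutoff_tail N x : R :=
  Num.min 1 (dot x x / N) + Num.min 1 (N * dot x x)^-1.

(** The gradient of [cutoff N] at [x] is this multiple of [x]; [flat 2] occurs as the derivative of
    [flat 0]. *)
Definition cutoff_coef N x : R := expR 1 *
  (flat 0 (1 - dot x x / N) * (flat 2 (N * dot x x - 1) * (2 * N)) -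
   flat 0 (N * dot x x - 1) * (flat 2 (1 - dot x x / N) * (2 / N))).

Definition annulus N : set 'rV[R]_n := [set x | N^-1 <= dot x x <= N].

Lemma cutoff_ge0 N x : 0 <= cutoff N x.
Proof. by rewrite !mulr_ge0 ?expR_ge0 ?flat_ge0. Qed.

Lemma flat0_onem_le t : 0 <= t -> expR 1 * flat 0 (1 - t) <= 1 :> R.
Proof.
move=> t0; rewrite /flat; case: ifPn => t1; last by rewrite mulr0.
rewrite expr0 mul1r -expRD -[leRHS]expR0 ler_expR subr_le0 invf_ge1//; lra.
Qed.

Lemma cutoff_le1 N x : 0 < N -> cutoff N x <= 1.
Proof.
move=> N0; apply: mulr_ile1; rewrite ?flat_ge0 ?flat0_le1//.
  by rewrite mulr_ge0 ?expR_ge0 ?flat_ge0.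
by apply: flat0_onem_le; rewrite divr_ge0 ?dot_ge0// ltW.
Qed.

Lemma cutoff_eq0 N x : 0 < N -> ~ annulus N x -> cutoff N x = 0.
Proof.
move=> N0 xN; have [h1|h1] := leP (dot x x) N^-1.
  rewrite /cutoff (@flat_le0 _ _ (N * dot x x - 1)) ?mulr0//.
  by rewrite subr_le0 mulrC -ler_pdivlMr// div1r.
have [h2|h2] := leP N (dot x x).
  rewrite /cutoff (@flat_le0 _ _ (1 - dot x x / N)) ?mulr0 ?mul0r//.
  by rewrite subr_le0 ler_pdivlMr// mul1r.
by case: xN; rewrite /annulus /= !ltW.
Qed.

Lemma smooth_cutoff N : smooth (cutoff N).
Proof.
apply/smoothP => k; apply: CnM; last first.
  apply: Cn_flat_comp => j.
  by apply: (CnD (f := fun x => N * dot x x)); [apply: (CnM (f := fun=> N)); [exact: Cn_cst|exact: Cn_dot]|exact: Cn_cst].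
apply: (CnM (f := fun=> expR 1)); first exact: Cn_cst.
apply: Cn_flat_comp => j; rewrite (_ : (fun _ => _) = fun x => 1 + (- N^-1) * dot x x).
  apply: CnD; first exact: Cn_cst.
  by apply: CnM; [exact: Cn_cst|exact: Cn_dot].
by apply/funext => x; rewrite mulNr [N^-1 * _]mulrC.
Qed.

Lemma is_derive_dot x v : is_derive x v (fun x => dot x x) (2 * dot x v).
Proof.
have sL : smooth (fun x : 'rV[R]_n => dot x x).
  by apply/smoothP => k; exact: Cn_dot.
have := smooth_is_derive x v sL; set d := dot v _.
suff -> : d = 2 * dot x v by [].
rewrite /d /dot mulr_sumr; apply: eq_bigr => i _; rewrite mxE /partial /dot.
rewrite [X in v ord0 i * X = _](_ : _ = 2 * x ord0 i); first by ring.
apply: derive_val; rewrite (_ : (fun _ => _) = \sum_(j < n) (fun x => x ord0 j * x ord0 j)).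
  apply: is_derive_eq.
    apply: is_derive_sum => j; apply: is_deriveM; exact: derivable_coord.
  rewrite (bigD1 i)//= eqxx big1 ?addr0 => [|j ji].
    by rewrite /GRing.scale /= mulr1; ring.
  by rewrite eq_sym (negbTE ji) scaler0 addr0.
by apply/funext => y; rewrite fct_sumE.
Qed.

Lemma grad_cutoff N x : grad (cutoff N) x = cutoff_coef N x *: x.
Proof.
apply/rowP => i; rewrite !mxE /partial; apply: derive_val.
have dd : is_derive x (delta_mx ord0 i) (fun x => dot x x) (2 * x ord0 i).
  have := is_derive_dot x (delta_mx ord0 i).
  rewrite [X in 2 * X](_ : _ = x ord0 i)// /dot (bigD1 i)//= mxE !eqxx mulr1.
  rewrite big1 ?addr0// => j ji; rewrite mxE eqxx /=.
  by rewrite (negbTE ji) mulr0.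
have f0 (L : 'rV[R]_n -> R) (dL : R) : is_derive x (delta_mx ord0 i) L dL ->
    is_derive x (delta_mx ord0 i) (fun x => flat 0 (L x)) (flat 2 (L x) * dL).
  move=> HL; apply: is_derive_comp_real => //.
  by have := is_derive_flat 0 (L x); rewrite mul0r subr0.
have d1 : is_derive x (delta_mx ord0 i) (fun x => 1 - dot x x / N) (- (2 * x ord0 i / N)).
  rewrite (_ : (fun _ => _) = (fun y => (fun=> 1) y + (- N^-1) *: dot y y)); last first.
    by apply/funext => y; rewrite /GRing.scale /= mulNr [N^-1 * _]mulrC.
  apply: is_derive_eq; rewrite add0r /GRing.scale/=; ring.
have d2 : is_derive x (delta_mx ord0 i) (fun x => N * dot x x - 1) (N * (2 * x ord0 i)).
    have := is_deriveB (is_deriveZ N dd) (is_derive_cst (1 : R) x (delta_mx ord0 i)).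
  by rewrite subr0.
have dA : is_derive x (delta_mx ord0 i) (fun x => expR 1 * flat 0 (1 - dot x x / N)) (expR 1 * (flat 2 (1 - dot x x / N) * - (2 * x ord0 i / N))).
  exact: (is_deriveZ (expR 1) (f0 _ _ d1)).
apply: (@is_derive_eq _ _ _ _ _ _ _ _ (is_deriveM dA (f0 _ _ d2))).
by rewrite /GRing.scale /= /cutoff_coef; ring.
Qed.

Lemma cutoff_tail_ge0 N x : 0 < N -> 0 <= cutoff_tail N x.
Proof.
move=> N0; have d0 := dot_ge0 x.
by rewrite addr_ge0// le_min ler01/= ?divr_ge0 ?invr_ge0 ?mulr_ge0// ltW.
Qed.

Lemma cutoff_tail_le2 N x : cutoff_tail N x <= 2.
Proof.
by rewrite -[leRHS]/(1 + 1 : R) lerD// ge_min lexx.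
Qed.

Lemma flat2_tailr (t : R) : 0 <= t -> flat 2 (1 - t) * t <= 4 * Num.min 1 t.
Proof.
move=> t0; have [t1|t1] := ltP t 1; last first.
  rewrite flat_le0 ?mul0r; first by rewrite mulr_ge0// le_min ler01.
  by rewrite subr_le0.
rewrite ler_wpM2r//.
apply: (le_trans (flat2_le _)); first by lra.
rewrite ler_pdivrMr; last by rewrite exprn_gt0//; lra.
by rewrite ler_peMr// -[leLHS](expr1n _ 2) ler_pXn2r// ?nnegrE; lra.
Qed.

Lemma flat2_taill (y : R) : 0 <= y -> flat 2 (y - 1) * y <= 4 * Num.min 1 y^-1.
Proof.
move=> y0; have [y1|y1] := leP y 1.
  rewrite flat_le0 ?mul0r; first by rewrite mulr_ge0// le_min ler01 invr_ge0.
  by rewrite subr_le0.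
have y0' : 0 < y by lra.
rewrite min_r; last by rewrite invf_le1// ltW.
have y1' : -1 < y - 1 by lra.
have := flat2_le y1'; rewrite (_ : 1 + (y - 1) = y); last by lra.
move=> H; apply: (@le_trans _ _ (4 / y ^+ 2 * y)); first by rewrite ler_wpM2r.
by rewrite expr2 invfM mulrA mulfVK ?gt_eqF.
Qed.

(** The chain rule factors 2/N and 2N combine with |x|^2 into the arguments |x|^2/N and N|x|^2, for
    which [flat2_tailr] and [flat2_taill] give bounds free of N. Thus |x| |grad (cutoff N)| is
    controlled by the tail uniformly in N. *)
Lemma cutoff_coef_le N x : 0 < N ->
  `|cutoff_coef N x| * dot x x <= 8 * expR 1 * cutoff_tail N x.
Proof.
move=> N0; have d0 := dot_ge0 x; set r := dot x x in d0 *.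
have e0 := expR_ge0 (1 : R).
have -> : 8 * expR 1 * cutoff_tail N x = expR 1 *
    (2 * (4 * Num.min 1 (r / N)) + 2 * (4 * Num.min 1 (N * r)^-1)).
  by rewrite /cutoff_tail -/r; ring.
rewrite /cutoff_coef -/r normrM (ger0_norm e0) -mulrA ler_wpM2l//.
have H1 : flat 2 (1 - r / N) * (r / N) <= 4 * Num.min 1 (r / N).
  by apply: flat2_tailr; rewrite divr_ge0// ltW.
have H2 : flat 2 (N * r - 1) * (N * r) <= 4 * Num.min 1 (N * r)^-1.
  by apply: flat2_taill; rewrite mulr_ge0// ltW.
have f1 := @flat0_le1 R (1 - r / N); have f2 := @flat0_le1 R (N * r - 1).
have g1 := @flat_ge0 R 0 (1 - r / N); have g2 := @flat_ge0 R 0 (N * r - 1).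
have h1 := @flat_ge0 R 2 (1 - r / N); have h2 := @flat_ge0 R 2 (N * r - 1).
apply: (@le_trans _ _ ((flat 2 (N * r - 1) * (2 * N) + flat 2 (1 - r / N) * (2 / N)) * r)).
  rewrite ler_wpM2r//; apply: le_trans (ler_normB _ _) _.
  rewrite !ger0_norm ?mulr_ge0 ?invr_ge0//; try by apply: ltW.
  rewrite lerD// ler_piMl// ?mulr_ge0 ?invr_ge0//; exact: ltW.
have -> : (flat 2 (N * r - 1) * (2 * N) + flat 2 (1 - r / N) * (2 / N)) * r =
  2 * (flat 2 (1 - r / N) * (r / N)) + 2 * (flat 2 (N * r - 1) * (N * r)) by ring.
by rewrite lerD// ler_pM2l.
Qed.

(** The factor 1/|x| is the weight of Hardy's inequality, which keeps the terms with the gradient of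
    the cutoff integrable. *)
Lemma dot_grad_cutoff_le N x (y : 'rV[R]_n) : 0 < N ->
  `|dot y (grad (cutoff N) x)| <=
  8 * expR 1 * cutoff_tail N x * (enorm y / enorm x).
Proof.
move=> N0; rewrite grad_cutoff dotZr normrM.
have [->|x0] := eqVneq x 0.
  have d0 : dot y (0 : 'rV[R]_n) = 0.
    by rewrite /dot big1// => i _; rewrite mxE mulr0.
  rewrite d0 normr0 mulr0 !mulr_ge0 ?expR_ge0 ?cutoff_tail_ge0 ?enorm_ge0//.
  by rewrite invr_ge0 enorm_ge0.
have ex0 : 0 < enorm x by rewrite lt_def enorm_ge0 enorm_eq0 x0.
rewrite mulrA ler_pdivlMr//.
apply: (@le_trans _ _ (`|cutoff_coef N x| * dot x x * enorm y)).
  rewrite -sqr_enorm expr2 -!mulrA ler_wpM2l//.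
  rewrite [leRHS]mulrC -mulrA mulrCA [leRHS]mulrA ler_wpM2r ?enorm_ge0//.
  exact: normr_dot.
by rewrite ler_wpM2r ?enorm_ge0// cutoff_coef_le.
Qed.

(** Compares the tail at the intermediate point of a mean value argument with the tail at [x]; 4 is
    the value of t^(-2) at t = 1/2. *)
Lemma cutoff_tail_scale N (t : R) x : 0 < N -> 2^-1 <= t <= 1 ->
  cutoff_tail N (t *: x) <= 4 * cutoff_tail N x.
Proof.
move=> N0 /andP[t1 t2]; rewrite /cutoff_tail dotZl dotZr mulrA.
set r := dot x x; have r0 : 0 <= r by exact: dot_ge0.
have t0 : 0 < t by lra.
have tt : 4^-1 <= t * t <= 1 by nra.
have m1 : Num.min 1 (t * t * r / N) <= Num.min 1 (r / N).
  rewrite le_min ge_min lexx /= ge_min; apply/orP; right.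
  apply: ler_wpM2r; first by rewrite invr_ge0 ltW.
  by rewrite ler_piMl//; case/andP: tt.
have m1' : 0 <= Num.min 1 (r / N) by rewrite le_min ler01 divr_ge0// ltW.
have m2 : Num.min 1 (N * (t * t * r))^-1 <= 4 * Num.min 1 (N * r)^-1.
  have [->|rn] := eqVneq r 0.
    by rewrite !mulr0 invr0 min_r// mulr0.
  have rp : 0 < r by rewrite lt_def rn.
  have [h|h] := leP 1 (N * r)^-1.
    by rewrite mulr1 ge_min (_ : (1 : R) <= 4)//; lra.
  rewrite ge_min; apply/orP; right.
  rewrite mulrCA invfM ler_wpM2r ?invr_ge0 ?mulr_ge0//; try exact: ltW.
  by rewrite invf_ple ?posrE ?mulr_gt0//; case/andP: tt.
lra.
Qed.

(** Mean value theorem on the segment from x/l to x. The constant is 2 . 8 . 4: a factor 1/c <= 2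
    from the intermediate point c x, then [cutoff_coef_le] and [cutoff_tail_scale]. *)
Lemma cutoff_lipschitz N (l : R) x : 0 < N -> 1 <= l <= 2 ->
  `|cutoff N (l^-1 *: x) - cutoff N x| <=
  64 * expR 1 * (l - 1) * cutoff_tail N x.
Proof.
move=> N0 /andP[l1 l2].
have l0 : 0 < l by lra.
have D (t : R) : is_derive t 1 (fun t : R => cutoff N (t *: x + 0))
    (dot x (grad (cutoff N) (t *: x + 0))).
  apply: is_derive_line; apply: smooth_is_derive; exact: smooth_cutoff.
have cD : continuous (fun t : R => cutoff N (t *: x + 0)).
  move=> t; apply: differentiable_continuous; apply/derivable1_diffP.
  by have [] := D t.
have e0 := expR_ge0 (1 : R).
have m0 := cutoff_tail_ge0 x N0.
have [->|ln1] := eqVneq l 1.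
  by rewrite invr1 scale1r subrr normr0 subrr mulr0 mul0r.
have li1 : l^-1 < 1 by rewrite invf_lt1// lt_def ln1.
have [c] := @MVT R _ (fun t : R => dot x (grad (cutoff N) (t *: x + 0)))
  _ _ li1 (fun t _ => D t) (continuous_subspaceT cD).
rewrite in_itv/= !addr0 scale1r => /andP[c1 c2] E.
have cc : 2^-1 <= c <= 1.
  have := c1; have : 2^-1 <= l^-1 by rewrite lef_pV2 ?posrE.
  by lra.
have c0 : 0 < c by move: cc; lra.
have li0 : 0 <= 1 - l^-1 by rewrite subr_ge0 ltW.
rewrite distrC E normrM (ger0_norm li0).
have B : `|dot x (grad (cutoff N) (c *: x))| <= 64 * expR 1 * cutoff_tail N x.
  rewrite grad_cutoff dotZr dotZr.
  have := @cutoff_coef_le N (c *: x) N0.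
  rewrite dotZl dotZr => H.
  have T := @cutoff_tail_scale N c x N0 cc.
  move: H; set k0 := cutoff_coef _ _; move: k0 => k0 H.
  have r0 := dot_ge0 x; move: H; set r := dot x x in r0 * => H.
  have cr : 0 <= c * r by rewrite mulr_ge0// ltW.
  rewrite normrM (ger0_norm cr); move: H.
  have : 0 <= `|k0| by []; move: (`|k0|) => k k_ge0 H.
  have kr : 0 <= k * (c * r) by rewrite mulr_ge0.
  apply: (@le_trans _ _ (2 * (k * (c * (c * r))))); first by nra.
  apply: (@le_trans _ _ (2 * (8 * expR 1 * (4 * cutoff_tail N x)))).
    rewrite ler_pM2l//; apply: le_trans H _.
    by rewrite ler_wpM2l// mulr_ge0.
  by lra.
have L : 1 - l^-1 <= l - 1.
  have : l * l^-1 = 1 by rewrite mulfV ?gt_eqF.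
  have : 0 < l^-1 by rewrite invr_gt0.
  nra.
rewrite mulrAC ler_pM// subr_ge0 ltW//.
Qed.

Lemma annulus0 N : 0 < N -> ~ annulus N 0.
Proof.
move=> N0; rewrite /annulus /= -sqr_enorm enorm0 expr0n /=.
by move=> /andP[]; rewrite leNgt invr_gt0 N0.
Qed.

Lemma continuous_dot : continuous (fun x : 'rV[R]_n => dot x x).
Proof. exact: (Cn_continuous (Cn_dot 0)). Qed.

Lemma compact_annulus N : compact (annulus N).
Proof.
apply: bounded_closed_compact.
  exists (N + 1); split; [exact: num_real|move=> M NM x /andP[_ xN]].
  have [N0|N0] := leP 0 N; last by have := dot_ge0 x; lra.
  apply: le_trans (rV_norm_enorm x) _.
  rewrite -(@ler_pXn2r _ 2) ?nnegrE ?enorm_ge0//; last by lra.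
  by rewrite sqr_enorm; nra.
rewrite (_ : annulus N = (fun x => dot x x) @^-1` `[N^-1, N]%classic); last first.
  by apply/seteqP; split => x /=; rewrite in_itv.
apply: closed_comp; last exact: interval_closed.
by move=> x _; exact: continuous_dot.
Qed.

Lemma test_function_supp (phi : 'rV[R]_n -> R) (K : set 'rV[R]_n) :
  smooth phi -> compact K -> (forall x, ~ K x -> phi x = 0) ->
  test_function phi.
Proof.
move=> sphi cK phi0; split => //.
apply: (@subclosed_compact _ _ K) => //; first exact: closed_closure.
apply: subset_trans (_ : closure K `<=` K).
  apply: closure_subset => x /= /eqP px; apply: contrapT => /phi0; exact: px.
have /closure_id <- // : closed K.
by apply: compact_closed => //; exact: norm_hausdorff.
Qed.

Lemma test_function_cutoffM N (phi : 'rV[R]_n -> R) : 0 < N ->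
  smooth phi -> test_function (fun x => cutoff N x * phi x).
Proof.
move=> N0 sphi; apply: (test_function_supp _ (compact_annulus (N := N))).
  apply/smoothP => k; apply: CnM.
    exact: (proj1 (smoothP _) (smooth_cutoff N)).
  exact: (proj1 (smoothP _) sphi).
by move=> x /(cutoff_eq0 N0) ->; rewrite mul0r.
Qed.

End cutoff.

(** * Real-valued integrals *)

Section real_integral.
Context d (T : measurableType d) (R : realType).
Variable mu : {measure set T -> \bar R}.
Implicit Types f g h : T -> R.

(** Integrability is carried along as a separate fact, so that integrals are real numbers and [ring]
    and [lra] apply to them. *)
Definition L1 f : Prop := mu.-integrable setT (EFin \o f).

Lemma L1_measurable f : L1 f -> measurable_fun setT f.
Proof. by move=> /integrableP[/measurable_EFinP]. Qed.

Lemma L1D f g : L1 f -> L1 g -> L1 (fun x => f x + g x).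
Proof. by move=> Hf Hg; exact: (integrableD measurableT Hf Hg). Qed.

Lemma L1Z (k : R) f : L1 f -> L1 (fun x => k * f x).
Proof. by move=> Hf; exact: (integrableZl measurableT k Hf). Qed.

Lemma L1B f g : L1 f -> L1 g -> L1 (fun x => f x - g x).
Proof. by move=> Hf Hg; exact: (integrableB measurableT Hf Hg). Qed.

Lemma L1_norm f : L1 f -> L1 (fun x => `|f x|).
Proof. exact: integrable_norm. Qed.

Lemma intD f g : L1 f -> L1 g ->
  \int[mu]_x (f x + g x) = \int[mu]_x f x + \int[mu]_x g x.
Proof. exact: RintegralD. Qed.

Lemma intB f g : L1 f -> L1 g ->
  \int[mu]_x (f x - g x) = \int[mu]_x f x - \int[mu]_x g x.
Proof. exact: RintegralB. Qed.

Lemma intZ (k : R) f : L1 f -> \int[mu]_x (k * f x) = k * \int[mu]_x f x.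
Proof. by move=> Hf; rewrite RintegralZl. Qed.

Lemma L1ZD (a b : R) f g : L1 f -> L1 g -> L1 (fun x => a * f x + b * g x).
Proof. by move=> Hf Hg; apply: L1D; exact: L1Z. Qed.

Lemma intZD (a b : R) f g : L1 f -> L1 g ->
  \int[mu]_x (a * f x + b * g x) = a * \int[mu]_x f x + b * \int[mu]_x g x.
Proof.
by move=> Hf Hg; rewrite (intD (L1Z a Hf) (L1Z b Hg)) (intZ a Hf) (intZ b Hg).
Qed.

Lemma L1_ae_le f g : measurable_fun setT f -> L1 g ->
  {ae mu, forall x, `|f x| <= g x} -> L1 f.
Proof.
move=> mf Hg fg; have mg := L1_measurable Hg.
move/integrableP: Hg => [_ goo]; apply/integrableP; split.
  exact/measurable_EFinP.
apply: le_lt_trans goo; apply: ae_ge0_le_integral => //.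
- by apply/measurable_EFinP; exact: measurableT_comp.
- by apply/measurable_EFinP; exact: measurableT_comp.
- apply: filterS fg => x fgx _ /=; rewrite lee_fin.
  exact: le_trans fgx (ler_norm _).
Qed.

Lemma L1_le f g : measurable_fun setT f -> L1 g ->
  (forall x, `|f x| <= g x) -> L1 f.
Proof. by move=> mf Hg fg; apply: L1_ae_le mf Hg _; exact/aeW. Qed.

Lemma int_ae_eq f g : measurable_fun setT f -> measurable_fun setT g ->
  {ae mu, forall x, f x = g x} -> \int[mu]_x f x = \int[mu]_x g x.
Proof.
move=> mf mg fg; rewrite /Rintegral; congr fine.
apply: ae_eq_integral => //; try exact/measurable_EFinP.
by apply: filterS fg => x -> _.
Qed.

Lemma int_ae_le f g : L1 f -> L1 g -> {ae mu, forall x, f x <= g x} ->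
  \int[mu]_x f x <= \int[mu]_x g x.
Proof.
move=> Hf Hg fg.
have mf := L1_measurable Hf; have mg := L1_measurable Hg.
(* The maximum equals g almost everywhere and dominates f everywhere, which reduces the claim to a
   pointwise inequality. *)
have mh : measurable_fun setT (fun x => Num.max (f x) (g x)).
  exact: measurable_maxr.
rewrite (@int_ae_eq g (fun x => Num.max (f x) (g x)))//; last first.
  by apply: filterS fg => x fgx; rewrite max_r.
apply: le_Rintegral => //; last by move=> x _; rewrite le_max lexx.
apply: (L1_ae_le mh (L1D (L1_norm Hf) (L1_norm Hg))).
apply/aeW => x; rewrite /Num.max; case: ifP => _; first by rewrite lerDr.
by rewrite lerDl.
Qed.

Lemma int_le f g : L1 f -> L1 g -> (forall x, f x <= g x) ->
  \int[mu]_x f x <= \int[mu]_x g x.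
Proof. by move=> Hf Hg fg; apply: int_ae_le => //; exact/aeW. Qed.

Lemma int_norm_le f g : measurable_fun setT f -> L1 g ->
  {ae mu, forall x, `|f x| <= g x} -> `|\int[mu]_x f x| <= \int[mu]_x g x.
Proof.
move=> mf Hg fg; have Hf := L1_ae_le mf Hg fg.
apply: le_trans (le_normr_Rintegral _ Hf) _ => //.
by apply: int_ae_le => //; exact: L1_norm.
Qed.

Lemma int_ge0 f : (forall x, 0 <= f x) -> 0 <= \int[mu]_x f x.
Proof. by move=> f0; exact: Rintegral_ge0. Qed.

Lemma L1_EFin f : L1 f -> (\int[mu]_x (f x)%:E = (\int[mu]_x f x)%:E)%E.
Proof.
by move=> Hf; rewrite /Rintegral fineK//; exact: integrable_fin_num.
Qed.

Lemma L1_ge0P f : measurable_fun setT f -> (forall x, 0 <= f x) ->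
  L1 f <-> (\int[mu]_x (f x)%:E < +oo)%E.
Proof.
move=> mf f0; split.
  by move=> Hf; rewrite L1_EFin// ltry.
move=> Hf; apply/integrableP; split; first exact/measurable_EFinP.
by under eq_integral do rewrite /= ger0_norm//.
Qed.

(** Fatou's lemma with bounds that need only converge, and with integrability of the limit in the
    conclusion: this is how Hardy's inequality and the finiteness of the nonlinear integrals are
    obtained. *)
Lemma fatou_real (f_ : nat -> T -> R) f (c_ : nat -> R) (c : R) :
  (forall k, L1 (f_ k)) -> (forall k x, 0 <= f_ k x) ->
  measurable_fun setT f -> (forall x, 0 <= f x) ->
  {ae mu, forall x, f_ k x @[k --> \oo] --> f x} ->
  (forall k, \int[mu]_x f_ k x <= c_ k) ->
  c_ k @[k --> \oo] --> c ->
  L1 f /\ \int[mu]_x f x <= c.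
Proof.
move=> Hf_ f_0 mf f0 f_f Hc cc.
have mf_ k : measurable_fun setT (f_ k) by exact: L1_measurable.
suff H : (\int[mu]_x (f x)%:E <= c%:E)%E.
  have Hf : L1 f by apply/L1_ge0P => //; exact: le_lt_trans H (ltry _).
  by split => //; rewrite -lee_fin -L1_EFin.
(* Multiplication by the indicator of the complement of a null set makes the convergence hold
   everywhere. *)
have [N [mN N0 NP]] := f_f.
have mI : measurable_fun setT (fun x => \1_(~` N) x : R).
  exact: measurable_indic (measurableC mN).
have cI x : f_ k x * \1_(~` N) x @[k --> \oo] --> f x * \1_(~` N) x.
  rewrite indicE; case: (boolP (x \in ~` N)) => [|_].
    rewrite inE => xN; rewrite !mulr1; under eq_fun do rewrite mulr1.
    by apply: contrapT => H; apply: xN; apply: NP.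
  by rewrite mulr0; under eq_fun do rewrite mulr0; exact: cvg_cst.
have -> : (\int[mu]_x (f x)%:E =
    \int[mu]_x limn_einf (fun k => (f_ k x * \1_(~` N) x)%:E))%E.
  transitivity (\int[mu]_x (f x * \1_(~` N) x)%:E)%E.
    apply: ae_eq_integral => //.
    - exact/measurable_EFinP.
    - by apply/measurable_EFinP; exact: measurable_funM.
    - exists N; split => // x; apply: contra_notP => xN _.
      by rewrite indicE mem_set// mulr1.
  apply: eq_integral => x _.
  have cE : (f_ k x * \1_(~` N) x)%:E @[k --> \oo] --> (f x * \1_(~` N) x)%:E.
    by apply: cvg_EFin; [exact: nearW|exact: cI].
  by rewrite (cvg_limn_einf_sup cE).1.
have cE : (c_ k)%:E @[k --> \oo] --> c%:E.
  by apply: cvg_EFin => //; exact: nearW.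
apply: (le_trans (@fatou _ _ _ mu setT measurableT
    (fun k x => (f_ k x * \1_(~` N) x)%:E) _ _)).
- by move=> k; apply/measurable_EFinP; exact: measurable_funM.
- by move=> k x _; rewrite lee_fin mulr_ge0// indicE; case: (_ \in _).
rewrite limn_einf_lim -(cvg_lim _ cE)//; apply: lee_lim.
- exact: is_cvg_einfs.
- by apply/cvg_ex; exists c%:E.
apply: nearW => k; apply: (@le_trans _ _ (\int[mu]_x (f_ k x * \1_(~` N) x)%:E)%E).
  by apply: ereal_inf_lbound; exists k => /=.
apply: (@le_trans _ _ (\int[mu]_x (f_ k x)%:E)%E).
  apply: ge0_le_integral => //.
  - by move=> x _; rewrite lee_fin mulr_ge0// indicE; case: (_ \in _).
  - by apply/measurable_EFinP; exact: measurable_funM.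
  - exact/measurable_EFinP.
  - by move=> x _; rewrite lee_fin ler_piMr// indicE; case: (_ \in _).
by rewrite L1_EFin// lee_fin.
Qed.

Lemma dominated_real (f_ : nat -> T -> R) f g :
  (forall k, measurable_fun setT (f_ k)) -> measurable_fun setT f -> L1 g ->
  {ae mu, forall x, f_ k x @[k --> \oo] --> f x} ->
  (forall k, {ae mu, forall x, `|f_ k x| <= g x}) ->
  L1 f /\ \int[mu]_x f_ k x @[k --> \oo] --> \int[mu]_x f x.
Proof.
move=> mf_ mf Hg f_f f_g.
have [||||Hf _ H] := @dominated_convergence _ _ _ mu setT measurableT
    (fun k x => (f_ k x)%:E) (fun x => (f x)%:E) (fun x => (g x)%:E) _ _ _ Hg.
- by move=> k; exact/measurable_EFinP.
- exact/measurable_EFinP.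
- by apply: filterS f_f => x f_fx _; apply: cvg_EFin => //; exact: nearW.
- by have := ae_foralln f_g; apply: filterS => x H k _; rewrite lee_fin.
split => //.
have Hf_ k : L1 (f_ k) by exact: L1_ae_le (mf_ k) Hg (f_g k).
apply: fine_cvg; rewrite -L1_EFin//.
Qed.

(** Along indices where the integral is at most 2^(-k), the sum of the series has a finite integral,
    hence is finite almost everywhere, and the terms of a convergent series tend to 0. *)
Lemma ae_cvg_subseq (f_ : nat -> T -> R) :
  (forall k, L1 (f_ k)) -> (forall k x, 0 <= f_ k x) ->
  \int[mu]_x f_ k x @[k --> \oo] --> 0 ->
  exists2 sg : nat -> nat, (forall k, (k <= sg k)%N) &
    {ae mu, forall x, f_ (sg k) x @[k --> \oo] --> 0}.
Proof.
move=> Hf_ f_0 Hc.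
have H0 k : exists j, (k <= j)%N /\ \int[mu]_x f_ j x <= 2^-1 ^+ k.
  have /cvgrPdist_le/(_ (2^-1 ^+ k)) [|K _ HK] := Hc.
    by rewrite exprn_gt0// invr_gt0.
  exists (maxn k K); split; first exact: leq_maxl.
  have := HK (maxn k K) (leq_maxr _ _).
  by rewrite /= sub0r normrN; apply: le_trans; exact: ler_norm.
pose sg k := projT1 (cid (H0 k)).
have sgP k : (k <= sg k)%N /\ \int[mu]_x f_ (sg k) x <= 2^-1 ^+ k.
  exact: projT2 (cid (H0 k)).
exists sg; first by move=> k; have [] := sgP k.
pose F x := (\sum_(k <oo) (f_ (sg k) x)%:E)%E.
have mF k : measurable_fun setT (fun x => (f_ (sg k) x)%:E).
  by apply/measurable_EFinP; exact: L1_measurable.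
have iF : (\int[mu]_x F x < +oo)%E.
  rewrite /F integral_nneseries//; last by move=> k x _; rewrite lee_fin.
  apply: (@le_lt_trans _ _ (\sum_(k <oo) (2^-1 ^+ k)%:E)%E).
    apply: lee_nneseries => k *.
      by apply: integral_ge0 => x _; rewrite lee_fin.
    by rewrite L1_EFin// lee_fin; have [] := sgP k.
  rewrite (_ : (\sum_(k <oo) (2^-1 ^+ k)%:E)%E = 2%:E) ?ltry//.
  apply/cvg_lim => //.
  rewrite (_ : (fun _ => _) = (fun N => (series (geometric 1 (2^-1 : R)) N)%:E)).
    apply: cvg_EFin; first exact: nearW.
    have h2 : `|2^-1 : R| < 1 by rewrite ger0_norm; lra.
    have := @cvg_geometric_series R 1 _ h2.
    by rewrite (_ : 1 / (1 - 2^-1) = 2 :> R)//; field.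
  apply/funext => N; rewrite /series /= sumEFin; congr EFin.
  by apply: eq_bigr => k _; rewrite /geometric /= mul1r.
have mFF : measurable_fun setT F.
  apply: ge0_emeasurable_sum => //.
    by move=> k x _ _; rewrite lee_fin.
have HF : mu.-integrable setT F.
  apply/integrableP; split => //.
  under eq_integral => x _.
    rewrite gee0_abs; last by apply: nneseries_ge0 => k _ _; rewrite lee_fin.
    over.
  exact: iF.
have := integrable_ae measurableT HF; apply: filterS => x /(_ Logic.I) Fx.
apply: (@cvg_series_cvg_0 _ _ (fun k => f_ (sg k) x)).
apply: nondecreasing_is_cvgn.
  by apply: nondecreasing_series => k _ _.
exists (fine (F x)) => _ [N _ <-].
rewrite -lee_fin fineK// /series /= -sumEFin.
by apply: nneseries_lim_ge => k _; rewrite lee_fin.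
Qed.

Lemma int_eq0_ae f : L1 f -> (forall x, 0 <= f x) -> \int[mu]_x f x <= 0 ->
  {ae mu, forall x, f x = 0}.
Proof.
move=> Hf f0 If; have mf := L1_measurable Hf.
have : (\int[mu]_x `|(EFin \o f) x| = 0)%E.
  under eq_integral do rewrite /= ger0_norm//.
  rewrite L1_EFin//; congr EFin; apply/eqP; rewrite eq_le If /=.
  exact: int_ge0.
have mEf : measurable_fun setT (EFin \o f) by exact/measurable_EFinP.
move/(ae_eq_integral_abs mu measurableT mEf); apply: filterS => x /= /(_ Logic.I).
by case.
Qed.

End real_integral.

(** * Inequalities for real powers *)

Section powR_inequalities.
Context {R : realType}.
Implicit Types a b t p r : R.

Lemma mulr_powR_pred p a : 0 < p -> 0 <= a -> a `^ (p - 1) * a = a `^ p.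
Proof. by move=> p0 a0; rewrite mulrC mulr_powRB1. Qed.

(** Young's inequality for a^(p-1) and b with exponents p/(p-1) and p. The sharp constants matter:
    with them it is the tangent inequality of t^p. *)
Lemma young_powR p a b : 1 < p -> 0 <= a -> 0 <= b ->
  a `^ (p - 1) * b <= (1 - p^-1) * a `^ p + b `^ p / p.
Proof.
move=> p1 a0 b0; have p0 : 0 < p by lra.
have q0 : 0 < p / (p - 1) by rewrite divr_gt0//; lra.
have := @conjugate_powR R (a `^ (p - 1)) b (p / (p - 1)) p (powR_ge0 _ _) b0
  q0 p0.
rewrite -powRrM (_ : (p - 1) * (p / (p - 1)) = p); last first.
  by field; lra.
rewrite (_ : (p / (p - 1))^-1 = 1 - p^-1); last by field; rewrite !gt_eqF//; lra.
by rewrite subrK (mulrC (1 - _)); apply.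
Qed.

Lemma mulr_powR_le p a b : 1 < p -> 0 <= a -> 0 <= b ->
  a `^ (p - 1) * b <= a `^ p + b `^ p.
Proof.
move=> p1 a0 b0; apply: le_trans (young_powR p1 a0 b0) _.
have p0 : 0 < p^-1 by rewrite invr_gt0; lra.
have pi1 : p^-1 < 1 by rewrite invf_lt1//; lra.
have := powR_ge0 a p; have := powR_ge0 b p; set x := a `^ p; set y := b `^ p.
nra.
Qed.

Lemma powR_inv a r : 0 <= a -> (a^-1) `^ r = (a `^ r)^-1.
Proof. by move=> a0; rewrite -powR_inv1// -powRrM mulN1r powRN. Qed.

(** The product is unchanged when a is replaced by k a and b by b/k^(p-1), so either summand can be
    given a small coefficient. *)
Lemma mulr_powR_le_scaled p k a b : 1 < p -> 0 < k -> 0 <= a -> 0 <= b ->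
  a `^ (p - 1) * b <= k `^ p * a `^ p + (k `^ ((p - 1) * p))^-1 * b `^ p.
Proof.
move=> p1 k0 a0 b0.
have kp0 : 0 < k `^ (p - 1) by exact: powR_gt0.
have kb : 0 <= b / k `^ (p - 1) by rewrite divr_ge0// ltW.
have ka : 0 <= k * a by rewrite mulr_ge0// ltW.
have := mulr_powR_le p1 ka kb; rewrite !powRM ?(ltW k0)//; last first.
  by rewrite invr_ge0 ltW.
rewrite (_ : k `^ (p - 1) * a `^ (p - 1) * (b / k `^ (p - 1)) = a `^ (p - 1) * b).
  move=> /le_trans; apply; rewrite lerD2l mulrC.
  by rewrite powR_inv ?(ltW kp0)// -powRrM.
by field; rewrite gt_eqF.
Qed.

Lemma powR_inv_root p e : 0 < p -> 0 < e -> (e `^ p^-1) `^ p = e.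
Proof.
by move=> p0 e0; rewrite -powRrM mulVf ?gt_eqF// powRr1// ltW.
Qed.

Lemma mulr_powR_le_epsl p e : 1 < p -> 0 < e -> exists2 C, 0 < C &
  forall a b, 0 <= a -> 0 <= b -> a `^ (p - 1) * b <= e * a `^ p + C * b `^ p.
Proof.
move=> p1 e0; have p0 : 0 < p by lra.
have k0 : 0 < e `^ p^-1 by exact: powR_gt0.
exists (((e `^ p^-1) `^ ((p - 1) * p))^-1); first by rewrite invr_gt0 powR_gt0.
move=> a b a0 b0; have := mulr_powR_le_scaled p1 k0 a0 b0.
by rewrite powR_inv_root.
Qed.

Lemma mulr_powR_le_epsr p e : 1 < p -> 0 < e -> exists2 C, 0 < C &
  forall a b, 0 <= a -> 0 <= b -> a `^ (p - 1) * b <= C * a `^ p + e * b `^ p.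
Proof.
move=> p1 e0; have p0 : 0 < (p - 1) * p by rewrite mulr_gt0//; lra.
have k0 : 0 < e^-1 `^ ((p - 1) * p)^-1 by rewrite powR_gt0 ?invr_gt0.
exists ((e^-1 `^ ((p - 1) * p)^-1) `^ p); first by rewrite powR_gt0.
move=> a b a0 b0; have := mulr_powR_le_scaled p1 k0 a0 b0.
by rewrite (@powR_inv_root ((p - 1) * p)) ?invr_gt0// invrK.
Qed.

Lemma ler_powR_base r a b : 0 <= r -> 0 <= a -> a <= b -> a `^ r <= b `^ r.
Proof.
move=> r0 a0 ab; apply: ge0_ler_powR => //; rewrite nnegrE//.
exact: le_trans ab.
Qed.

(** If b <= e a then a + b <= (1 + e) a, otherwise a + b <= (1 + 1/e) b. For small e the coefficient
    of a^p is close to 1, which leaves room for absorption. *)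
Lemma powRD_le p e a b : 0 <= p -> 0 < e -> 0 <= a -> 0 <= b ->
  (a + b) `^ p <= (1 + e) `^ p * a `^ p + (1 + e^-1) `^ p * b `^ p.
Proof.
move=> p0 e0 a0 b0.
have ei0 : 0 < e^-1 by rewrite invr_gt0.
rewrite -!powRM ?addr_ge0 ?(ltW ei0) ?(ltW e0)//.
have [ba|ab] := leP b (e * a).
  apply: (@le_trans _ _ (((1 + e) * a) `^ p)); last by rewrite lerDl powR_ge0.
  by rewrite ler_powR_base ?addr_ge0//; nra.
apply: (@le_trans _ _ (((1 + e^-1) * b) `^ p)); last by rewrite lerDr powR_ge0.
rewrite ler_powR_base ?addr_ge0// mulrDl mul1r addrC lerD2l.
by rewrite mulrC ler_pdivlMr// mulrC ltW.
Qed.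

(** Split at the t with t^al = e. On a set of finite measure this trades a power for a higher one
    whose integral is known to tend to 0. *)
Lemma powR_le_eps al be e : 0 < al -> al <= be -> 0 < e ->
  exists2 C, 0 < C & forall t, 0 <= t -> t `^ al <= e + C * t `^ be.
Proof.
move=> al0 ab e0; set d := e `^ al^-1.
have d0 : 0 < d by exact: powR_gt0.
exists ((d `^ (be - al))^-1); first by rewrite invr_gt0 powR_gt0.
move=> t t0; have [td|dt] := leP t d.
  apply: (@le_trans _ _ e).
    by rewrite -[leRHS](powR_inv_root al0 e0) ler_powR_base// ltW.
  by rewrite lerDl mulr_ge0 ?invr_ge0 ?powR_ge0.
have tp : 0 < t by exact: lt_trans dt.
apply: (@le_trans _ _ ((d `^ (be - al))^-1 * t `^ be)); last by rewrite lerDr ltW.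
rewrite mulrC ler_pdivlMr ?powR_gt0//.
have -> : t `^ be = t `^ al * t `^ (be - al).
  rewrite -powRD; first by congr (_ `^ _); lra.
  by apply/implyP => _; rewrite gt_eqF.
rewrite ler_wpM2l ?powR_ge0// ler_powR_base ?(ltW dt)// ?(ltW d0)//; lra.
Qed.

Lemma powR_tangent r a b : 1 <= r -> 0 <= a -> 0 <= b ->
  a `^ r - b `^ r <= r * a `^ (r - 1) * (a - b).
Proof.
rewrite le_eqVlt => /predU1P[<- a0 b0|r1 a0 b0].
  by rewrite subrr powRr0 !powRr1// !mul1r.
have r0 : 0 < r by lra.
have := young_powR r1 a0 b0.
rewrite -(ler_pM2l r0) => H.
have E := mulr_powR_pred r0 a0.
have : r * ((1 - r^-1) * a `^ r + b `^ r / r) = (r - 1) * a `^ r + b `^ r.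
  by field; rewrite gt_eqF.
by move: H => /[swap] -> ; rewrite -E; lra.
Qed.

Lemma powR_subadd s a b : 0 < s -> s <= 1 -> 0 <= a -> 0 <= b ->
  (a + b) `^ s <= a `^ s + b `^ s.
Proof.
move=> s0 s1; rewrite le_eqVlt => /predU1P[<-|a0].
  by rewrite add0r powR0 ?add0r// gt_eqF.
rewrite le_eqVlt => /predU1P[<-|b0].
  by rewrite addr0 powR0 ?addr0// gt_eqF.
have ab0 : 0 < a + b by rewrite addr_gt0.
have F x : 0 < x -> x <= a + b -> x / (a + b) * (a + b) `^ s <= x `^ s.
  move=> x0 xab; have E : x = x / (a + b) * (a + b) by rewrite divfK ?gt_eqF.
  have y0 : 0 < x / (a + b) by rewrite divr_gt0.
  have y1 : x / (a + b) <= 1 by rewrite ler_pdivrMr// mul1r.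
  rewrite [X in _ <= X `^ _]E powRM ?(ltW y0) ?(ltW ab0)//.
  by rewrite ler_wpM2r ?powR_ge0// ger1_powR// y0.
have aab : a <= a + b by rewrite lerDl ltW.
have bab : b <= a + b by rewrite lerDr ltW.
have := lerD (F a a0 aab) (F b b0 bab).
by rewrite -mulrDl -mulrDl mulfV ?gt_eqF// mul1r.
Qed.

(** For s >= 1 the tangents give a Lipschitz bound on [0, M]; for s < 1 subadditivity gives the
    exponent s. *)
Lemma powR_hoelder_continuous s M : 0 < s -> 0 <= M ->
  exists C th, [/\ 0 <= C, 0 < th & forall a b, 0 <= a -> a <= b -> b <= M ->
    b `^ s - a `^ s <= C * (b - a) `^ th].
Proof.
move=> s0 M0; have [s1|s1] := leP 1 s.
  exists (s * M `^ (s - 1)), 1; split => //.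
    by rewrite mulr_ge0 ?powR_ge0// ltW.
  move=> a b a0 ab bM; rewrite powRr1 ?subr_ge0//.
  apply: le_trans (powR_tangent s1 _ _) _ => //; first exact: le_trans ab.
  rewrite ler_wpM2r ?subr_ge0// ler_wpM2l ?(ltW s0)// ler_powR_base//; first lra.
  exact: le_trans ab.
exists 1, s; split => // a b a0 ab bM; rewrite mul1r lerBlDl.
by rewrite -{1}(subrKC a b) powR_subadd ?subr_ge0// ltW.
Qed.

(* The derivative of [t |-> `|t| `^ r / r]. *)
Definition dpow r t : R := `|t| `^ (r - 2) * t.

Lemma norm_dpow r t : 1 < r -> `|dpow r t| = `|t| `^ (r - 1).
Proof.
move=> r1; rewrite /dpow normrM ger0_norm ?powR_ge0//.
have [->|t0] := eqVneq t 0; first by rewrite normr0 mulr0 powR0//; lra.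
rewrite -[X in _ * X]powRr1// -powRD; first by congr (_ `^ _); lra.
by apply/implyP => _; rewrite normr_eq0.
Qed.

Lemma dpowM r t : 1 < r -> dpow r t * t = `|t| `^ r.
Proof.
move=> r1; rewrite /dpow -mulrA -expr2 -real_normK ?num_real//.
have [->|t0] := eqVneq t 0; first by rewrite normr0 expr0n /= mulr0 powR0//; lra.
rewrite -powR_mulrn// -powRD; first by congr (_ `^ _); lra.
by apply/implyP => _; rewrite normr_eq0.
Qed.

Lemma dpow_convex r a b : 1 < r ->
  dpow r a * (b - a) <= (`|b| `^ r - `|a| `^ r) / r.
Proof.
move=> r1; rewrite mulrBr dpowM//.
have := @young_powR r `|a| `|b| r1 (normr_ge0 _) (normr_ge0 _).
rewrite -norm_dpow// -normrM; have := ler_norm (dpow r a * b).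
have : (1 - r^-1) * `|a| `^ r + `|b| `^ r / r - `|a| `^ r =
  (`|b| `^ r - `|a| `^ r) / r by field; lra.
by lra.
Qed.

(** [dpow r] is odd and equals a^(r-1) for a >= 0. Values of the same sign are compared by
    [powR_hoelder_continuous]; for opposite signs each is compared with 0, which doubles the
    constant. *)
Lemma dpow_hoelder_continuous r M : 1 < r -> 0 <= M ->
  exists C th, [/\ 0 <= C, 0 < th & forall a b, `|a| <= M -> `|b| <= M ->
    `|dpow r b - dpow r a| <= C * `|b - a| `^ th].
Proof.
move=> r1 M0; have r10 : 0 < r - 1 by lra.
have [C [th [C0 th0 H]]] := powR_hoelder_continuous r10 M0.
exists (2 * C), th; split => //; first by rewrite mulr_ge0.
have Hp a b : 0 <= a -> 0 <= b -> a <= M -> b <= M ->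
    `|b `^ (r - 1) - a `^ (r - 1)| <= 2 * C * `|b - a| `^ th.
  move=> a0 b0 aM bM.
  suff {a b a0 b0 aM bM} G a b : 0 <= a -> a <= b -> b <= M ->
      `|b `^ (r - 1) - a `^ (r - 1)| <= 2 * C * `|b - a| `^ th.
    have [ab|/ltW ba] := leP a b; first exact: G.
    by rewrite distrC (distrC b); exact: G.
  move=> a0 ab bM; have := H a b a0 ab bM; rewrite !ger0_norm ?subr_ge0//.
    by have := mulr_ge0 C0 (powR_ge0 (b - a) th); lra.
  by rewrite ler_powR_base// ltW.
have dE a : 0 <= a -> dpow r a = a `^ (r - 1).
  move=> a0; have := norm_dpow a r1; rewrite (ger0_norm a0) => <-.
  by rewrite ger0_norm// /dpow mulr_ge0 ?powR_ge0.
have dN a : dpow r (- a) = - dpow r a by rewrite /dpow normrN mulrN.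
have G a b : 0 <= a -> `|a| <= M -> `|b| <= M ->
    `|dpow r b - dpow r a| <= 2 * C * `|b - a| `^ th.
  move=> a0 aM bM; have [b0|b0] := leP 0 b.
    rewrite !dE//; apply: Hp => //; first by rewrite -(ger0_norm a0).
    by rewrite -(ger0_norm b0).
  have nb : 0 <= - b by rewrite oppr_ge0 ltW.
  have -> : dpow r b - dpow r a = - (dpow r (- b) + dpow r a).
    by rewrite dN; lra.
  have -> : b - a = - (- b + a) by lra.
  rewrite !normrN.
  rewrite !dE// ger0_norm ?addr_ge0 ?powR_ge0// (@ger0_norm _ (- b + a)) ?addr_ge0//.
  have Hz x : 0 <= x -> x <= M -> x <= - b + a ->
      x `^ (r - 1) <= C * (- b + a) `^ th.
    move=> x0 xM xa; have := H 0 x (lexx _) x0 xM.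
    rewrite powR0 ?gt_eqF// !subr0 => /le_trans; apply.
    by rewrite ler_wpM2l// ler_powR_base// ltW.
  have h1 : (- b) `^ (r - 1) <= C * (- b + a) `^ th.
    apply: Hz => //; last by rewrite lerDl.
    by rewrite -(ger0_norm nb) normrN.
  have h2 : a `^ (r - 1) <= C * (- b + a) `^ th.
    apply: Hz => //; last by rewrite lerDr.
    by rewrite -(ger0_norm a0).
  by lra.
move=> a b aM bM; have [a0|a0] := leP 0 a; first exact: G.
have -> : dpow r b - dpow r a = - (dpow r (- b) - dpow r (- a)).
  by rewrite !dN; lra.
have -> : b - a = - (- b - - a) by lra.
rewrite !normrN.
by apply: G; rewrite ?normrN// oppr_ge0 ltW.
Qed.

(* The first-order Taylor remainder of [t |-> `|t| `^ r / r].  The Hoelder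
   continuity of [dpow r] makes it small relative to [`|b - a|] for close [a] and
   [b], and [`|b - a| `^ p] absorbs the rest. *)
Lemma dpow_defect r p M e : 1 < r -> 1 < p -> 0 <= M -> 0 < e ->
  exists2 C, 0 <= C & forall a b, `|a| <= M -> `|b| <= M ->
    `|(`|b| `^ r - `|a| `^ r) / r - dpow r a * (b - a)| <=
    e * `|b - a| + C * `|b - a| `^ p.
Proof.
move=> r1 p1 M0 e0.
have [C [th [C0 th0 H]]] := dpow_hoelder_continuous r1 M0.
set d := (e / (C + 1)) `^ th^-1.
have C1 : 0 < C + 1 by lra.
have eC0 : 0 < e / (C + 1) by rewrite divr_gt0.
have d0 : 0 < d by exact: powR_gt0.
have dth : d `^ th = e / (C + 1) by exact: powR_inv_root.
pose C' := C * (2 * M) `^ th / d `^ (p - 1).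
exists C'; first by rewrite !mulr_ge0 ?invr_ge0 ?powR_ge0.
move=> a b aM bM.
(* Convexity at a makes the remainder non-negative; convexity at b bounds it by (dpow r b - dpow r
   a) (b - a). *)
have c1 := @dpow_convex r a b r1; have c2 := @dpow_convex r b a r1.
rewrite ger0_norm ?subr_ge0//.
have ab0 := normr_ge0 (b - a).
apply: (@le_trans _ _ (`|dpow r b - dpow r a| * `|b - a|)).
  rewrite -normrM; apply: le_trans (ler_norm _).
  have : (`|b| `^ r - `|a| `^ r) / r = - ((`|a| `^ r - `|b| `^ r) / r).
    by rewrite -mulNr opprB.
  lra.
have Hab := H a b aM bM.
have [hd|hd] := leP `|b - a| d.
  apply: (@le_trans _ _ (e * `|b - a|)); last first.
    by rewrite lerDl !mulr_ge0 ?invr_ge0 ?powR_ge0.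
  rewrite ler_wpM2r//; apply: le_trans Hab _.
  apply: (@le_trans _ _ (C * (e / (C + 1)))).
    by rewrite ler_wpM2l// -dth ler_powR_base// ltW.
  by rewrite mulrCA ler_piMr ?(ltW e0)// ler_pdivrMr// mul1r lerDl.
apply: (@le_trans _ _ (C' * `|b - a| `^ p)); last by rewrite lerDr mulr_ge0// ltW.
have p0 : 0 < p by lra.
rewrite -(mulr_powR_pred p0 ab0) mulrA ler_wpM2r//.
apply: le_trans Hab _; rewrite /C' -mulrA -mulrA ler_wpM2l//.
apply: (@le_trans _ _ ((2 * M) `^ th)).
  apply: ler_powR_base => //; first exact: ltW.
  by apply: le_trans (ler_normB _ _) _; lra.
rewrite ler_peMr ?powR_ge0// mulrC ler_pdivlMr ?powR_gt0// mul1r.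
by rewrite ler_powR_base ?(ltW hd)//; lra.
Qed.

End powR_inequalities.

(** * Dilation differences *)

Section lebesgue_rV_facts.
Context {R : realType} {n : nat}.
Implicit Types (x y : 'rV[R]_n) (K : set 'rV[R]_n) (f g : 'rV[R]_n -> R).
Local Notation m := (lebesgue_rV R n).

Lemma L1_dilation (l : R) f : 0 < l -> (forall x, 0 <= f x) -> L1 m f ->
  L1 m (fun x => f (l *: x)) /\
  \int[m]_x f (l *: x) = (l ^+ n)^-1 * \int[m]_x f x.
Proof.
move=> l0 f0 Hf; have mf := L1_measurable Hf.
have mfl : measurable_fun setT (fun x : 'rV[R]_n => f (l *: x)).
  by apply: (measurableT_comp mf); exact: measurable_scale_rV.
have E := @ge0_integral_dilation R n l (EFin \o f) l0
  (proj2 (measurable_EFinP _ _) mf) (fun x => f0 x).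
have ln0 : 0 < l ^+ n by rewrite exprn_gt0.
have Hfl : L1 m (fun x => f (l *: x)).
  apply/L1_ge0P => //; move: E; rewrite /= L1_EFin// => E.
  rewrite ltey; apply/eqP => Jy; move: E.
  by rewrite Jy mulry gtr0_sg// mul1e.
split => //; move: E; rewrite /= !L1_EFin// -EFinM => -[->].
by rewrite mulKf// gt_eqF.
Qed.

Lemma ae_dilation (l : R) (P : 'rV[R]_n -> Prop) : 0 < l ->
  {ae m, forall x, P x} -> {ae m, forall x, P (l *: x)}.
Proof.
move=> l0 [N [mN N0 NP]].
exists ((fun x : 'rV[R]_n => l *: x) @^-1` N); split.
- by rewrite -[X in measurable X]setTI; apply: measurable_scale_rV.
- have E := @ge0_integral_dilation R n l (fun x => (\1_N x)%:E) l0
    (proj2 (measurable_EFinP _ _) (measurable_indic mN)) _.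
  have ln0 : 0 < l ^+ n by rewrite exprn_gt0.
  move: E; rewrite integral_indic//= setIT N0 => /(_ (fun x => _))/wrap[] => [x|].
    by rewrite lee_fin indicE; case: (_ \in _).
  rewrite (_ : (\int[m]_x (\1_N (l *: x))%:E)%E = (\int[m]_x (\1_((fun x : 'rV[R]_n => l *: x) @^-1` N) x)%:E)%E); last first.
    by apply: eq_integral => x _; rewrite !indicE.
  rewrite integral_indic//=; last first.
    by rewrite -[X in measurable X]setTI; apply: measurable_scale_rV.
  rewrite setIT => /esym/eqP; rewrite mule_eq0 => /orP[/eqP[] /eqP|/eqP//].
  by rewrite gt_eqF.
- by move=> x /=; exact: NP.
Qed.

Lemma compact_measurable_rV K : compact K -> measurable K.
Proof.
move=> cK; rewrite -[K]setCK; apply: measurableC; apply: open_measurable_rV.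
apply: closed_openC; apply: compact_closed => //; exact: norm_hausdorff.
Qed.

Lemma compact_lty K : compact K -> (m K < +oo)%E.
Proof.
move=> cK; have [M [_ HM]] := compact_bounded cK.
pose a := `|M| + 1.
have Ma : M < a by rewrite /a; have := ler_norm M; lra.
pose B := [set x : 'rV[R]_n | forall i : 'I_n, `[- a, a]%classic (x ord0 i)].
have KB : K `<=` B.
  move=> x Kx i; rewrite /= in_itv /= -ler_norml.
  exact: le_trans (le_rV_norm x i) (HM a Ma x Kx).
have mB : measurable B.
  rewrite (_ : B = \bigcap_(i in [set: 'I_n])
      ((fun x : 'rV[R]_n => x ord0 i) @^-1` `[- a, a]%classic)).
    apply: fin_bigcap_measurable; first exact: finite_finset.
    move=> i _; rewrite -[X in measurable X]setTI.
    exact: measurable_coord.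
  by apply/seteqP; split=> [x Bx i _|x Bx i]; exact: Bx.
apply: (@le_lt_trans _ _ (m B)).
  by apply: le_measure; rewrite ?inE//; exact: compact_measurable_rV.
have -> : m B = (\prod_(i < n) @lebesgue_measure R `[(- a)%R, a]%classic)%E.
  by apply: (@lebesgue_rV_box R n (fun=> `[(- a)%R, a]%classic)).
have : (\prod_(i < n) @lebesgue_measure R `[(- a)%R, a]%classic)%E \is a fin_num.
  apply: (big_ind (fun y : \bar R => y \is a fin_num)) => //.
    by move=> x y; exact: fin_numM.
  by move=> i _; rewrite lebesgue_measure_itv; case: ifP.
by rewrite fin_numE ltey => /andP[].
Qed.

Lemma L1_compact_indic K : compact K -> L1 m (fun x => \1_K x).
Proof.
move=> cK; have mK := compact_measurable_rV cK.
apply/L1_ge0P => //; first exact: measurable_indic.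
by rewrite integral_indic// setIT compact_lty.
Qed.

Lemma L1_bounded_supp f (C : R) K : measurable_fun setT f -> compact K ->
  (forall x, `|f x| <= C * \1_K x) -> L1 m f.
Proof.
move=> mf cK fC; apply: (L1_le mf _ fC).
by apply: L1Z; exact: L1_compact_indic.
Qed.

Lemma continuous_supp_bounded f K : continuous f -> compact K ->
  (forall x, ~ K x -> f x = 0) ->
  exists2 C, 0 <= C & forall x, `|f x| <= C * \1_K x.
Proof.
move=> cf cK f0.
have cfK : compact (f @` K).
  by apply: continuous_compact => //; exact: continuous_subspaceT.
have [M [_ HM]] := compact_bounded cfK.
exists (`|M| + 1) => [|x]; first by rewrite addr_ge0.
rewrite indicE; have [|] := boolP (x \in K).
  rewrite inE => Kx; rewrite mulr1; apply: HM; last by exists x.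
  by have := ler_norm M; lra.
by rewrite notin_setE => /f0 ->; rewrite normr0 mulr0.
Qed.

Lemma measurable_grad f : smooth f -> measurable_fun setT (grad f).
Proof.
move=> sf; apply/measurable_fun_coordP => i; under eq_fun do rewrite mxE.
by apply: continuous_measurable_rV; apply: smooth_continuous; exact: smooth_partial.
Qed.

Lemma smooth_measurable f : smooth f -> measurable_fun setT f.
Proof. by move=> sf; apply: continuous_measurable_rV; exact: smooth_continuous. Qed.

Lemma test_function_bounded phi : test_function phi ->
  exists C K, [/\ 0 <= C, compact K, forall x, `|phi x| <= C * \1_K x &
    forall x, enorm (grad phi x) <= C * \1_K x].
Proof.
move=> [sphi cK]; set K := closure _ in cK.
have phi0 x : ~ K x -> phi x = 0.
  move=> Kx; apply/eqP/negP => /negP px; apply: Kx.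
  exact: subset_closure.
have [C C0 HC] := continuous_supp_bounded (smooth_continuous sphi) cK phi0.
have dphi0 i x : ~ K x -> partial i phi x = 0.
  move=> Kx; rewrite /partial -(derive_cst (0 : R) x (delta_mx ord0 i)).
  apply: near_eq_derive.
  have : nbhs x (~` K).
    apply: open_nbhs_nbhs; split => //; apply: closed_openC; exact: closed_closure.
  by apply: filterS => y /phi0.
have /choice[c Hc] : forall i, exists c, 0 <= c /\ forall x, `|partial i phi x| <= c * \1_K x.
  move=> i; have [c c0 H] := continuous_supp_bounded
    (smooth_continuous (@smooth_partial R n i phi sphi)) cK (dphi0 i).
  by exists c.
have c0 i : 0 <= c i by have [] := Hc i.
have s0 : 0 <= \sum_i c i by exact: sumr_ge0.
exists (C + \sum_i c i), K; split => //; first by rewrite addr_ge0.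
  by move=> x; apply: le_trans (HC x) _; rewrite ler_wpM2r ?lerDl//.
move=> x; apply: (@le_trans _ _ (\sum_i c i * \1_K x)); last first.
  by rewrite -mulr_suml ler_wpM2r ?lerDr//.
apply: (@le_trans _ _ (\sum_i `|partial i phi x|)); last first.
  by apply: ler_sum => i _; have [_] := Hc i; exact.
rewrite -(@ler_pXn2r _ 2) ?nnegrE ?enorm_ge0 ?sumr_ge0//.
rewrite sqr_enorm expr2 mulr_suml; apply: ler_sum => i _; rewrite mxE.
rewrite -expr2 -real_normK ?num_real// expr2 ler_wpM2l// (bigD1 i)//= lerDl.
exact: sumr_ge0.
Qed.

Lemma measurable_powR_fun d (T : measurableType d) (f0 : T -> R) (r : R) :
  measurable_fun setT f0 -> measurable_fun setT (fun z => f0 z `^ r).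
Proof. exact: (measurableT_comp (measurable_powR r)). Qed.

Lemma measurable_inv_fun d (T : measurableType d) (f0 : T -> R) :
  (forall z, 0 <= f0 z) ->
  measurable_fun setT f0 -> measurable_fun setT (fun z => (f0 z)^-1).
Proof.
move=> f00 mf; under eq_fun do rewrite -powR_inv1//.
exact: measurable_powR_fun.
Qed.

Lemma measurable_enorm_id : measurable_fun setT (fun x : 'rV[R]_n => enorm x).
Proof. exact: measurable_enorm. Qed.

Lemma L1_powR_test phi p : 0 < p -> test_function phi ->
  L1 m (fun x => enorm (grad phi x) `^ p).
Proof.
move=> p0 tphi; have [C [K [C0 cK _ HC]]] := test_function_bounded tphi.
apply: (@L1_bounded_supp _ (C `^ p) K) => //.
  apply: measurable_powR_fun; apply: measurable_enorm; apply: measurable_grad.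
  exact: tphi.1.
move=> x; rewrite ger0_norm ?powR_ge0//.
have := HC x; rewrite indicE; case: (x \in K); rewrite /= ?mulr1 ?mulr0 => H.
  by rewrite ler_powR_base ?enorm_ge0// ltW.
have -> : enorm (grad phi x) = 0 by apply/eqP; rewrite eq_le H enorm_ge0.
by rewrite powR0 ?gt_eqF.
Qed.

End lebesgue_rV_facts.

(** * Difference quotients along dilations *)

Section dilation_difference.
Context {R : realType} {n : nat}.
Implicit Types (x y : 'rV[R]_n) (phi : 'rV[R]_n -> R) (p l : R).
Local Notation m := (lebesgue_rV R n).

(** Hoelder continuity on [0, a + 1] also covers the limit a = 0. *)
Lemma cvg_powR (T : Type) (F : set_system T) (FF : Filter F) (w : T -> R) (a p : R) :
  0 < p -> 0 <= a -> (forall t, 0 <= w t) -> w t @[t --> F] --> a ->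
  w t `^ p @[t --> F] --> a `^ p.
Proof.
move=> p0 a0 w0 cw; apply/cvgrPdist_le => e e0 /=.
have M0 : 0 <= a + 1 by rewrite addr_ge0.
have [C [th [C0 th0 H]]] := powR_hoelder_continuous p0 M0.
have d0 : 0 < (e / (C + 1)) `^ th^-1.
  by rewrite powR_gt0// divr_gt0// ltr_wpDl.
have /cvgrPdist_le Ht := cw.
near=> s.
have sd : `|a - w s| <= (e / (C + 1)) `^ th^-1 by near: s; exact: Ht.
have s1 : `|a - w s| <= 1 by near: s; exact: Ht.
have ws : w s <= a + 1 by move: s1; rewrite ler_norml; lra.
have B : C * `|a - w s| `^ th <= e.
  apply: (@le_trans _ _ (C * (e / (C + 1)))).
    rewrite ler_wpM2l// -[leRHS](powR_inv_root th0) ?divr_gt0 ?ltr_wpDl//.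
    by rewrite ler_powR_base// ltW.
  by rewrite mulrCA ler_piMr ?(ltW e0)// ler_pdivrMr ?mul1r ?lerDl// ltr_wpDl.
apply: le_trans B; have [h|h] := leP (w s) a.
  rewrite !ger0_norm ?subr_ge0 ?ler_powR_base ?(ltW p0)//.
  by apply: H => //; rewrite lerDl.
rewrite distrC (distrC a) !ger0_norm ?subr_ge0 ?ler_powR_base ?(ltW p0) ?(ltW h)//.
by apply: H => //; exact: ltW.
Unshelve. all: by end_near. Qed.

Lemma continuous_powR_comp (w : R -> R) p : 0 < p -> (forall t, 0 <= w t) ->
  continuous w -> continuous (fun t => w t `^ p).
Proof. by move=> p0 w0 cw t; apply: cvg_powR => //; exact: cw. Qed.

(** Jensen's inequality: integrate the tangent inequality of t^p at the mean [M] of [w]. *)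
Lemma jensen_powR d (T : measurableType d) (mu : {measure set T -> \bar R})
    (D : set T) (w : T -> R) p (c : R) : 1 < p -> measurable D ->
  0 < c -> mu D = c%:E ->
  mu.-integrable D (EFin \o w) -> mu.-integrable D (EFin \o (fun t => w t `^ p)) ->
  (forall t, 0 <= w t) ->
  (\int[mu]_(t in D) w t) `^ p <= c `^ (p - 1) * \int[mu]_(t in D) (w t `^ p).
Proof.
move=> p1 mD c0 muD iw iwp w0; have p0 : 0 < p by lra.
set J := \int[mu]_(t in D) w t.
have J0 : 0 <= J by apply: Rintegral_ge0.
pose M := J / c.
have M0 : 0 <= M by rewrite divr_ge0// ltW.
have icst k : mu.-integrable D (EFin \o (fun=> k)).
  apply/integrableP; split; first exact: measurable_cst.
  by rewrite /= integral_cst//= muD -EFinM ltry.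
have K : \int[mu]_(t in D) (M `^ p - p * M `^ (p - 1) * M + p * M `^ (p - 1) * w t) <=
    \int[mu]_(t in D) (w t `^ p).
  apply: le_Rintegral => //.
    exact: (integrableD mD (icst (M `^ p - p * M `^ (p - 1) * M))
      (integrableZl mD (p * M `^ (p - 1)) iw)).
  move=> t _; have := powR_tangent (ltW p1) M0 (w0 t); lra.
move: K; rewrite (RintegralD mD (icst _) (integrableZl mD (p * M `^ (p - 1)) iw)).
rewrite RintegralZl// Rintegral_cst// muD -/J /=.
have -> : J = M * c by rewrite /M divfK// gt_eqF.
rewrite (_ : _ + _ = M `^ p * c); last by ring.
move=> K; rewrite powRM ?(ltW c0)// -(mulr_powR_pred p0 (ltW c0)).
by rewrite mulrCA ler_wpM2l ?powR_ge0.
Qed.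

Lemma normr_int_le_itv d (T : measurableType d) (mu : {measure set T -> \bar R})
    (D : set T) (g w : T -> R) (k : R) : measurable D ->
  mu.-integrable D (EFin \o g) -> mu.-integrable D (EFin \o w) ->
  (forall t, `|g t| <= k * w t) ->
  `|\int[mu]_(t in D) g t| <= k * \int[mu]_(t in D) w t.
Proof.
move=> mD ig iw gw; apply: le_trans (le_normr_Rintegral mD ig) _.
rewrite -RintegralZl//; apply: le_Rintegral => //.
- exact: (integrable_norm ig).
- exact: (integrableZl mD k iw).
Qed.

Lemma lebesgue_measure_segment1 l : 1 < l ->
  @lebesgue_measure R `[1, l]%classic = (l - 1)%:E.
Proof. by move=> l1; rewrite lebesgue_measure_itv /= lte_fin l1 -EFinB. Qed.

Lemma jensen_itv p l (w : R -> R) : 1 < p -> 1 < l -> continuous w ->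
  (forall t, 0 <= w t) ->
  (\int[@lebesgue_measure R]_(t in `[1, l]) w t) `^ p <=
  (l - 1) `^ (p - 1) * \int[@lebesgue_measure R]_(t in `[1, l]) (w t `^ p).
Proof.
move=> p1 l1 cw w0; have p0 : 0 < p by lra.
apply: jensen_powR => //.
- by rewrite subr_gt0.
- exact: lebesgue_measure_segment1.
- apply: continuous_compact_integrable; first exact: segment_compact.
  exact: continuous_subspaceT.
- apply: continuous_compact_integrable; first exact: segment_compact.
  by apply: continuous_subspaceT; exact: continuous_powR_comp.
Qed.

Lemma continuous_dot_grad phi x : smooth phi ->
  continuous (fun y => dot x (grad phi y)).
Proof.
move=> sphi; apply: (@Cn_continuous _ _ 0); apply: Cn_sum => i.
apply: (CnM (f := fun=> x ord0 i)); first exact: Cn_cst.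
rewrite (_ : (fun _ => _) = partial i phi); last first.
  by apply/funext => y; rewrite mxE.
exact: (proj1 (smoothP _) (@smooth_partial _ _ i phi sphi)).
Qed.

Lemma continuous_enorm_grad phi : smooth phi ->
  continuous (fun y => enorm (grad phi y)).
Proof.
move=> sphi y; apply: (@cvg_comp _ _ _ (fun y => dot (grad phi y) (grad phi y))); last first.
  exact: sqrt_continuous.
suff : continuous (fun y => dot (grad phi y) (grad phi y)) by exact.
apply: (@Cn_continuous _ _ 0); apply: Cn_sum => i.
have C : Cn 0 (fun y => grad phi y ord0 i).
  rewrite (_ : (fun _ => _) = partial i phi); last first.
    by apply/funext => z; rewrite mxE.
  exact: (proj1 (smoothP _) (@smooth_partial _ _ i phi sphi)).
exact: CnM.
Qed.

(** Fundamental theorem of calculus along the ray t x, 1 <= t <= l, then Cauchy-Schwarz and Jensen's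
    inequality on an interval of length l - 1. *)
Lemma dilation_difference_pointwise p l phi x : 1 < p -> 1 < l -> smooth phi ->
  `|phi (l *: x) - phi x| `^ p <= (l - 1) `^ (p - 1) * (enorm x `^ p *
    \int[@lebesgue_measure R]_(t in `[1, l]) (enorm (grad phi (t *: x)) `^ p)).
Proof.
move=> p1 l1 sphi; set D := `[1, l]%classic.
have p0 : 0 < p by lra.
have mD : measurable D by exact: measurable_itv.
have cg : continuous (fun t : R => dot x (grad phi (t *: x))).
  move=> t; apply: (@cvg_comp _ _ _ (fun t : R => t *: x)
      (fun y => dot x (grad phi y)) _ (nbhs (t *: x))).
    exact: scalel_continuous.
  exact: continuous_dot_grad.
have cw : continuous (fun t : R => enorm (grad phi (t *: x))).
  move=> t; apply: (@cvg_comp _ _ _ (fun t : R => t *: x)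
      (fun y => enorm (grad phi y)) _ (nbhs (t *: x))).
    exact: scalel_continuous.
  exact: continuous_enorm_grad.
have dF (t : R) : is_derive t (1 : R) (fun t : R => phi (t *: x))
    (dot x (grad phi (t *: x))).
  have := @is_derive_line R _ phi 0 x t (dot x (grad phi (t *: x))).
  under eq_fun do rewrite addr0.
  by rewrite addr0; apply; exact: smooth_is_derive.
have cF : continuous (fun t : R => phi (t *: x)).
  move=> t; apply: differentiable_continuous; apply/derivable1_diffP.
  by have [] := dF t.
have FTC : \int[@lebesgue_measure R]_(t in D) dot x (grad phi (t *: x)) =
    phi (l *: x) - phi x.
  rewrite /Rintegral (@continuous_FTC2 _ _ (fun t : R => phi (t *: x)))//.
  - by rewrite scale1r.
  - exact: continuous_subspaceT.
  - split; first by move=> t _; have [] := dF t.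
      by apply: cvg_at_right_filter; exact: cF.
    by apply: cvg_at_left_filter; exact: cF.
  - by move=> t _; rewrite derive1E; apply: derive_val; exact: dF.
have iw : (@lebesgue_measure R).-integrable D (EFin \o (fun t : R => enorm (grad phi (t *: x)))).
  apply: continuous_compact_integrable; first exact: segment_compact.
  exact: continuous_subspaceT.
have ig : (@lebesgue_measure R).-integrable D (EFin \o (fun t : R => dot x (grad phi (t *: x)))).
  apply: continuous_compact_integrable; first exact: segment_compact.
  exact: continuous_subspaceT.
have J0 : 0 <= \int[@lebesgue_measure R]_(t in D) enorm (grad phi (t *: x)).
  by apply: Rintegral_ge0 => t _; exact: enorm_ge0.
have B : `|phi (l *: x) - phi x| <=
    enorm x * \int[@lebesgue_measure R]_(t in D) enorm (grad phi (t *: x)).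
  rewrite -FTC; apply: normr_int_le_itv => // t.
  exact: normr_dot.
apply: (@le_trans _ _ ((enorm x * \int[@lebesgue_measure R]_(t in D) enorm (grad phi (t *: x))) `^ p)).
  by rewrite ler_powR_base// ltW.
rewrite powRM ?enorm_ge0// mulrCA ler_wpM2l ?powR_ge0//.
by apply: jensen_itv => // t; exact: enorm_ge0.
Qed.

(** Division by |x|^p cancels that factor in [dilation_difference_pointwise]. By Tonelli it remains
    to integrate |grad phi|^p at t x over x, which gives t^(-n) [A] with t >= 1; the length l - 1 of
    the interval completes the power p. *)
Lemma L1_dilation_difference p l phi : 1 < p -> 1 < l -> test_function phi ->
  L1 m (fun x => (`|phi (l *: x) - phi x| / enorm x) `^ p) /\
  \int[m]_x ((`|phi (l *: x) - phi x| / enorm x) `^ p) <=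
  (l - 1) `^ p * \int[m]_x (enorm (grad phi x) `^ p).
Proof.
move=> p1 l1 tphi; have sphi := tphi.1; set D := `[1, l]%classic.
have p0 : 0 < p by lra.
have mD : measurable D by exact: measurable_itv.
pose W (z : 'rV[R]_n * measurableTypeR R) : R :=
  enorm (grad phi (z.2 *: z.1)) `^ p * \1_D z.2.
have W0 z : 0 <= W z by rewrite mulr_ge0 ?powR_ge0.
have mW : measurable_fun setT W.
  apply: measurable_funM.
    apply: measurable_powR_fun; apply: measurable_enorm.
    apply: (measurableT_comp (measurable_grad sphi)).
    apply/measurable_fun_coordP => i; under eq_fun do rewrite mxE.
    apply: measurable_funM => //.
    by apply: (measurableT_comp (@measurable_coord _ _ n i)).
  exact: (measurableT_comp (measurable_indic mD)).
set A := \int[m]_x (enorm (grad phi x) `^ p).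
have HA := L1_powR_test p0 tphi.
have A0 : 0 <= A by apply: int_ge0 => x; exact: powR_ge0.
have inner t : (\int[m]_x (W (x, t))%:E <= (A * \1_D t)%:E)%E.
  rewrite /W /= indicE; have [|] := boolP (t \in D); last first.
    move=> _; rewrite mulr0; under eq_integral do rewrite mulr0.
    by rewrite integral0.
  rewrite inE /D /= in_itv/= mulr1 => /andP[t1 _].
  under eq_integral do rewrite mulr1.
  have t0 : 0 < t by lra.
  have [H1 H2] := L1_dilation t0 (fun x => powR_ge0 (enorm (grad phi x)) p) HA.
  rewrite (L1_EFin H1) lee_fin H2; apply: ler_piMl; first exact: A0.
  by rewrite invf_le1 ?exprn_gt0// exprn_ege1.
have mh : measurable_fun setT (fun x => (`|phi (l *: x) - phi x| / enorm x) `^ p).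
  apply: measurable_powR_fun; apply: measurable_funM; last first.
    by apply: measurable_inv_fun; [exact: enorm_ge0|exact: measurable_enorm_id].
  apply: measurableT_comp => //; apply: measurable_funB; last exact: smooth_measurable.
  by apply: (measurableT_comp (smooth_measurable sphi)); exact: measurable_scale_rV.
have l10 : 0 < l - 1 by lra.
have key : (\int[m]_x ((`|phi (l *: x) - phi x| / enorm x) `^ p)%:E <=
    ((l - 1) `^ p * A)%:E)%E.
  apply: (@le_trans _ _ (\int[m]_x (((l - 1) `^ (p - 1))%:E *
      \int[@lebesgue_measure R]_t (W (x, t))%:E))%E).
    apply: ge0_le_integral => //.
    - by move=> x _; rewrite lee_fin powR_ge0.
    - exact/measurable_EFinP.
    - apply: emeasurable_funM => //.
      apply: (measurable_fun_fubini_tonelli_F (EFin \o W)).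
        exact/measurable_EFinP.
      by move=> z; rewrite lee_fin.
    - move=> x _.
      have cw : continuous (fun t : R => enorm (grad phi (t *: x)) `^ p).
        move=> t; have := @continuous_powR_comp (fun t : R => enorm (grad phi (t *: x))) p.
        apply => //; first by move=> s; exact: enorm_ge0.
        move=> s; apply: (@cvg_comp _ _ _ (fun t : R => t *: x)
            (fun y => enorm (grad phi y)) _ (nbhs (s *: x))).
          exact: scalel_continuous.
        exact: continuous_enorm_grad.
      have iw : (@lebesgue_measure R).-integrable D (EFin \o (fun t : R => enorm (grad phi (t *: x)) `^ p)).
        apply: continuous_compact_integrable; first exact: segment_compact.
        exact: continuous_subspaceT.
      have -> : (\int[@lebesgue_measure R]_t (W (x, t))%:E =
          (\int[@lebesgue_measure R]_(t in D) (enorm (grad phi (t *: x)) `^ p))%:E)%E.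
        rewrite /Rintegral fineK; last exact: integrable_fin_num.
        rewrite [RHS]integral_mkcond; apply: eq_integral => t _.
        rewrite /W /= patchE indicE; case: ifP => _; by rewrite ?mulr1 ?mulr0.
      rewrite -EFinM lee_fin.
      have [->|x0] := eqVneq x 0.
        rewrite scaler0 subrr normr0 mul0r powR0 ?gt_eqF//.
        by rewrite mulr_ge0 ?powR_ge0//; apply: Rintegral_ge0 => t _; exact: powR_ge0.
      have ex0 : 0 < enorm x by rewrite lt_def enorm_ge0 enorm_eq0 x0.
      rewrite powRM ?invr_ge0 ?enorm_ge0// powR_inv ?enorm_ge0//.
      rewrite ler_pdivrMr ?powR_gt0// -mulrA [X in _ <= _ * X]mulrC.
      exact: dilation_difference_pointwise.
  rewrite ge0_integralZl//; first last.
  - by rewrite lee_fin powR_ge0.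
  - by move=> x _; apply: integral_ge0 => t _; rewrite lee_fin.
  - apply: (measurable_fun_fubini_tonelli_F (EFin \o W)).
      exact/measurable_EFinP.
    by move=> z; rewrite lee_fin.
  rewrite -(mulr_powR_pred p0 (ltW l10)) -mulrA EFinM.
  apply: lee_pmul => //.
  - by rewrite lee_fin powR_ge0.
  - by apply: integral_ge0 => x _; apply: integral_ge0 => t _; rewrite lee_fin.
  rewrite (fubini_tonelli (EFin \o W)); first last.
  - by move=> z; rewrite lee_fin.
  - exact/measurable_EFinP.
  apply: (@le_trans _ _ (\int[@lebesgue_measure R]_t (A%:E * (\1_D t)%:E))%E).
    apply: ge0_le_integral => //.
    - by move=> t _; apply: integral_ge0 => x _; rewrite lee_fin.
    - apply: (measurable_fun_fubini_tonelli_G (EFin \o W)).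
        exact/measurable_EFinP.
      by move=> z; rewrite lee_fin.
    - by apply: emeasurable_funM => //; apply/measurable_EFinP; exact: measurable_indic.
    - by move=> t _; exact: inner.
  rewrite ge0_integralZl//; last by apply/measurable_EFinP; exact: measurable_indic.
  rewrite integral_indic// setIT.
  rewrite [X in (_ * X)%E](lebesgue_measure_segment1 l1).
  by rewrite -EFinM mulrC.
have H : L1 m (fun x => (`|phi (l *: x) - phi x| / enorm x) `^ p).
  apply/L1_ge0P => //; first by move=> x; exact: powR_ge0.
  exact: le_lt_trans key (ltry _).
by split => //; rewrite -lee_fin -L1_EFin.
Qed.

End dilation_difference.

(** * Approximation and Hardy's inequality *)

Section approximation.
Context {R : realType} {n : nat}.
Implicit Types (x y : 'rV[R]_n) (phi v : 'rV[R]_n -> R) (V : 'rV[R]_n -> 'rV[R]_n).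
Implicit Types (p l : R) (psi : nat -> 'rV[R]_n -> R).
Local Notation m := (lebesgue_rV R n).

Lemma cvg_subseq (u : nat -> R) (a : R) (sg : nat -> nat) :
  (forall k, (k <= sg k)%N) -> u k @[k --> \oo] --> a ->
  u (sg k) @[k --> \oo] --> a.
Proof.
move=> Hs ua; apply: (cvg_comp sg u _ ua).
by apply/cvgnyPge => N; exists N => // k /= Nk; exact: leq_trans (Hs k).
Qed.

Lemma cvg_ext (u w : nat -> R) (a : R) : (forall k, u k = w k) ->
  u k @[k --> \oo] --> a -> w k @[k --> \oo] --> a.
Proof. by move=> /funext ->. Qed.

Lemma cvg_cstM (c a : R) (u : nat -> R) : u k @[k --> \oo] --> a ->
  c * u k @[k --> \oo] --> c * a.
Proof. by move=> ua; apply: cvgM; [exact: cvg_cst|exact: ua]. Qed.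

Lemma cvg_cstM0 (c : R) (u : nat -> R) : u k @[k --> \oo] --> 0 ->
  c * u k @[k --> \oo] --> 0.
Proof. by move=> u0; have := @cvg_cstM c 0 u u0; rewrite mulr0. Qed.

Lemma gt1_powR (a x : R) : 1 < a -> 0 < x -> 1 < a `^ x.
Proof.
move=> a1 x0; rewrite [ltLHS](_ : 1 = 1 `^ x); last by rewrite powR1.
by apply: gt0_ltr_powR => //; rewrite nnegrE; lra.
Qed.

(** Convergence in the extended reals makes the norms finite only from some rank [K] on. *)
Lemma Lnorm_cvg0 d (T : measurableType d) (mu : {measure set T -> \bar R})
    (f : nat -> T -> R) (r : R) : 0 < r ->
  (forall k, measurable_fun setT (f k)) ->
  Lnorm mu r%:E (fun z => (f k z)%:E) @[k --> \oo] --> 0%E ->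
  (exists K, forall k, (K <= k)%N -> L1 mu (fun z => `|f k z| `^ r)) /\
  \int[mu]_z (`|f k z| `^ r) @[k --> \oo] --> 0.
Proof.
move=> r0 mf /fine_cvgP[[K _ HK] fcvg].
have rn0 : r != 0 by rewrite gt_eqF.
have H k : (K <= k)%N -> (\int[mu]_z (`|f k z| `^ r)%:E)%E =
    ((fine (Lnorm mu r%:E (fun z => (f k z)%:E))) `^ r)%:E.
  move=> Kk; rewrite -poweR_EFin fineK; last exact: HK.
  by rewrite poweR_Lnorm//; apply: eq_integral => x _; rewrite poweR_EFin.
split.
  exists K => k Kk; apply/L1_ge0P; last by rewrite H// ltry.
  - by apply: measurable_powR_fun; exact: measurableT_comp.
  - by move=> x; exact: powR_ge0.
have : (fine (Lnorm mu r%:E (fun z => (f k z)%:E))) `^ r @[k --> \oo] --> (0 : R) `^ r.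
  apply: cvg_powR => //.
  by move=> k; rewrite fine_ge0// Lnorm_ge0.
rewrite powR0//; apply: cvg_trans; apply: near_eq_cvg.
by exists K => // k Kk /=; rewrite /Rintegral H.
Qed.

(** The convergence in [D1p_gradient], restated with real integrals of powers that are finite for
    every index. It is stable under dilation, so that u and u_l are treated alike. *)
Definition approximates p v V psi : Prop :=
  [/\ forall k, test_function (psi k),
    forall k, L1 m (fun x => `|psi k x - v x| `^ crit_exp n p),
    \int[m]_x (`|psi k x - v x| `^ crit_exp n p) @[k --> \oo] --> 0,
    forall k, L1 m (fun x => enorm (grad (psi k) x - V x) `^ p) &
    \int[m]_x (enorm (grad (psi k) x - V x) `^ p) @[k --> \oo] --> 0].

Lemma lt_crit_exp p : 1 < p -> p < n%:R -> p < crit_exp n p.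
Proof.
move=> p1 pn; rewrite /crit_exp ltr_pdivlMr; last by rewrite subr_gt0.
have p0 : 0 < p by lra.
by rewrite mulrC ltr_pM2r//; lra.
Qed.

Lemma D1p_approximates p v V : 1 < p -> p < n%:R -> D1p_gradient p v V ->
  exists2 psi, approximates p v V psi &
    {ae m, forall x, psi k x @[k --> \oo] --> v x}.
Proof.
move=> p1 pn [mv mV [phi [tphi phi_v phi_V]]].
have p0 : 0 < p by lra.
have q0 : 0 < crit_exp n p by exact: lt_trans (lt_crit_exp p1 pn).
have mphi k : measurable_fun setT (phi k) by exact: smooth_measurable (tphi k).1.
have [[K1 HK1] c1] := Lnorm_cvg0 q0
  (fun k => measurable_funB (mphi k) mv) phi_v.
have mg k : measurable_fun setT (fun x => enorm (grad (phi k) x - V x)).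
  apply: measurable_enorm; apply/measurable_fun_coordP => i.
  under eq_fun do rewrite !mxE.
  apply: measurable_funB.
    by apply: continuous_measurable_rV; apply: smooth_continuous; apply: smooth_partial; exact: (tphi k).1.
  exact: (measurableT_comp (@measurable_coord _ _ n i)).
have [[K2 HK2] c2] := Lnorm_cvg0 p0 mg phi_V.
(* A shift by [K] makes all integrals finite; a subsequence then converges almost everywhere. *)
pose K := maxn K1 K2.
have HK1' k : L1 m (fun x => `|phi (k + K)%N x - v x| `^ crit_exp n p).
  by apply: HK1; rewrite (leq_trans (leq_maxl K1 K2))// leq_addl.
have HK2' k : L1 m (fun x => enorm (grad (phi (k + K)%N) x - V x) `^ p).
  have := HK2 (k + K)%N; rewrite (leq_trans (leq_maxr K1 K2)) ?leq_addl// => /(_ isT).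
  by under eq_fun do rewrite ger0_norm ?enorm_ge0//.
have c1' := cvg_subseq (leq_addr K) c1.
have c2' : \int[m]_x (enorm (grad (phi (k + K)%N) x - V x) `^ p) @[k --> \oo] --> 0.
  apply: cvg_ext (cvg_subseq (leq_addr K) c2) => k.
  by apply: eq_Rintegral => x _; rewrite ger0_norm// enorm_ge0.
have [sg Hs ae_sg] := ae_cvg_subseq HK1' (fun k x => powR_ge0 _ _) c1'.
exists (fun k => phi (sg k + K)%N).
  split; [by move=> k; exact: tphi|by move=> k; exact: HK1'| |by move=> k; exact: HK2'|].
    exact: (cvg_subseq Hs c1').
  exact: (cvg_subseq Hs c2').
apply: filterS ae_sg => x Hx; apply/cvgrPdist_le => e e0.
have /cvgrPdist_le/(_ (e `^ crit_exp n p)) := Hx.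
rewrite powR_gt0// => /(_ isT); apply: filterS => k.
rewrite sub0r normrN ger0_norm ?powR_ge0// distrC => H.
rewrite leNgt; apply/negP => eH; move: H; apply/negP; rewrite -ltNge.
by apply: gt0_ltr_powR => //; rewrite nnegrE// ltW.
Qed.

Lemma approximates_L1_gradient p v V psi : 0 < p -> measurable_fun setT V ->
  approximates p v V psi -> L1 m (fun x => enorm (V x) `^ p).
Proof.
move=> p0 mV [tpsi _ _ H _].
apply: (@L1_le _ _ _ _ _ (fun x => (1 + 1) `^ p * enorm (grad (psi 0%N) x) `^ p +
   (1 + 1^-1) `^ p * enorm (grad (psi 0%N) x - V x) `^ p)).
- by apply: measurable_powR_fun; exact: measurable_enorm.
- by apply: L1D; apply: L1Z; [exact: L1_powR_test|exact: H].
move=> x; rewrite ger0_norm ?powR_ge0//.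
apply: le_trans (powRD_le (ltW p0) ltr01 (enorm_ge0 _) (enorm_ge0 _)).
rewrite ler_powR_base ?enorm_ge0 ?(ltW p0)//.
have := ler_enormD (grad (psi 0%N) x) (V x - grad (psi 0%N) x).
by rewrite subrKC -(enormN (V x - _)) opprB.
Qed.

Lemma approximates_int_grad p v V psi k : 0 < p -> measurable_fun setT V ->
  approximates p v V psi ->
  \int[m]_x (enorm (grad (psi k) x) `^ p) <=
  2 `^ p * \int[m]_x (enorm (V x) `^ p) +
  2 `^ p * \int[m]_x (enorm (grad (psi k) x - V x) `^ p).
Proof.
move=> p0 mV Ha; have HV := approximates_L1_gradient p0 mV Ha.
case: Ha => [tpsi _ _ H _].
rewrite -(intZD _ _ HV (H k)).
apply: int_le; [exact: L1_powR_test|exact: L1ZD|].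
move=> x; have := powRD_le (ltW p0) ltr01 (enorm_ge0 (V x)) (enorm_ge0 (grad (psi k) x - V x)).
rewrite invr1 -[1 + 1]/(2 : R); apply: le_trans.
rewrite ler_powR_base ?enorm_ge0 ?(ltW p0)//.
have := ler_enormD (V x) (grad (psi k) x - V x).
by rewrite subrKC.
Qed.

Lemma cvg_int_grad p v V psi (c : R) : 0 < p ->
  approximates p v V psi ->
  c * (2 `^ p * \int[m]_x (enorm (V x) `^ p) +
  2 `^ p * \int[m]_x (enorm (grad (psi k) x - V x) `^ p)) @[k --> \oo] -->
  c * (2 `^ p * \int[m]_x (enorm (V x) `^ p)).
Proof.
move=> p0 [_ _ _ _ H]; apply: cvg_cstM; rewrite -[X in _ --> X]addr0.
by apply: cvgD; [exact: cvg_cst|apply: cvg_cstM0; exact: H].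
Qed.

Lemma measurable_dilation_fun l v : measurable_fun setT v ->
  measurable_fun setT (fun x : 'rV[R]_n => v (l *: x)).
Proof. by move=> mv; apply: (measurableT_comp mv); exact: measurable_scale_rV. Qed.

Lemma measurable_div_enorm v p : measurable_fun setT v ->
  measurable_fun setT (fun x : 'rV[R]_n => (`|v x| / enorm x) `^ p).
Proof.
move=> mv; apply: measurable_powR_fun; apply: measurable_funM; last first.
  by apply: measurable_inv_fun; [exact: enorm_ge0|exact: measurable_enorm_id].
exact: measurableT_comp.
Qed.

(** Fatou's lemma along approximations that converge at almost every x, hence also at l x for almost
    every x. Only the order (l - 1)^p matters later, so the factor 2^p is harmless. *)
Lemma D1p_dilation_difference p l v V : 1 < p -> p < n%:R -> 1 < l ->
  D1p_gradient p v V ->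
  L1 m (fun x => (`|v (l *: x) - v x| / enorm x) `^ p) /\
  \int[m]_x ((`|v (l *: x) - v x| / enorm x) `^ p) <=
  (l - 1) `^ p * (2 `^ p * \int[m]_x (enorm (V x) `^ p)).
Proof.
move=> p1 pn l1 Dv; have [psi Ha ae_psi] := D1p_approximates p1 pn Dv.
have [mv mV _] := Dv; have p0 : 0 < p by lra.
have l0 : 0 < l by lra.
have tpsi : forall k, test_function (psi k) by case: Ha.
apply: (@fatou_real _ _ _ m
    (fun k x => (`|psi k (l *: x) - psi k x| / enorm x) `^ p) _
    (fun k => (l - 1) `^ p * (2 `^ p * \int[m]_x (enorm (V x) `^ p) +
     2 `^ p * \int[m]_x (enorm (grad (psi k) x - V x) `^ p)))).
- by move=> k; exact: (L1_dilation_difference p1 l1 (tpsi k)).1.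
- by move=> k x; exact: powR_ge0.
- apply: measurable_div_enorm; apply: measurable_funB => //.
  exact: measurable_dilation_fun.
- by move=> x; exact: powR_ge0.
- have := ae_dilation l0 ae_psi; apply: filterS2 ae_psi => x H1 H2.
  apply: cvg_powR => //.
  + by rewrite divr_ge0 ?enorm_ge0.
  + by move=> k; rewrite divr_ge0 ?enorm_ge0.
  apply: cvgM; last exact: cvg_cst.
  by apply: cvg_norm; apply: cvgB.
- move=> k; apply: le_trans (L1_dilation_difference p1 l1 (tpsi k)).2 _.
  by rewrite ler_wpM2l ?powR_ge0//; exact: approximates_int_grad Ha.
- exact: cvg_int_grad Ha.
Qed.

(* Compares [phi] with its dilation by 2, which shrinks the integral by the
   factor [2 `^ (p - n)]; the truncation at radius [d] makes that integral finite,
   so that it can be absorbed. *)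
Lemma hardy_test_function p : 1 < p -> p < n%:R -> exists2 C : R, 0 <= C &
  forall (phi : 'rV[R]_n -> R) (d : R), test_function phi -> 0 < d ->
  L1 m (fun x => (`|phi x| / enorm x) `^ p * \1_[set x | d <= enorm x] x) /\
  \int[m]_x ((`|phi x| / enorm x) `^ p * \1_[set x | d <= enorm x] x) <=
  C * \int[m]_x (enorm (grad phi x) `^ p).
Proof.
move=> p1 pn; have p0 : 0 < p by lra.
(* With this b > 1, kap = b^p 2^(p-n) = 2^(-(n-p)/2) < 1: half of the exponent of the contraction
   2^(p-n) is spent on the coefficient in [powRD_le] for e = b - 1. *)
pose b : R := 2 `^ ((n%:R - p) / (2 * p)).
have b1 : 1 < b.
  rewrite /b gt1_powR//; first by rewrite ltr1n.
  by rewrite divr_gt0 ?mulr_gt0// subr_gt0.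
have e0 : 0 < b - 1 by rewrite subr_gt0.
pose kap : R := b `^ p * (2 `^ p * (2 ^+ n)^-1).
have kap1 : kap < 1.
  rewrite /kap -(@powR_mulrn _ 2 n)// -powRN -powRD; last first.
    by apply/implyP => _; rewrite pnatr_eq0.
  rewrite /b -powRrM -powRD; last by apply/implyP => _; rewrite pnatr_eq0.
  have -> : (n%:R - p) / (2 * p) * p + (p - n%:R) = - ((n%:R - p) / 2) :> R.
    by field; rewrite gt_eqF.
  rewrite powRN invf_lt1 ?powR_gt0// gt1_powR ?ltr1n//.
  by rewrite divr_gt0// subr_gt0.
pose C2 := (1 + (b - 1)^-1) `^ p.
exists (C2 / (1 - kap)).
  by rewrite divr_ge0 ?powR_ge0// subr_ge0 ltW.
move=> phi d tphi d0; set S := [set x | d <= enorm x].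
have mS : measurable S.
  have -> : S = enorm @^-1` `[d, +oo[%classic.
    by apply/seteqP; split => x /=; rewrite in_itv/= andbT.
  by rewrite -[X in measurable X]setTI; apply: measurable_enorm_id.
set h := fun x => (`|phi x| / enorm x) `^ p * \1_S x.
have h0 x : 0 <= h x by rewrite mulr_ge0 ?powR_ge0.
have mh : measurable_fun setT h.
  apply: measurable_funM; last exact: measurable_indic.
  by apply: measurable_div_enorm; exact: smooth_measurable tphi.1.
have [C [K [C0 cK HC _]]] := test_function_bounded tphi.
have Hh : L1 m h.
  apply: (@L1_bounded_supp _ _ _ ((C / d) `^ p) K) => // x.
  rewrite ger0_norm// /h (indicE _ S); have [|] := boolP (x \in S); last first.
    by move=> _; rewrite mulr0 mulr_ge0 ?powR_ge0.
  rewrite inE /S /= mulr1 => dx.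
  have ex0 : 0 < enorm x by exact: lt_le_trans dx.
  have := HC x; rewrite indicE; case: (x \in K); rewrite /= ?mulr1 ?mulr0 => H.
    rewrite ler_powR_base ?divr_ge0 ?enorm_ge0 ?(ltW p0)//.
    by rewrite ler_pM ?invr_ge0 ?enorm_ge0// lef_pV2 ?posrE.
  have -> : `|phi x| = 0 by apply/eqP; rewrite eq_le H normr_ge0.
  by rewrite mul0r powR0 ?gt_eqF.
split => //.
have l1 : (1 : R) < 2 by rewrite ltr1n.
have [Hd Id] := L1_dilation_difference p1 l1 tphi.
have [Hh2 Ih2] := @L1_dilation R n 2 h (ltr0Sn R 1) h0 Hh.
(* |phi(x)| <= |phi(2x)| + |phi(2x) - phi(x)|, and d <= |x| implies d <= |2x|, so the truncated
   integral reappears on the right with a factor below 1. *)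
have key : \int[m]_x h x <= kap * \int[m]_x h x + C2 * \int[m]_x (enorm (grad phi x) `^ p).
  apply: (@le_trans _ _ (b `^ p * 2 `^ p * \int[m]_x h (2 *: x) +
     C2 * \int[m]_x ((`|phi (2 *: x) - phi x| / enorm x) `^ p))).
    rewrite -(intZD _ _ Hh2 Hd).
    apply: int_le; [exact: Hh|exact: L1ZD|].
    move=> x; rewrite /h (indicE _ S x); have [|] := boolP (x \in S); last first.
      by move=> _; rewrite mulr0 addr_ge0 ?mulr_ge0 ?powR_ge0.
    rewrite inE /S /= mulr1 => dx.
    have ex0 : 0 < enorm x by exact: lt_le_trans dx.
    have -> : \1_[set x | d <= enorm x] (2 *: x) = 1 :> R.
      rewrite indicE mem_set//= enormZ ger0_norm//; lra.
    have E2 : 2 `^ p * ((`|phi (2 *: x)| / enorm (2 *: x)) `^ p) =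
        (`|phi (2 *: x)| / enorm x) `^ p.
      rewrite enormZ (ger0_norm (ler0n R 2)) -powRM ?ler0n//; last first.
        by rewrite divr_ge0 ?mulr_ge0 ?enorm_ge0.
      by congr (_ `^ _); field; rewrite gt_eqF.
    rewrite mulr1 -[X in _ <= X + _]mulrA E2.
    rewrite -[X in _ <= X `^ p * _ + _](subrKC 1 b).
    apply: le_trans (powRD_le (ltW p0) e0 _ _); rewrite ?divr_ge0 ?enorm_ge0//.
    rewrite ler_powR_base ?divr_ge0 ?enorm_ge0 ?(ltW p0)//.
    rewrite -mulrDl ler_wpM2r ?invr_ge0 ?enorm_ge0//.
    have := ler_normB (phi (2 *: x)) (phi (2 *: x) - phi x).
    by rewrite opprB addrC subrK.
  rewrite Ih2 /kap lerD//.
    by rewrite !mulrA.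
  rewrite ler_wpM2l ?powR_ge0//; apply: le_trans Id _.
  by rewrite (_ : 2 - 1 = 1 :> R) ?powR1 ?mul1r//; lra.
rewrite mulrAC ler_pdivlMr ?subr_gt0//; lra.
Qed.

(** The bound of [hardy_test_function] does not depend on the truncation radius, so the radius can
    tend to 0 along the approximations in Fatou's lemma. *)
Lemma D1p_hardy p v V : 1 < p -> p < n%:R -> D1p_gradient p v V ->
  L1 m (fun x => (`|v x| / enorm x) `^ p).
Proof.
move=> p1 pn Dv; have [psi Ha ae_psi] := D1p_approximates p1 pn Dv.
have [mv mV _] := Dv; have p0 : 0 < p by lra.
have tpsi : forall k, test_function (psi k) by case: Ha.
have [C C0 HC] := hardy_test_function p1 pn.
have k0 k : 0 < k.+1%:R^-1 :> R by rewrite invr_gt0.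
apply: (proj1 (@fatou_real _ _ _ m
    (fun k x => (`|psi k x| / enorm x) `^ p * \1_[set x | k.+1%:R^-1 <= enorm x] x) _
    (fun k => C * (2 `^ p * \int[m]_x (enorm (V x) `^ p) +
     2 `^ p * \int[m]_x (enorm (grad (psi k) x - V x) `^ p)))
    (C * (2 `^ p * \int[m]_x (enorm (V x) `^ p))) _ _ _ _ _ _ _)).
- by move=> k; exact: (HC _ _ (tpsi k) (k0 k)).1.
- by move=> k x; rewrite mulr_ge0 ?powR_ge0.
- exact: measurable_div_enorm.
- by move=> x; exact: powR_ge0.
- apply: filterS ae_psi => x Hx.
  (* The inverse of 0 is 0, so at the origin every term and the limit vanish. *)
  have [->|x0] := eqVneq x 0.
    rewrite enorm0 invr0; under eq_cvg do rewrite mulr0 powR0 ?gt_eqF// mul0r.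
    by rewrite mulr0 powR0 ?gt_eqF//; exact: cvg_cst.
  have ex0 : 0 < enorm x by rewrite lt_def enorm_ge0 enorm_eq0 x0.
  have : (`|psi k x| / enorm x) `^ p @[k --> \oo] --> (`|v x| / enorm x) `^ p.
    apply: cvg_powR => //.
    + by rewrite divr_ge0 ?enorm_ge0.
    + by move=> k; rewrite divr_ge0 ?enorm_ge0.
    by apply: cvgM; [exact: cvg_norm|exact: cvg_cst].
  apply: cvg_trans; apply: near_eq_cvg.
  have [K] := ltr_add_invr ex0; rewrite add0r => HK.
  exists K => // k /= Kk; rewrite indicE mem_set ?mulr1//=.
  by apply: le_trans (ltW HK); rewrite lef_pV2 ?posrE// ler_nat.
- move=> k; apply: le_trans (HC _ _ (tpsi k) (k0 k)).2 _.
  by rewrite ler_wpM2l//; exact: approximates_int_grad Ha.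
- exact: cvg_int_grad Ha.
Qed.

Lemma test_function_dilation l phi : 0 < l -> test_function phi ->
  test_function (fun x => phi (l *: x)).
Proof.
move=> l0 [sphi cK].
have cK' : compact ((fun x : 'rV[R]_n => l^-1 *: x) @` closure [set x | phi x != 0]).
  apply: continuous_compact => //; apply: continuous_subspaceT.
  exact: scaler_continuous.
apply: (test_function_supp _ cK').
  by apply/smoothP => k; apply: Cn_dilation; exact: (proj1 (smoothP _) sphi).
move=> x Kx; apply/eqP/negP => /negP px; apply: Kx.
exists (l *: x); first by apply: subset_closure.
by rewrite scalerA mulVf ?scale1r// gt_eqF.
Qed.

Lemma approximates_dilation p l v V psi : 0 < p -> 0 < l ->
  approximates p v V psi ->
  approximates p (fun x => v (l *: x)) (fun x => l *: V (l *: x))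
    (fun k x => psi k (l *: x)).
Proof.
move=> p0 l0 [tpsi Hv cv HV cV].
have D1 k := L1_dilation l0 (fun x => powR_ge0 `|psi k x - v x| (crit_exp n p)) (Hv k).
have D2 k := L1_dilation l0 (fun x => powR_ge0 (enorm (grad (psi k) x - V x)) p) (HV k).
have E k x : enorm (grad (fun x => psi k (l *: x)) x - l *: V (l *: x)) `^ p =
    l `^ p * enorm (grad (psi k) (l *: x) - V (l *: x)) `^ p.
  rewrite grad_dilation; last exact: (tpsi k).1.
  by rewrite -scalerBr enormZ (gtr0_norm l0) powRM ?enorm_ge0// ltW.
split.
- by move=> k; exact: test_function_dilation.
- by move=> k; exact: (D1 k).1.
- apply: (cvg_ext (fun k => esym (D1 k).2)).
  apply: cvg_cstM0; exact: cv.
- move=> k; rewrite (_ : (fun _ => _) = fun x => l `^ p * enorm (grad (psi k) (l *: x) - V (l *: x)) `^ p).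
    exact: (L1Z _ (D2 k).1).
  by apply/funext => x; rewrite E.
- have F k : l `^ p * ((l ^+ n)^-1 * \int[m]_x (enorm (grad (psi k) x - V x) `^ p)) =
      \int[m]_x (enorm (grad (fun x => psi k (l *: x)) x - l *: V (l *: x)) `^ p).
    rewrite -(D2 k).2 -(intZ _ (D2 k).1).
    by apply: eq_Rintegral => x _; rewrite E.
  apply: (cvg_ext F); apply: cvg_cstM0; apply: cvg_cstM0; exact: cV.
Qed.

End approximation.

(** * Testing the equation with cut-off functions *)

Section weak_formulation.
Context {R : realType} {n : nat}.
Implicit Types (x y : 'rV[R]_n) (phi v f : 'rV[R]_n -> R) (V G : 'rV[R]_n -> 'rV[R]_n).
Implicit Types (p l : R) (psi : nat -> 'rV[R]_n -> R).
Local Notation m := (lebesgue_rV R n).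

(** Replaces dominated convergence when the error has no majorant independent of k: [c1] and [c2]
    may depend on e, which is fixed before k tends to infinity. *)
Lemma int_cvg_eps d (T : measurableType d) (mu : {measure set T -> \bar R})
    (h_ : nat -> T -> R) (h a : T -> R) (J Q : nat -> T -> R) :
  (forall k, L1 mu (h_ k)) -> measurable_fun setT h -> L1 mu a ->
  (forall k, L1 mu (J k)) -> \int[mu]_z J k z @[k --> \oo] --> 0 ->
  (forall k, L1 mu (Q k)) -> \int[mu]_z Q k z @[k --> \oo] --> 0 ->
  (forall e, 0 < e -> exists c1 c2 : R, forall k,
    {ae mu, forall z, `|h_ k z - h z| <= e * a z + (c1 * J k z + c2 * Q k z)}) ->
  L1 mu h /\ \int[mu]_z h_ k z @[k --> \oo] --> \int[mu]_z h z.
Proof.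
move=> Hh_ mh Ha HJ cJ HQ cQ H.
have Hg e c1 c2 k : L1 mu (fun z => e * a z + (c1 * J k z + c2 * Q k z)).
  by apply: L1D; [exact: L1Z|exact: L1ZD].
have Hh : L1 mu h.
  have [c1 [c2 Hc]] := H 1 ltr01.
  apply: (@L1_ae_le _ _ _ mu h (fun z => `|h_ 0%N z| + (1 * a z + (c1 * J 0%N z + c2 * Q 0%N z)))) => //.
    by apply: L1D; [exact: L1_norm|exact: Hg].
  apply: filterS (Hc 0%N) => z Hz.
  have := ler_normB (h_ 0%N z) (h_ 0%N z - h z); rewrite opprB subrKC.
  by lra.
split => //; apply/cvgrPdist_le => e e0.
set A := \int[mu]_z a z.
have e'0 : 0 < e / 2 / (`|A| + 1) by rewrite !divr_gt0// ltr_wpDl.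
have [c1 [c2 Hc]] := H _ e'0.
have c0 : c1 * \int[mu]_z J k z + c2 * \int[mu]_z Q k z @[k --> \oo] --> 0.
  by rewrite -[X in _ --> X]addr0; apply: cvgD; apply: cvg_cstM0.
have e20 : 0 < e / 2 by rewrite divr_gt0.
have /cvgrPdist_le/(_ _ e20) := c0; apply: filterS => k; rewrite sub0r normrN => Hk.
rewrite distrC -(intB (Hh_ k) Hh).
have mD : measurable_fun setT (fun z => h_ k z - h z).
  exact: (L1_measurable (L1B (Hh_ k) Hh)).
apply: le_trans (int_norm_le mD (Hg _ c1 c2 k) (Hc k)) _.
rewrite (intD (L1Z _ Ha) (L1ZD c1 c2 (HJ k) (HQ k))) (intZ _ Ha) (intZD _ _ (HJ k) (HQ k)).
rewrite [leRHS]splitr lerD//; last exact: le_trans (ler_norm _) Hk.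
rewrite -/A mulrAC ler_pdivrMr ?ltr_wpDl// ler_wpM2l ?(ltW e20)//.
by rewrite (le_trans (ler_norm A))// lerDl.
Qed.

Definition flux p G x (y : 'rV[R]_n) : R := enorm (G x) `^ (p - 2) * dot (G x) y.

Lemma normr_flux p G x y : 1 < p ->
  `|flux p G x y| <= enorm (G x) `^ (p - 1) * enorm y.
Proof.
move=> p1; rewrite /flux normrM ger0_norm ?powR_ge0//.
have <- : enorm (G x) `^ (p - 2) * enorm (G x) = enorm (G x) `^ (p - 1).
  have a0 := enorm_ge0 (G x); have := norm_dpow (enorm (G x)) p1.
  by rewrite /dpow (ger0_norm a0) ger0_norm// mulr_ge0// powR_ge0.
by rewrite -mulrA ler_wpM2l ?powR_ge0// normr_dot.
Qed.

Lemma fluxD p G x y z : flux p G x (y + z) = flux p G x y + flux p G x z.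
Proof. by rewrite /flux dotDr mulrDr. Qed.

Lemma fluxZ p G x (c : R) y : flux p G x (c *: y) = c * flux p G x y.
Proof. by rewrite /flux dotZr mulrCA. Qed.

Lemma fluxB p G x y z : flux p G x (y - z) = flux p G x y - flux p G x z.
Proof. by rewrite fluxD -scaleN1r fluxZ mulN1r. Qed.

Lemma flux_self p G x : 1 < p -> flux p G x (G x) = enorm (G x) `^ p.
Proof.
move=> p1; rewrite /flux -sqr_enorm expr2 mulrA.
have := dpowM (enorm (G x)) p1; rewrite /dpow.
by rewrite (ger0_norm (enorm_ge0 (G x))).
Qed.

Lemma measurable_flux p G V : measurable_fun setT G -> measurable_fun setT V ->
  measurable_fun setT (fun x => flux p G x (V x)).
Proof.
move=> mG mV; apply: measurable_funM; last exact: measurable_dot.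
by apply: measurable_powR_fun; exact: measurable_enorm.
Qed.

Lemma measurable_scale_vec v V : measurable_fun setT v -> measurable_fun setT V ->
  measurable_fun setT (fun x => v x *: V x).
Proof.
move=> mv /measurable_fun_coordP mV; apply/measurable_fun_coordP => i.
by under eq_fun do rewrite mxE; apply: measurable_funM.
Qed.

Lemma measurable_add_vec V W : measurable_fun setT V -> measurable_fun setT W ->
  measurable_fun setT (fun x : 'rV[R]_n => V x + W x : 'rV[R]_n).
Proof.
move=> /measurable_fun_coordP mV /measurable_fun_coordP mW.
apply/measurable_fun_coordP => i.
by under eq_fun do rewrite mxE; apply: measurable_funD.
Qed.

(** Extends the equation to the test function [cutoff N] times v. Along the approximations the left
    side converges because the gradients do in L^p and [grad (cutoff N)] is bounded with compact
    support, the right side because f is bounded on the annulus. *)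
Lemma weak_cutoff p G f (F N : R) v V psi : 1 < p -> p < n%:R -> 0 < N -> 0 <= F ->
  measurable_fun setT G -> L1 m (fun x => enorm (G x) `^ p) ->
  measurable_fun setT f ->
  {ae m, forall x, annulus N x -> `|f x| <= F} ->
  (forall phi, test_function phi ->
    (\int[m]_x (flux p G x (grad phi x))%:E = \int[m]_x (f x * phi x)%:E)%E) ->
  measurable_fun setT v -> measurable_fun setT V -> approximates p v V psi ->
  [/\ L1 m (fun x => flux p G x (cutoff N x *: V x + v x *: grad (cutoff N) x)),
      L1 m (fun x => f x * (cutoff N x * v x)) &
      \int[m]_x flux p G x (cutoff N x *: V x + v x *: grad (cutoff N) x) =
      \int[m]_x (f x * (cutoff N x * v x))].
Proof.
move=> p1 pn N0 F0 mG HG mf fF weak mv mV Ha.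
have [tpsi HQ cQ HJ cJ] := Ha.
have p0 : 0 < p by lra.
have pps := lt_crit_exp p1 pn.
have seta := @smooth_cutoff R n N.
have teta : test_function (@cutoff R n N).
  apply: (test_function_supp seta (compact_annulus (N := N))).
  by move=> x; exact: cutoff_eq0.
have [C [K [C0 cK _ HCg]]] := test_function_bounded teta.
have HK := L1_compact_indic cK.
have HAn := L1_compact_indic (@compact_annulus R n N).
have meta := smooth_measurable seta.
have mgeta := measurable_grad seta.
have mpsi k : measurable_fun setT (psi k) by exact: smooth_measurable (tpsi k).1.
have mgpsi k : measurable_fun setT (grad (psi k)) by exact: measurable_grad (tpsi k).1.
have mB (w : 'rV[R]_n -> R) (W : 'rV[R]_n -> 'rV[R]_n) : measurable_fun setT w -> measurable_fun setT W ->
    measurable_fun setT (fun x => flux p G x (cutoff N x *: W x + w x *: grad (cutoff N) x)).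
  move=> mw mW; apply: measurable_flux => //.
  by apply: measurable_add_vec; exact: measurable_scale_vec.
have eta1 x : `|cutoff N x| <= 1.
  by rewrite ger0_norm ?cutoff_ge0// cutoff_le1.
have bB (w : 'rV[R]_n -> R) (W : 'rV[R]_n -> 'rV[R]_n) x : `|flux p G x (cutoff N x *: W x + w x *: grad (cutoff N) x)| <=
    enorm (G x) `^ (p - 1) * enorm (W x) +
    enorm (G x) `^ (p - 1) * (C * \1_K x * `|w x|).
  apply: le_trans (normr_flux _ _ _ p1) _.
  rewrite -mulrDr ler_wpM2l ?powR_ge0//; apply: le_trans (ler_enormD _ _) _.
  rewrite !enormZ lerD//; first by rewrite ler_piMl ?enorm_ge0.
  by rewrite mulrC ler_wpM2r.
have indK x : (\1_K x : R) `^ p = \1_K x.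
  rewrite indicE; case: (_ \in _); first by rewrite powR1.
  by rewrite powR0// gt_eqF.
have indK0 x : 0 <= \1_K x :> R by [].
have HBk k : L1 m (fun x => flux p G x (cutoff N x *: grad (psi k) x + psi k x *: grad (cutoff N) x)).
  have [C' [K' [C'0 cK' HC' _]]] := test_function_bounded (tpsi k).
  have HK' := L1_compact_indic cK'.
  apply: (@L1_le _ _ _ _ _ (fun x => 2 * enorm (G x) `^ p +
     1 * (1 * enorm (grad (psi k) x) `^ p + ((C * C') `^ p) * \1_K' x))).
  - by apply: mB.
  - by apply: L1ZD => //; apply: L1ZD => //; exact: L1_powR_test.
  move=> x; apply: le_trans (bB _ _ _) _.
  have h1 := mulr_powR_le p1 (enorm_ge0 (G x)) (enorm_ge0 (grad (psi k) x)).
  have Cpos : 0 <= C * \1_K x * `|psi k x| by rewrite !mulr_ge0.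
  have h2 := mulr_powR_le p1 (enorm_ge0 (G x)) Cpos.
  have h3 : (C * \1_K x * `|psi k x|) `^ p <= (C * C') `^ p * \1_K' x.
    apply: (@le_trans _ _ ((C * C' * \1_K' x) `^ p)).
      rewrite ler_powR_base ?(ltW p0)// -[C * C' * _]mulrA ler_pM ?mulr_ge0//.
      by rewrite ler_piMr// indicE; case: (_ \in _).
    rewrite powRM ?mulr_ge0// (indicE _ K'); case: (_ \in _).
      by rewrite powR1.
    by rewrite powR0 ?mulr0// gt_eqF.
  by lra.
have [HB cB] : L1 m (fun x => flux p G x (cutoff N x *: V x + v x *: grad (cutoff N) x)) /\
   \int[m]_x flux p G x (cutoff N x *: grad (psi k) x + psi k x *: grad (cutoff N) x) @[k --> \oo] -->
   \int[m]_x flux p G x (cutoff N x *: V x + v x *: grad (cutoff N) x).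
  apply: (@int_cvg_eps _ _ m _ _ (fun x => 2 * enorm (G x) `^ p + 1 * \1_K x)
     (fun k x => enorm (grad (psi k) x - V x) `^ p)
     (fun k x => `|psi k x - v x| `^ crit_exp n p)) => //.
  - exact: mB.
  - exact: L1ZD.
  move=> e e0; have [C1 C10 HC1] := mulr_powR_le_epsl p1 e0.
  have e'0 : 0 < e / (C1 * C `^ p + 1).
    by rewrite divr_gt0// ltr_wpDl// mulr_ge0 ?powR_ge0// ltW.
  have [C2 C20 HC2] := powR_le_eps p0 (ltW pps) e'0.
  exists C1, (C1 * C `^ p * C2) => k; apply/aeW => x.
  rewrite -fluxB.
  have -> : cutoff N x *: grad (psi k) x + psi k x *: grad (cutoff N) x -
     (cutoff N x *: V x + v x *: grad (cutoff N) x) =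
     cutoff N x *: (grad (psi k) x - V x) + (psi k x - v x) *: grad (cutoff N) x.
    by rewrite opprD addrACA scalerBr scalerBl.
  apply: le_trans (bB (fun x => psi k x - v x) (fun x => grad (psi k) x - V x) x) _.
  have h1 := HC1 _ _ (enorm_ge0 (G x)) (enorm_ge0 (grad (psi k) x - V x)).
  have Cpos : 0 <= C * \1_K x * `|psi k x - v x| by rewrite !mulr_ge0.
  have h2 := HC1 _ _ (enorm_ge0 (G x)) Cpos.
  (* On the compact [K] the power p is at most a small constant plus a multiple of the power
     [crit_exp n p], whose integral tends to 0. *)
  have h3 : C1 * (C * \1_K x * `|psi k x - v x|) `^ p <=
     e * \1_K x + C1 * C `^ p * C2 * `|psi k x - v x| `^ crit_exp n p.
    rewrite powRM ?mulr_ge0// powRM// indK.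
    have t := HC2 _ (normr_ge0 (psi k x - v x)).
    set tp := `|_| `^ p in t *; set tq := `|_| `^ crit_exp n p in t *.
    have tq0 : 0 <= tq by exact: powR_ge0.
    have D0 : 0 <= C1 * C `^ p by rewrite mulr_ge0 ?powR_ge0// ltW.
    have -> : C1 * (C `^ p * \1_K x * tp) = C1 * C `^ p * (\1_K x * tp) by ring.
    apply: (@le_trans _ _ (C1 * C `^ p * (\1_K x * (e / (C1 * C `^ p + 1)) + C2 * tq))).
      rewrite ler_wpM2l// (indicE _ K); case: (_ \in _); first by rewrite !mul1r.
      by rewrite !mul0r add0r mulr_ge0// ltW.
    rewrite mulrDr [X in _ + X]mulrA lerD2r mulrCA mulrC ler_wpM2r//.
    by rewrite mulrCA ler_piMr ?(ltW e0)// ler_pdivrMr ?mul1r ?lerDl// ltr_wpDl.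
  by lra.
have [Hf cf] : L1 m (fun x => f x * (cutoff N x * v x)) /\
   \int[m]_x (f x * (cutoff N x * psi k x)) @[k --> \oo] -->
   \int[m]_x (f x * (cutoff N x * v x)).
  apply: (@int_cvg_eps _ _ m _ _ (\1_(annulus N))
     (fun k x => `|psi k x - v x| `^ crit_exp n p)
     (fun k x => `|psi k x - v x| `^ crit_exp n p)) => //.
  - move=> k; have [C' [K' [C'0 cK' HC' _]]] := test_function_bounded (tpsi k).
    have HK' := L1_compact_indic cK'.
    apply: (@L1_ae_le _ _ _ _ _ (fun x => F * C' * \1_K' x)).
    + by apply: measurable_funM => //; exact: measurable_funM.
    + exact: L1Z.
    apply: filterS fF => x Hx.
    have [An|An] := pselect (annulus N x); last first.
      by rewrite cutoff_eq0// mul0r mulr0 normr0 !mulr_ge0.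
    rewrite normrM -mulrA ler_pM// ?Hx// normrM.
    by apply: le_trans (HC' x); rewrite ler_piMl.
  - by apply: measurable_funM => //; exact: measurable_funM.
  move=> e e0.
  have e'0 : 0 < e / (F + 1) by rewrite divr_gt0// ltr_wpDl.
  have ps1 : 1 <= crit_exp n p by lra.
  have [C2 C20 HC2] := powR_le_eps ltr01 ps1 e'0.
  exists (F * C2), 0 => k; apply: filterS fF => x Hx.
  have tq0 : 0 <= `|psi k x - v x| `^ crit_exp n p by exact: powR_ge0.
  rewrite mul0r addr0.
  have [An|An] := pselect (annulus N x); last first.
    rewrite cutoff_eq0// !mul0r mulr0 subrr normr0.
    by rewrite addr_ge0// mulr_ge0// ?mulr_ge0// ltW.
  rewrite indicE mem_set// mulr1 -mulrBr -mulrBr normrM [X in _ * X]normrM.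
  have t := HC2 _ (normr_ge0 (psi k x - v x)); rewrite powRr1// in t.
  apply: (@le_trans _ _ (F * (e / (F + 1) + C2 * `|psi k x - v x| `^ crit_exp n p))).
    apply: ler_pM; [exact: normr_ge0|by rewrite mulr_ge0|exact: Hx|].
    apply: (@le_trans _ _ `|psi k x - v x|); last exact: t.
    exact: ler_piMl (normr_ge0 _) (eta1 x).
  rewrite mulrDr [X in _ + X]mulrA lerD2r.
  by rewrite mulrCA ler_piMr ?(ltW e0)// ler_pdivrMr ?mul1r ?lerDl// ltr_wpDl.
split => //.
have E k : \int[m]_x flux p G x (cutoff N x *: grad (psi k) x + psi k x *: grad (cutoff N) x) =
    \int[m]_x (f x * (cutoff N x * psi k x)).
  rewrite /Rintegral -(weak _ (test_function_cutoffM N0 (tpsi k).1)).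
  congr fine; apply: eq_integral => x _.
  by rewrite gradM//; exact: (tpsi k).1.
have cB' := cvg_ext E cB.
by rewrite -(cvg_lim _ cf)// -(cvg_lim _ cB').
Qed.

End weak_formulation.

(** * Limits in the cutoff and expansion in the dilation factor *)

Section cutoff_limits.
Context {R : realType} {n : nat}.
Implicit Types (x : 'rV[R]_n) (h : 'rV[R]_n -> R) (N l e sg : R).
Local Notation m := (lebesgue_rV R n).

(** The cutoff tends to 1 off the origin only. The origin is a box whose sides have measure 0, and n
    > 0 provides a side. *)
Lemma ae_neq0 : (0 < n)%N -> {ae m, forall x, x != 0}.
Proof.
case: n => // n' _.
exists [set x : 'rV[R]_n'.+1 | forall i, [set (0 : R)] (x ord0 i)]; split.
- rewrite (_ : mkset _ = \bigcap_(i in [set: 'I_n'.+1])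
      ((fun x : 'rV[R]_n'.+1 => x ord0 i) @^-1` [set 0])); last first.
    by apply/seteqP; split=> [x xA i _|x xA i]; exact: xA.
  apply: fin_bigcap_measurable; first exact: finite_finset.
  move=> i _; rewrite -[X in measurable X]setTI.
  exact: measurable_coord.
- apply: etrans (@lebesgue_rV_box R n'.+1 (fun=> [set (0 : R)]) _) _ => //.
  by rewrite big_ord_recl (lebesgue_measure_set1 (0 : R)) mul0e.
- by move=> x /= /negP; rewrite negbK => /eqP -> i; rewrite mxE.
Qed.

(** Squeezed below (r + 1/r)/N with r = |x|^2; this covers the origin, where the inverse of 0 is
    0. *)
Lemma cvg_cutoff_tail x : cutoff_tail k.+1%:R x @[k --> \oo] --> (0 : R).
Proof.
have cH : (dot x x + (dot x x)^-1) * (harmonic k : R) @[k --> \oo] --> (0 : R).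
  by apply: cvg_cstM0; exact: cvg_harmonic.
have c0 : (fun=> 0 : R) k @[k --> \oo] --> (0 : R) by exact: cvg_cst.
apply: (squeeze_cvgr _ c0 cH); near=> k; rewrite cutoff_tail_ge0//=.
rewrite mulrDl lerD// ge_min; apply/orP; right=> //.
by rewrite invfM mulrC.
Unshelve. all: by end_near. Qed.

Lemma cvg_cutoff x : x != 0 -> cutoff k.+1%:R x @[k --> \oo] --> (1 : R).
Proof.
move=> x0; have d0 : 0 < dot x x.
  by rewrite -sqr_enorm exprn_gt0// lt_neqAle enorm_ge0 andbT eq_sym enorm_eq0.
have c1 : flat 0 (1 - dot x x / k.+1%:R) @[k --> \oo] --> flat 0 (1 : R).
  apply: (@cvg_comp _ _ _ _ (flat 0) _ (nbhs (1 : R))); last exact: continuous_flat.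
  have : 1 - dot x x * (harmonic k : R) @[k --> \oo] --> (1 - 0 : R).
    apply: cvgB; first exact: cvg_cst.
    by apply: cvg_cstM0; exact: cvg_harmonic.
  by rewrite subr0.
have c2 : flat 0 (k.+1%:R * dot x x - 1) @[k --> \oo] --> (1 : R).
  have cH : dot x x - (harmonic k : R) @[k --> \oo] --> dot x x.
    rewrite -[X in _ --> X]subr0; apply: cvgB; first exact: cvg_cst.
    exact: cvg_harmonic.
  (* With h = 1/N and r = |x|^2, the exponent -1/(N r - 1) is -h/(r - h). *)
  have cq : - ((harmonic k : R) * (dot x x - (harmonic k : R))^-1) @[k --> \oo] --> (0 : R).
    rewrite -oppr0 -(mul0r (dot x x)^-1); apply: cvgN; apply: cvgM.
      exact: cvg_harmonic.
    by apply: cvgV => //; rewrite gt_eqF.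
  have ce : expR (- ((harmonic k : R) * (dot x x - (harmonic k : R))^-1)) @[k --> \oo] --> (1 : R).
    rewrite -expR0; apply: (@cvg_comp _ _ _ _ (@expR R) _ (nbhs (0 : R))).
      exact: cq.
    exact: continuous_expR.
  apply: cvg_trans ce; apply: near_eq_cvg.
  have /cvgrPdist_lt/(_ _ d0) := cvg_harmonic (R := R).
  apply: filterS => k; rewrite sub0r normrN gtr0_norm ?invr_gt0// => Hk.
  have kd : 0 < k.+1%:R * dot x x - 1.
    by rewrite subr_gt0 mulrC -ltr_pdivrMr// div1r.
  rewrite /flat kd expr0 mul1r; congr expR; congr (- _).
  rewrite /harmonic; set K : R := k.+1%:R in kd *.
  have K0 : K != 0 by rewrite gt_eqF.
  have KD : dot x x - K^-1 = (K * dot x x - 1) / K by field.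
  by rewrite KD invfM invrK mulrCA mulVf// mulr1.
have E : expR 1 * flat 0 (1 : R) * 1 = 1.
  by rewrite /flat ltr01 expr0 mul1r invr1 -expRD subrr expR0 mulr1.
have : cutoff k.+1%:R x @[k --> \oo] --> expR 1 * flat 0 (1 : R) * 1.
  by apply: cvgM; [exact: cvg_cstM c1|exact: c2].
by rewrite E.
Unshelve. all: by end_near. Qed.

Lemma powR_differentiable1 (r e : R) : 0 < e ->
  exists2 de, 0 < de & forall l, 1 < l -> l < 1 + de ->
    `|l `^ r - 1 - r * (l - 1)| <= e * (l - 1).
Proof.
move=> e0; have [] := @is_derive1_powR R r 1 ltr01.
move=> dr; rewrite powR1 mulr1 => Dr.
have : h^-1 *: ((((@powR R)^~ r) \o shift 1) (h *: 1) - 1 `^ r) @[h --> 0^']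
    --> 'D_1 ((@powR R)^~ r) 1 by exact: dr.
rewrite Dr; move=> /cvgrPdist_le/(_ _ e0)/nbhs_ballP[de /= de0 H].
exists de => // l l1 ld; have h0 : 0 < l - 1 by rewrite subr_gt0.
have := H (l - 1); rewrite /ball /= sub0r normrN gtr0_norm// => /(_ _ _).
rewrite gt_eqF// powR1 -[_ *: 1]/(_ * 1) mulr1 subrK => /(_ _ isT) K.
have {}K : `|r - (l - 1)^-1 *: (l `^ r - 1)| <= e by apply: K; lra.
rewrite distrC -ler_pdivrMr// -[X in _ / X]gtr0_norm// -normrV ?unitfE ?gt_eqF//.
rewrite -normrM; move: K; rewrite -[_ *: _]/(_ * _).
by rewrite (_ : r - _ = (r * (l - 1) - (l `^ r - 1)) / (l - 1))//; field; lra.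
Qed.

Lemma measurable_cutoff N : measurable_fun setT (fun x => cutoff N x).
Proof. exact: smooth_measurable (smooth_cutoff N). Qed.

Lemma measurable_cutoff_tail N : 0 < N -> measurable_fun setT (fun x => cutoff_tail N x).
Proof.
move=> N0; have md : measurable_fun setT (fun x : 'rV[R]_n => dot x x).
  exact: measurable_dot.
apply: measurable_funD; apply: measurable_minr => //.
  exact: measurable_funM.
by apply: measurable_inv_fun => [x|]; [rewrite mulr_ge0 ?dot_ge0// ltW|exact: measurable_funM].
Qed.

Lemma L1_cutoff N h : 0 < N -> L1 m h -> L1 m (fun x => cutoff N x * h x).
Proof.
move=> N0 Hh; apply: (L1_le _ (L1_norm Hh)) => [|x].
  by apply: measurable_funM; [exact: measurable_cutoff|exact: L1_measurable Hh].
by rewrite normrM ger0_norm ?cutoff_ge0// ler_piMl// cutoff_le1.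
Qed.

Lemma L1_cutoff_tail N h : 0 < N -> L1 m h -> L1 m (fun x => cutoff_tail N x * h x).
Proof.
move=> N0 Hh; apply: (L1_le _ (L1Z 2 (L1_norm Hh))) => [|x].
  by apply: measurable_funM; [exact: measurable_cutoff_tail|exact: L1_measurable Hh].
by rewrite normrM ger0_norm ?cutoff_tail_ge0// ler_wpM2r// cutoff_tail_le2.
Qed.

Lemma cvg_int_cutoff h : (0 < n)%N -> L1 m h ->
  \int[m]_x (cutoff k.+1%:R x * h x) @[k --> \oo] --> \int[m]_x h x.
Proof.
move=> n0 Hh; have mh := L1_measurable Hh.
apply: (proj2 (dominated_real (g := fun x => `|h x|) _ _ _ _ _)) => //.
- by move=> k; apply: measurable_funM => //; exact: measurable_cutoff.
- exact: L1_norm.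
- apply: filterS (ae_neq0 n0) => x x0; rewrite -[X in _ --> X]mul1r.
  by apply: cvgM; [exact: cvg_cutoff|exact: cvg_cst].
- move=> k; apply/aeW => x.
  by rewrite normrM ger0_norm ?cutoff_ge0// ler_piMl// cutoff_le1.
Qed.

Lemma cvg_int_cutoff_tail h : L1 m h ->
  \int[m]_x (cutoff_tail k.+1%:R x * h x) @[k --> \oo] --> 0.
Proof.
move=> Hh; have mh := L1_measurable Hh.
have -> : (0 : R) = \int[m]_x ((fun=> 0) x) by rewrite /Rintegral integral0.
apply: (proj2 (dominated_real (g := fun x => 2 * `|h x|) _ _ _ _ _)) => //.
- by move=> k; apply: measurable_funM => //; exact: measurable_cutoff_tail.
- by apply: L1Z; exact: L1_norm.
- apply/aeW => x; rewrite -(mul0r (h x)).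
  by apply: cvgM; [exact: cvg_cutoff_tail|exact: cvg_cst].
- move=> k; apply/aeW => x.
  by rewrite normrM ger0_norm ?cutoff_tail_ge0// ler_wpM2r// cutoff_tail_le2.
Qed.

(** The change of variables moves the dilation from h to the cutoff, with a factor l^(sg-n) <= 1,
    and [cutoff_lipschitz] compares the two cutoffs. The weight l^sg comes from the scaling of the
    density: sg is p for |grad u|^p, and the exponent of |x| for the other densities. *)
Lemma int_cutoff_dilation N l sg h : 0 < N -> 1 < l -> l <= 2 -> sg <= n%:R ->
  (forall x, 0 <= h x) -> L1 m h ->
  L1 m (fun x => cutoff N x * (l `^ sg * h (l *: x))) /\
  `|\int[m]_x (cutoff N x * (l `^ sg * h (l *: x))) -
    l `^ (sg - n%:R) * \int[m]_x (cutoff N x * h x)| <=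
  64 * expR 1 * (l - 1) * \int[m]_x (cutoff_tail N x * h x).
Proof.
move=> N0 l1 l2 sgn h0 Hh; have l0 : 0 < l by lra.
have mh := L1_measurable Hh.
have meta : measurable_fun setT (fun x : 'rV[R]_n => cutoff N (l^-1 *: x)).
  exact: measurable_dilation_fun (measurable_cutoff N).
have HF : L1 m (fun x => cutoff N (l^-1 *: x) * h x).
  apply: (L1_le _ Hh) => [|x]; first exact: measurable_funM.
  by rewrite normrM !ger0_norm ?cutoff_ge0// ler_piMl// cutoff_le1.
have F0 x : 0 <= cutoff N (l^-1 *: x) * h x by rewrite mulr_ge0// cutoff_ge0.
have [] := L1_dilation l0 F0 HF.
have E : (fun x => cutoff N (l^-1 *: (l *: x)) * h (l *: x)) =
    fun x => cutoff N x * h (l *: x).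
  by apply/funext => x; rewrite scalerA mulVf ?gt_eqF// scale1r.
rewrite E => HFl IFl.
have E2 : (fun x => cutoff N x * (l `^ sg * h (l *: x))) =
    fun x => l `^ sg * (cutoff N x * h (l *: x)).
  by apply/funext => x; rewrite mulrCA.
rewrite E2; split; first exact: L1Z.
rewrite (intZ _ HFl) IFl mulrA.
have -> : l `^ sg / l ^+ n = l `^ (sg - n%:R).
  rewrite powRD; first by rewrite powRN powR_mulrn// ltW.
  by apply/implyP => _; rewrite gt_eqF.
have Hc := L1_cutoff N0 Hh; have Ht := L1_cutoff_tail N0 Hh.
rewrite -mulrBr -(intB HF Hc) normrM ger0_norm ?powR_ge0//.
apply: (@le_trans _ _ `|\int[m]_x (cutoff N (l^-1 *: x) * h x - cutoff N x * h x)|).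
  by rewrite ler_piMl// -[leRHS](powRr0 l) ler_powR ?(ltW l1)// subr_le0.
rewrite -(intZ _ Ht); apply: int_norm_le.
- exact: (L1_measurable (L1B HF Hc)).
- exact: L1Z.
apply/aeW => x; rewrite -mulrBl normrM (ger0_norm (h0 x)) mulrA ler_wpM2r//.
by apply: cutoff_lipschitz => //; rewrite ltW.
Qed.

(** The first-order coefficient is the derivative sg - n of l^(sg-n) at 1. The tail term is of order
    l - 1 as well and disappears only in the later limit in N. *)
Lemma cutoff_dilation_derivative N sg h e : 0 < N -> sg <= n%:R ->
  (forall x, 0 <= h x) -> L1 m h -> 0 < e ->
  exists2 de, 0 < de & forall l, 1 < l -> l <= 2 -> l < 1 + de ->
  `|\int[m]_x (cutoff N x * (l `^ sg * h (l *: x))) - \int[m]_x (cutoff N x * h x) -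
    (sg - n%:R) * (l - 1) * \int[m]_x (cutoff N x * h x)| <=
  (e + 64 * expR 1 * \int[m]_x (cutoff_tail N x * h x)) * (l - 1).
Proof.
move=> N0 sgn h0 Hh e0; set I := \int[m]_x (cutoff N x * h x).
have I0 : 0 <= I by apply: int_ge0 => x; rewrite mulr_ge0// cutoff_ge0.
have e'0 : 0 < e / (I + 1) by rewrite divr_gt0// ltr_wpDl.
have [de de0 H] := powR_differentiable1 (sg - n%:R) e'0.
exists de => // l l1 l2 ld.
have [_ ] := int_cutoff_dilation N0 l1 l2 sgn h0 Hh; rewrite -/I.
set Il := \int[m]_x (_ * (_ * _)); set T := \int[m]_x (_ * _) => H2.
have H1 : `|(l `^ (sg - n%:R) - 1 - (sg - n%:R) * (l - 1)) * I| <= e * (l - 1).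
  rewrite normrM (ger0_norm I0).
  apply: (@le_trans _ _ (e / (I + 1) * (l - 1) * I)).
    by rewrite ler_wpM2r// H.
  rewrite mulrAC ler_wpM2r//; first lra.
  by rewrite mulrAC ler_pdivrMr ?ltr_wpDl// ler_pM2l// lerDl.
have -> : Il - I - (sg - n%:R) * (l - 1) * I = (Il - l `^ (sg - n%:R) * I) +
    (l `^ (sg - n%:R) - 1 - (sg - n%:R) * (l - 1)) * I by ring.
apply: le_trans (ler_normD _ _) _.
have -> : (e + 64 * expR 1 * T) * (l - 1) = 64 * expR 1 * (l - 1) * T + e * (l - 1).
  by ring.
exact: lerD.
Qed.

End cutoff_limits.

(** * Dilation of the equation *)

Section power_nonlinearity.
Context {R : realType} {n : nat}.
Implicit Types (x : 'rV[R]_n) (u : 'rV[R]_n -> R) (G : 'rV[R]_n -> 'rV[R]_n).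
Implicit Types (N l e p r sg : R).
Local Notation m := (lebesgue_rV R n).

(** One pattern for the three zero-order terms: (r, sg) is (p, p) for the Hardy term,
    ([crit_exp_s n p s], s) and (q, 0) for the other two. *)
Definition power_density r sg u x : R := `|u x| `^ r / enorm x `^ sg.

Definition power_force r sg u x : R := dpow r (u x) / enorm x `^ sg.

Lemma power_density_ge0 r sg u x : 0 <= power_density r sg u x.
Proof. by rewrite divr_ge0 ?powR_ge0. Qed.

Lemma power_forceM r sg u x : 1 < r -> power_force r sg u x * u x = power_density r sg u x.
Proof. by move=> r1; rewrite /power_force mulrAC dpowM. Qed.

Lemma measurable_power_density r sg u : measurable_fun setT u ->
  measurable_fun setT (power_density r sg u).
Proof.
move=> mu; apply: measurable_funM.
  by apply: measurable_powR_fun; exact: measurableT_comp.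
apply: measurable_inv_fun => [x|]; first exact: powR_ge0.
by apply: measurable_powR_fun; exact: measurable_enorm_id.
Qed.

Lemma measurable_power_force r sg u : measurable_fun setT u ->
  measurable_fun setT (power_force r sg u).
Proof.
move=> mu; apply: measurable_funM.
  apply: measurable_funM => //.
  by apply: measurable_powR_fun; exact: measurableT_comp.
apply: measurable_inv_fun => [x|]; first exact: powR_ge0.
by apply: measurable_powR_fun; exact: measurable_enorm_id.
Qed.

Lemma power_density_dilation r sg u l x : 0 < l ->
  l `^ sg * power_density r sg u (l *: x) = `|u (l *: x)| `^ r / enorm x `^ sg.
Proof.
move=> l0; rewrite /power_density enormZ (gtr0_norm l0) powRM ?enorm_ge0 ?(ltW l0)//.
by rewrite invfM mulrCA mulVKf// gt_eqF// powR_gt0.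
Qed.

Lemma enorm_annulus N x : 0 < N -> annulus N x ->
  [/\ 0 < enorm x, enorm x <= Num.sqrt N & (enorm x)^-1 <= Num.sqrt N].
Proof.
move=> N0 /andP[x1 x2]; have d0 : 0 < dot x x by apply: lt_le_trans x1; rewrite invr_gt0.
split; first by rewrite sqrtr_gt0.
  by rewrite ler_sqrt// ltW.
have dN : (dot x x)^-1 <= N by rewrite -[leRHS]invrK lef_pV2// posrE invr_gt0.
by rewrite /enorm -sqrtrV ?dot_ge0// ler_sqrt// ltW.
Qed.

Lemma powR_enorm_annulus N x sg : 0 < N -> annulus N x ->
  enorm x `^ sg <= Num.sqrt N `^ `|sg|.
Proof.
move=> N0 /(enorm_annulus N0)[x0 x1 x2]; have [s0|s0] := leP 0 sg.
  by rewrite (ger0_norm s0) ler_powR_base ?enorm_ge0.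
rewrite (ltr0_norm s0) -[enorm x]invrK -(@powR_inv1 _ (enorm x)^-1) ?invr_ge0 ?enorm_ge0// -powRrM mulN1r.
by rewrite ler_powR_base ?invr_ge0 ?enorm_ge0// oppr_ge0 ltW.
Qed.

(** Lets a single bound of |u|, on the annulus of parameter 4 N, control u at both x and l x. *)
Lemma annulus_dilation N l x : 0 < N -> 1 <= l <= 2 -> annulus N x ->
  annulus (4 * N) (l *: x).
Proof.
move=> N0 /andP[l1 l2] /andP[x1 x2]; rewrite /annulus /= dotZl dotZr mulrA.
have d0 : 0 < dot x x by apply: lt_le_trans x1; rewrite invr_gt0.
apply/andP; split; last by rewrite ler_pM ?dot_ge0//; nra.
apply: (@le_trans _ _ N^-1); first by rewrite lef_pV2 ?posrE ?mulr_gt0//; lra.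
by apply: le_trans x1 _; rewrite ler_peMl ?(ltW d0)//; nra.
Qed.

Lemma Linfty_annulus u N : 0 < N -> Linfty_loc_punctured u ->
  exists2 M, 0 <= M & {ae m, forall x, annulus N x -> `|u x| <= M}.
Proof.
move=> N0 [_ /(_ _ (@compact_annulus _ _ N) (annulus0 N0))[M HM]].
exists `|M| => //; apply: filterS HM => x Hx xN.
exact: le_trans (Hx xN) (ler_norm _).
Qed.

(** With Z = |u_l - u|/|x|, [dpow_defect] bounds the remainder on the annulus by multiples of e' Z
    and Z^p. The integral of Z^p is of order (l-1)^p = o(l-1), and Z <= (l-1) + (l-1)^(1-p) Z^p, so
    the linear part contributes e' times O(l-1). *)
Lemma power_taylor p r sg u G N e : 1 < p -> p < n%:R -> 1 < r -> 0 < N ->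
  D1p_gradient p u G -> Linfty_loc_punctured u -> 0 < e ->
  exists2 de, 0 < de & forall l, 1 < l -> l <= 2 -> l < 1 + de ->
  let h x := cutoff N x * (((`|u (l *: x)| `^ r - `|u x| `^ r) / r -
    dpow r (u x) * (u (l *: x) - u x)) / enorm x `^ sg) in
  L1 m h /\ `|\int[m]_x h x| <= e * (l - 1).
Proof.
move=> p1 pn r1 N0 Du Hu e0; have p0 : 0 < p by lra.
have [mu mG _] := Du.
have N40 : 0 < 4 * N by rewrite mulr_gt0.
have [M M0 HM] := Linfty_annulus N40 Hu.
set B := 2 `^ p * \int[m]_x (enorm (G x) `^ p).
have B0 : 0 <= B by rewrite mulr_ge0 ?powR_ge0// int_ge0// => x; exact: powR_ge0.
set An := \int[m]_x (\1_(annulus N) x : R).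
have An0 : 0 <= An by apply: int_ge0.
have HAn := L1_compact_indic (@compact_annulus R n N).
set K0 := Num.sqrt N `^ `|- sg|; set K1 := Num.sqrt N.
have K00 : 0 <= K0 by exact: powR_ge0.
have K10 : 0 <= K1 by exact: sqrtr_ge0.
have e20 : 0 < e / 2 by rewrite divr_gt0.
(* [D1] is the factor of e' in the final bound and is independent of e', which can thus be fixed
   first. [D2] depends on e' through [C], and is compensated by the range allowed for l. *)
set D1 := K0 * K1 * (An + B).
have D10 : 0 <= D1 by rewrite !mulr_ge0// addr_ge0.
have e'0 : 0 < e / 2 / (D1 + 1) by rewrite divr_gt0// ltr_wpDl.
have [C C0 HC] := dpow_defect r1 p1 M0 e'0.
set e' := e / 2 / (D1 + 1) in e'0 HC.
have e'D : e' * D1 <= e / 2.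
  by rewrite /e' mulrAC ler_pdivrMr ?ltr_wpDl// ler_pM2l// lerDl.
clearbody e'.
set D2 := K0 * (C * K1 `^ p) * B.
have D20 : 0 <= D2 by rewrite mulr_ge0// !mulr_ge0// powR_ge0.
have f0 : 0 < e / 2 / (D2 + 1) by rewrite divr_gt0// ltr_wpDl.
have pi0 : 0 < (p - 1)^-1 by rewrite invr_gt0; lra.
exists ((e / 2 / (D2 + 1)) `^ (p - 1)^-1); first exact: powR_gt0.
move=> l l1 l2 ld h; have l0 : 0 < l by lra.
have t0 : 0 < l - 1 by lra.
have [HZ IZ] := D1p_dilation_difference p1 pn l1 Du; rewrite -/B in IZ.
set Z := fun x => `|u (l *: x) - u x| / enorm x in HZ IZ.
have mul := measurable_dilation_fun l mu.
have mh : measurable_fun setT h.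
  apply: measurable_funM; first exact: measurable_cutoff.
  apply: measurable_funM; last first.
    apply: measurable_inv_fun => [x|]; first exact: powR_ge0.
    by apply: measurable_powR_fun; exact: measurable_enorm_id.
  apply: measurable_funB.
    apply: measurable_funM => //; apply: measurable_funB.
      by apply: measurable_powR_fun; exact: measurableT_comp.
    by apply: measurable_powR_fun; exact: measurableT_comp.
  apply: measurable_funM; last exact: measurable_funB.
  apply: measurable_funM => //.
  by apply: measurable_powR_fun; exact: measurableT_comp.
have tp0 : 0 < (l - 1) `^ p by exact: powR_gt0.
set c1 := K0 * (e' * K1 * (l - 1)).
set c2 := K0 * (e' * K1 * (l - 1) / (l - 1) `^ p + C * K1 `^ p).
have c10 : 0 <= c1 by rewrite !mulr_ge0// ltW.
have c20 : 0 <= c2.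
  by rewrite mulr_ge0// addr_ge0// ?divr_ge0 ?mulr_ge0 ?powR_ge0// ltW.
have Hg : L1 m (fun x => c1 * \1_(annulus N) x + c2 * Z x `^ p) by exact: L1ZD.
have HMl := ae_dilation l0 HM.
have hg : {ae m, forall x, `|h x| <= c1 * \1_(annulus N) x + c2 * Z x `^ p}.
  apply: filterS2 HM HMl => x Hx Hlx.
  have Zp0 : 0 <= Z x `^ p by exact: powR_ge0.
  have [xN|xN] := pselect (annulus N x); last first.
    by rewrite /h cutoff_eq0// mul0r normr0 addr_ge0// mulr_ge0.
  have [x0 x1 x2] := enorm_annulus N0 xN.
  have xN4 : annulus (4 * N) (l *: x).
    by apply: annulus_dilation => //; rewrite (ltW l1).
  have xN4' : annulus (4 * N) x.
    by have := @annulus_dilation N 1 x N0; rewrite scale1r; apply => //; rewrite lexx ler1n.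
  have := HC _ _ (Hx xN4') (Hlx xN4); set d := u (l *: x) - u x => Hd.
  have dZ : `|d| = enorm x * Z x by rewrite mulrC divfK// gt_eqF.
  have Z0 : 0 <= Z x by rewrite divr_ge0// enorm_ge0.
  have h1 : `|d| <= K1 * ((l - 1) + (l - 1) / (l - 1) `^ p * Z x `^ p).
    rewrite dZ ler_pM ?enorm_ge0//.
    have y0 : 0 <= Z x / (l - 1) by rewrite divr_ge0// ltW.
    have : Z x / (l - 1) <= 1 + (Z x / (l - 1)) `^ p.
      have [y1|y1] := leP (Z x / (l - 1)) 1; first by rewrite ler_wpDr// powR_ge0.
      by rewrite ler_wpDl// -[leLHS]powRr1// ler_powR ?(ltW y1)// ltW.
    rewrite powRM ?invr_ge0 ?(ltW t0)// powR_inv ?(ltW t0)//.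
    by rewrite ler_pdivrMr// => /le_trans; apply; rewrite mulrDl mul1r lerD2l; lra.
  have h2 : `|d| `^ p <= K1 `^ p * Z x `^ p.
    by rewrite dZ powRM ?enorm_ge0// ler_wpM2r// ler_powR_base ?enorm_ge0// ltW.
  rewrite indicE mem_set// mulr1 /h normrM ger0_norm ?cutoff_ge0//.
  apply: (@le_trans _ _ (K0 * (e' * `|d| + C * `|d| `^ p))).
    apply: (@le_trans _ _ (`|((`|u (l *: x)| `^ r - `|u x| `^ r) / r - dpow r (u x) * d) / enorm x `^ sg|)).
      by rewrite ler_piMl// cutoff_le1.
    rewrite normrM mulrC ler_pM//.
    rewrite normrV ?unitfE ?gt_eqF ?powR_gt0// ger0_norm ?powR_ge0//.
    by rewrite -powRN powR_enorm_annulus.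
  have -> : c1 + c2 * Z x `^ p = K0 * (e' * (K1 * ((l - 1) + (l - 1) / (l - 1) `^ p * Z x `^ p)) +
     C * (K1 `^ p * Z x `^ p)) by rewrite /c1 /c2; ring.
  by rewrite ler_wpM2l// lerD// ler_wpM2l// ltW.
split; first exact: L1_ae_le mh Hg hg.
apply: le_trans (int_norm_le mh Hg hg) _.
rewrite (intZD _ _ HAn HZ) -/An.
apply: (@le_trans _ _ (c1 * An + c2 * ((l - 1) `^ p * B))).
  by rewrite lerD2l ler_wpM2l.
have tp : (l - 1) `^ p = (l - 1) * (l - 1) `^ (p - 1) by rewrite mulr_powRB1// ltW.
have -> : c1 * An + c2 * ((l - 1) `^ p * B) = (e' * D1 + D2 * (l - 1) `^ (p - 1)) * (l - 1).
  have -> : (e' * D1 + D2 * (l - 1) `^ (p - 1)) * (l - 1) = e' * D1 * (l - 1) + D2 * (l - 1) `^ p.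
    by rewrite tp; ring.
  by rewrite /c1 /c2 /D1 /D2; field; rewrite gt_eqF.
rewrite ler_wpM2r ?(ltW t0)// [leRHS]splitr lerD//.
have : (l - 1) `^ (p - 1) <= e / 2 / (D2 + 1).
  have p10 : 0 < p - 1 by lra.
  rewrite -[leRHS](powR_inv_root p10 f0) ler_powR_base ?(ltW p10) ?(ltW t0)//.
  by rewrite lerBlDl ltW.
move=> /(ler_wpM2l D20) /le_trans; apply.
by rewrite mulrCA ler_piMr ?(ltW e20)// ler_pdivrMr ?ltr_wpDl// mul1r lerDl.
Qed.

(** The force times u_l - u is the increment of |u|^r/(r |x|^sg), with |x| held fixed, minus the
    Taylor remainder; [cutoff_dilation_derivative] expands the former and [power_taylor] bounds the
    latter. *)
Lemma power_force_dilation p r sg u G N e : 1 < p -> p < n%:R -> 1 < r ->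
  sg <= n%:R -> 0 < N -> D1p_gradient p u G -> Linfty_loc_punctured u ->
  L1 m (power_density r sg u) -> 0 < e ->
  let I := \int[m]_x (cutoff N x * power_density r sg u x) in
  let J := \int[m]_x (cutoff_tail N x * power_density r sg u x) in
  exists2 de, 0 < de & forall l, 1 < l -> l <= 2 -> l < 1 + de ->
  let h x := cutoff N x * (power_force r sg u x * (u (l *: x) - u x)) in
  L1 m h /\ `|\int[m]_x h x - (sg - n%:R) / r * I * (l - 1)| <=
    (e + 64 * expR 1 * J) * (l - 1).
Proof.
move=> p1 pn r1 sgn N0 Du Hu Hh e0 I J; have r0 : 0 < r by lra.
have e20 : 0 < e / 2 by rewrite divr_gt0.
have [de1 de10 H1] := cutoff_dilation_derivative N0 sgn (power_density_ge0 r sg u) Hh e20.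
have [de2 de20 H2] := power_taylor sg p1 pn r1 N0 Du Hu e20.
exists (Num.min de1 de2); first by rewrite lt_min de10.
move=> l l1 l2; rewrite -ltrBlDl lt_min !ltrBlDl => /andP[ld1 ld2] h.
have l0 : 0 < l by lra.
have := H1 _ l1 l2 ld1; rewrite -/I -/J; have [] := H2 _ l1 l2 ld2.
have [HL _] := int_cutoff_dilation N0 l1 l2 sgn (power_density_ge0 r sg u) Hh.
have HI := L1_cutoff N0 Hh.
set F := fun x => cutoff N x * (_ / _); set Il := \int[m]_x (cutoff N x * (l `^ sg * power_density r sg u (l *: x))) => HF BF BI.
have Eh : h = fun x => r^-1 * (cutoff N x * (l `^ sg * power_density r sg u (l *: x)) -
    cutoff N x * power_density r sg u x) - F x.
  apply/funext => x; rewrite power_density_dilation// /h /F /power_force /power_density.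
  by ring.
have HB := L1B HL HI.
rewrite Eh; split; first by apply: L1B => //; exact: L1Z.
rewrite (intB (L1Z _ HB) HF) (intZ _ HB) (intB HL HI) -/I -/Il.
have -> : r^-1 * (Il - I) - \int[m]_x F x - (sg - n%:R) / r * I * (l - 1) =
    r^-1 * (Il - I - (sg - n%:R) * (l - 1) * I) - \int[m]_x F x by ring.
apply: le_trans (ler_normB _ _) _.
rewrite normrM gtr0_norm ?invr_gt0//.
apply: (@le_trans _ _ (1 * ((e / 2 + 64 * expR 1 * J) * (l - 1)) + e / 2 * (l - 1))).
  by rewrite lerD// ler_pM// ?invr_ge0 ?(ltW r0)// invf_le1// ltW.
by rewrite mul1r -mulrDl ler_wpM2r; lra.
Qed.

End power_nonlinearity.

(** * Testing with the solution and with its dilation difference *)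

Section dilation_identity.
Context {R : realType} {n : nat}.
Implicit Types (x : 'rV[R]_n) (u f : 'rV[R]_n -> R) (G : 'rV[R]_n -> 'rV[R]_n).
Implicit Types (N l e p r sg : R).
Local Notation m := (lebesgue_rV R n).

Lemma power_force_annulus r sg u N : 1 < r -> 0 < N -> Linfty_loc_punctured u ->
  exists2 F, 0 <= F & {ae m, forall x, annulus N x -> `|power_force r sg u x| <= F}.
Proof.
move=> r1 N0 Hu; have [M M0 HM] := Linfty_annulus N0 Hu.
exists (M `^ (r - 1) * Num.sqrt N `^ `|- sg|); first by rewrite mulr_ge0 ?powR_ge0.
apply: filterS HM => x Hx xN.
rewrite normrM norm_dpow// ler_pM ?powR_ge0//.
  by rewrite ler_powR_base ?Hx//; lra.
by rewrite normrV ?unitfE ?gt_eqF ?powR_gt0//;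
  [rewrite ger0_norm ?powR_ge0// -powRN powR_enorm_annulus|have [] := enorm_annulus N0 xN].
Qed.

Lemma L1_cutoff_power_density r sg u N : 1 < r -> 0 < N -> Linfty_loc_punctured u ->
  L1 m (fun x => cutoff N x * power_density r sg u x).
Proof.
move=> r1 N0 Hu; have [M M0 HM] := Linfty_annulus N0 Hu.
have [F F0 HF] := power_force_annulus sg r1 N0 Hu.
have HAn := L1_compact_indic (@compact_annulus R n N).
apply: (L1_ae_le _ (L1Z (F * M) HAn)).
  by apply: measurable_funM; [exact: measurable_cutoff|exact: measurable_power_density Hu.1].
apply: filterS2 HM HF => x Hx HFx.
have [xN|xN] := pselect (annulus N x); last first.
  by rewrite cutoff_eq0// mul0r normr0 !mulr_ge0.
rewrite indicE mem_set// mulr1 normrM (ger0_norm (cutoff_ge0 N x)).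
apply: (@le_trans _ _ `|power_density r sg u x|); first by rewrite ler_piMl// cutoff_le1.
by rewrite -power_forceM// normrM ler_pM ?Hx ?HFx.
Qed.

Lemma flux_grad_cutoff p G N x : 1 < p -> 0 < N ->
  `|flux p G x (grad (cutoff N) x)| <=
  8 * expR 1 * cutoff_tail N x * (enorm (G x) `^ (p - 1) / enorm x).
Proof.
move=> p1 N0; rewrite /flux normrM ger0_norm ?powR_ge0//.
have [G0|G0] := eqVneq (enorm (G x)) 0.
  have -> : dot (G x) (grad (cutoff N) x) = 0.
    by move/eqP: G0; rewrite enorm_eq0 => /eqP ->; rewrite /dot big1// => i _; rewrite mxE mul0r.
  rewrite normr0 mulr0 !mulr_ge0 ?expR_ge0 ?cutoff_tail_ge0 ?powR_ge0//.
  by rewrite invr_ge0 enorm_ge0.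
have -> : enorm (G x) `^ (p - 1) = enorm (G x) `^ (p - 2) * enorm (G x).
  rewrite -[X in _ * X]powRr1 ?enorm_ge0// -powRD ?G0 ?implybT//; congr (_ `^ _); lra.
have := ler_wpM2l (powR_ge0 (enorm (G x)) (p - 2)) (dot_grad_cutoff_le x (G x) N0).
by move=> /le_trans; apply; rewrite le_eqVlt; apply/orP; left; apply/eqP; ring.
Qed.

(** The test function is [cutoff N] times u. The gradient of the cutoff brings in |G|^(p-1) |u|/|x|,
    which Young's inequality bounds by [g] and the Hardy density, weighted by the tail. *)
Lemma energy_cutoff p u G f N (F : R) : 1 < p -> p < n%:R -> 0 < N -> 0 <= F ->
  D1p_gradient p u G -> measurable_fun setT f ->
  {ae m, forall x, annulus N x -> `|f x| <= F} ->
  (forall phi, test_function phi ->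
    (\int[m]_x (flux p G x (grad phi x))%:E = \int[m]_x (f x * phi x)%:E)%E) ->
  let g x := enorm (G x) `^ p in
  let b := power_density p p u in
  [/\ L1 m g, L1 m b, L1 m (fun x => cutoff N x * (f x * u x)) &
  \int[m]_x (cutoff N x * (f x * u x)) <= \int[m]_x (cutoff N x * g x) +
  8 * expR 1 * \int[m]_x (cutoff_tail N x * (g x + b x))].
Proof.
move=> p1 pn N0 F0 Du mf fF weak g b; have p0 : 0 < p by lra.
have [mu mG _] := Du.
have [psi Ha _] := D1p_approximates p1 pn Du.
have Hg : L1 m g by exact: approximates_L1_gradient p0 mG Ha.
have Eb : (fun x => (`|u x| / enorm x) `^ p) = b.
  apply/funext => x; rewrite powRM ?invr_ge0 ?enorm_ge0//.
  by rewrite powR_inv ?enorm_ge0.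
have Hb : L1 m b by have := D1p_hardy p1 pn Du; rewrite Eb.
have [H1 H2 H3] := weak_cutoff p1 pn N0 F0 mG Hg mf fF weak mu mG Ha.
have E : (fun x => cutoff N x * (f x * u x)) = fun x => f x * (cutoff N x * u x).
  by apply/funext => x; rewrite mulrCA.
rewrite E; split => //.
have Hc := L1_cutoff N0 Hg; have Ht := L1_cutoff_tail N0 (L1D Hg Hb).
rewrite -H3 -(intZ _ Ht) -(intD Hc (L1Z _ Ht)).
apply: int_le => [//||x]; first by apply: L1D => //; exact: L1Z.
rewrite fluxD !fluxZ flux_self// lerD2l.
have x1 := flux_grad_cutoff G x p1 N0.
apply: le_trans (ler_norm _) _; rewrite normrM.
apply: le_trans (ler_wpM2l (normr_ge0 (u x)) x1) _.
have -> : `|u x| * (8 * expR 1 * cutoff_tail N x * (enorm (G x) `^ (p - 1) / enorm x)) =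
  8 * expR 1 * (cutoff_tail N x * (enorm (G x) `^ (p - 1) * (`|u x| / enorm x))) by ring.
rewrite ler_wpM2l ?mulr_ge0 ?expR_ge0// ler_wpM2l ?cutoff_tail_ge0//.
rewrite /g -Eb; apply: mulr_powR_le => //; first exact: enorm_ge0.
by rewrite divr_ge0// enorm_ge0.
Qed.

(* The equation tested with [cutoff N x * (u (l *: x) - u x)]. *)
Lemma dilation_cutoff p u G e : 1 < p -> p < n%:R -> 0 < e -> D1p_gradient p u G ->
  exists2 K, 0 <= K & forall f N (F : R), 0 < N -> 0 <= F ->
  measurable_fun setT f ->
  {ae m, forall x, annulus N x -> `|f x| <= F} ->
  (forall phi, test_function phi ->
    (\int[m]_x (flux p G x (grad phi x))%:E = \int[m]_x (f x * phi x)%:E)%E) ->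
  let g x := enorm (G x) `^ p in
  exists2 de, 0 < de & forall l, 1 < l -> l <= 2 -> l < 1 + de ->
  \int[m]_x (cutoff N x * (f x * (u (l *: x) - u x))) <=
  ((p - n%:R) / p * \int[m]_x (cutoff N x * g x) +
   K * \int[m]_x (cutoff_tail N x * g x) + e) * (l - 1).
Proof.
move=> p1 pn e0 Du; have p0 : 0 < p by lra.
have [mu mG _] := Du.
have [psi Ha _] := D1p_approximates p1 pn Du.
have Hg : L1 m (fun x => enorm (G x) `^ p) by exact: approximates_L1_gradient p0 mG Ha.
set g := fun x => enorm (G x) `^ p in Hg.
set B := 2 `^ p * \int[m]_x g x.
have B0 : 0 <= B by rewrite mulr_ge0 ?powR_ge0// int_ge0// => x; exact: powR_ge0.
have E0 := expR_gt0 (1 : R); set E := expR 1 in E0.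
have EB0 : 0 <= 16 * E * B by rewrite mulr_ge0// mulr_ge0// ltW.
have D0 : 0 < 16 * E * B + 1 by rewrite ltr_wpDl.
have e'0 : 0 < e / 2 / (16 * E * B + 1) by rewrite !divr_gt0.
(* The integral of (Z/(l-1))^p is bounded by [B] but need not vanish as l tends to 1, so its
   coefficient must be small. The 16 is the 8 of [flux_grad_cutoff] times the bound 2 of the
   tail. *)
have [C C0 HC] := mulr_powR_le_epsr p1 e'0.
set e' := e / 2 / (16 * E * B + 1) in e'0 HC.
have e'B : 16 * E * e' * B <= e / 2.
  have -> : 16 * E * e' * B = e / 2 * (16 * E * B) / (16 * E * B + 1) by rewrite /e'; ring.
  by rewrite ler_pdivrMr// ler_pM2l ?divr_gt0// lerDl.
clearbody e'.
(* This constant depends on e through [C] but not on N, so the tail integral that it multiplies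
   still vanishes as N grows. *)
exists (64 * E + 8 * E * C); first by rewrite addr_ge0// !mulr_ge0// ltW.
move=> f N F N0 F0 mf fF weak g'; rewrite /g' {g'} -/g.
have g0 x : 0 <= g x by exact: powR_ge0.
have e20 : 0 < e / 2 by rewrite divr_gt0.
have [de de0 Hde] := cutoff_dilation_derivative N0 (ltW pn) g0 Hg e20.
exists de => // l l1 l2 ld; have l0 : 0 < l by lra.
have t0 : 0 < l - 1 by lra.
have {Hde} := Hde _ l1 l2 ld; set I := \int[m]_x (cutoff N x * g x).
set J := \int[m]_x (cutoff_tail N x * g x).
have [HL _] := int_cutoff_dilation N0 l1 l2 (ltW pn) g0 Hg.
set Il := \int[m]_x (cutoff N x * (l `^ p * g (l *: x))) => BI.
have [HZ IZ] := D1p_dilation_difference p1 pn l1 Du; rewrite -/g -/B in IZ.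
set Z := fun x => `|u (l *: x) - u x| / enorm x in HZ IZ.
have mul := measurable_dilation_fun l mu.
have mGl : measurable_fun setT (fun x : 'rV[R]_n => l *: G (l *: x)).
  apply: measurable_scale_vec => //.
  by apply: (measurableT_comp mG); exact: measurable_scale_rV.
have Hal := approximates_dilation p0 l0 Ha.
have [H1 H2 H3] := weak_cutoff p1 pn N0 F0 mG Hg mf fF weak mu mG Ha.
have [H1' H2' H3'] := weak_cutoff p1 pn N0 F0 mG Hg mf fF weak mul mGl Hal.
have HI := L1_cutoff N0 Hg; have HJ := L1_cutoff_tail N0 Hg.
have -> : (fun x => cutoff N x * (f x * (u (l *: x) - u x))) =
    fun x => f x * (cutoff N x * u (l *: x)) - f x * (cutoff N x * u x).
  by apply/funext => x; ring.
rewrite (intB H2' H2) -H3 -H3' -(intB H1' H1).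
set tp := (l - 1) `^ p in IZ.
have tp0 : 0 < tp by exact: powR_gt0.
have HB := L1B HL HI.
set c1 := 8 * E * C * (l - 1); set c2 := 16 * E * e' * (l - 1) / tp.
have c20 : 0 <= c2 by rewrite !mulr_ge0 ?invr_ge0// ltW.
apply: (@le_trans _ _ (\int[m]_x (p^-1 * (cutoff N x * (l `^ p * g (l *: x)) - cutoff N x * g x) +
    (c1 * (cutoff_tail N x * g x) + c2 * Z x `^ p)))).
  apply: int_le.
  - exact: (L1B H1' H1).
  - by apply: L1D; [exact: L1Z|exact: L1ZD].
  move=> x; rewrite !fluxD ![flux p G x (cutoff N x *: _)]fluxZ.
  rewrite ![flux p G x (u _ *: _)]fluxZ flux_self//.
  have enV : enorm (l *: G (l *: x)) `^ p = l `^ p * g (l *: x).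
    by rewrite enormZ (gtr0_norm l0) powRM ?enorm_ge0// ltW.
  (* The convexity inequality for the gradients, through Cauchy-Schwarz and Young. *)
  have h1 : flux p G x (l *: G (l *: x)) - g x <= p^-1 * (l `^ p * g (l *: x) - g x).
    have := young_powR p1 (enorm_ge0 (G x)) (enorm_ge0 (l *: G (l *: x))).
    rewrite enV; have := normr_flux G x (l *: G (l *: x)) p1.
    move=> /(le_trans (ler_norm _)) /le_trans /[apply]; rewrite -/(g x).
    have -> : p^-1 * (l `^ p * g (l *: x) - g x) =
      (1 - p^-1) * g x + l `^ p * g (l *: x) / p - g x by ring.
    by move=> h; rewrite lerD2r.
  have t00 : 0 <= 8 * E * cutoff_tail N x * (l - 1).
    by rewrite mulr_ge0 ?(ltW t0)// mulr_ge0 ?cutoff_tail_ge0// mulr_ge0// ltW.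
  have h2 : (u (l *: x) - u x) * flux p G x (grad (cutoff N) x) <=
      c1 * (cutoff_tail N x * g x) + c2 * Z x `^ p.
    apply: le_trans (ler_norm _) _; rewrite normrM.
    apply: le_trans (ler_wpM2l (normr_ge0 _) (flux_grad_cutoff G x p1 N0)) _.
    have Y0 : 0 <= Z x / (l - 1) by rewrite !divr_ge0 ?enorm_ge0// ltW.
    have := HC _ _ (enorm_ge0 (G x)) Y0; rewrite -/(g x).
    rewrite powRM ?divr_ge0 ?enorm_ge0 ?invr_ge0 ?(ltW t0)// powR_inv ?(ltW t0)// -/tp.
    move=> /(ler_wpM2l t00) h; apply: le_trans (le_trans _ h) _.
      rewrite le_eqVlt; apply/orP; left; apply/eqP; rewrite -/E /Z; set w := (enorm x)^-1; field.
      by rewrite gt_eqF.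
    rewrite mulrDr lerD//; first by rewrite le_eqVlt; apply/orP; left; apply/eqP; rewrite /c1; ring.
    have q0 : 0 <= 8 * E * (l - 1) * (e' * (Z x `^ p / tp)).
      by rewrite !mulr_ge0 ?powR_ge0 ?invr_ge0// ltW.
    have := ler_wpM2l q0 (cutoff_tail_le2 N x).
    rewrite (_ : c2 * Z x `^ p = 8 * E * (l - 1) * (e' * (Z x `^ p / tp)) * 2); last by rewrite /c2; ring.
    by apply: le_trans; rewrite le_eqVlt; apply/orP; left; apply/eqP; ring.
  have := ler_wpM2l (cutoff_ge0 N x) h1 => {}h1.
  have -> : cutoff N x * flux p G x (l *: G (l *: x)) +
    u (l *: x) * flux p G x (grad (cutoff N) x) -
    (cutoff N x * enorm (G x) `^ p + u x * flux p G x (grad (cutoff N) x)) =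
    cutoff N x * (flux p G x (l *: G (l *: x)) - g x) +
    (u (l *: x) - u x) * flux p G x (grad (cutoff N) x) by rewrite /g; ring.
  apply: lerD h2; apply: le_trans h1 _.
  by rewrite le_eqVlt; apply/orP; left; apply/eqP; ring.
rewrite (intD (L1Z _ HB) (L1ZD _ _ HJ HZ)) (intZ _ HB) (intB HL HI) (intZD _ _ HJ HZ).
rewrite -/I -/J -/Il.
have h3 : c2 * \int[m]_x Z x `^ p <= e / 2 * (l - 1).
  apply: le_trans (ler_wpM2l c20 IZ) _.
  have -> : c2 * (tp * B) = 16 * E * e' * B * (l - 1).
    by rewrite /c2; field; rewrite gt_eqF.
  by rewrite ler_wpM2r// ltW.
have h4 : p^-1 * (Il - I) <= (p - n%:R) / p * I * (l - 1) +
    (e / 2 + 64 * E * J) * (l - 1).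
  have J0 : 0 <= J by apply: int_ge0 => x; rewrite mulr_ge0// cutoff_tail_ge0.
  have p'0 : 0 <= p^-1 by rewrite invr_ge0 ltW.
  have := ler_wpM2l p'0 (le_trans (ler_norm _) BI); rewrite -/E => h.
  have : p^-1 * ((e / 2 + 64 * E * J) * (l - 1)) <= (e / 2 + 64 * E * J) * (l - 1).
    apply: ler_piMl; last by rewrite invf_le1// ltW.
    rewrite mulr_ge0 ?(ltW t0)// addr_ge0 ?(ltW e20)// mulr_ge0// mulr_ge0// ltW//.
  move=> /(le_trans h) {}h; rewrite -lerBlDl; apply: le_trans h.
  by rewrite le_eqVlt; apply/orP; left; apply/eqP; ring.
apply: le_trans (lerD h4 (lerD (lexx (c1 * J)) h3)) _.
by rewrite le_eqVlt; apply/orP; left; apply/eqP; rewrite /c1; field; rewrite gt_eqF.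
Qed.

End dilation_identity.

(** * The Pohozaev inequality *)

Section pohozaev.
Context {R : realType} {n : nat}.
Implicit Types (x : 'rV[R]_n) (u f : 'rV[R]_n -> R) (G : 'rV[R]_n -> 'rV[R]_n).
Implicit Types (N l e p r s q mu : R).
Local Notation m := (lebesgue_rV R n).

Definition source mu p r s q u x : R :=
  mu * power_force p p u x + power_force r s u x + power_force q 0 u x.

Lemma measurable_source mu p r s q u : measurable_fun setT u ->
  measurable_fun setT (source mu p r s q u).
Proof.
move=> mu'; apply: measurable_funD; last exact: measurable_power_force.
apply: measurable_funD; last exact: measurable_power_force.
by apply: measurable_funM => //; exact: measurable_power_force.
Qed.

Lemma source_annulus mu p r s q u N : 1 < p -> 1 < r -> 1 < q -> 0 < N ->
  Linfty_loc_punctured u ->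
  exists2 F, 0 <= F & {ae m, forall x, annulus N x -> `|source mu p r s q u x| <= F}.
Proof.
move=> p1 r1 q1 N0 Hu.
have [F1 F10 H1] := power_force_annulus p p1 N0 Hu.
have [F2 F20 H2] := power_force_annulus s r1 N0 Hu.
have [F3 F30 H3] := power_force_annulus 0 q1 N0 Hu.
exists (`|mu| * F1 + F2 + F3); first by rewrite !addr_ge0// mulr_ge0.
apply: filterS3 H1 H2 H3 => x h1 h2 h3 xN.
apply: le_trans (ler_normD _ _) _; apply: lerD; last exact: h3.
apply: le_trans (ler_normD _ _) _; apply: lerD; last exact: h2.
by rewrite normrM ler_wpM2l// h1.
Qed.

Lemma source_mul mu p r s q u x : 1 < p -> 1 < r -> 1 < q ->
  source mu p r s q u x * u x = mu * power_density p p u x +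
    (power_density r s u x + power_density q 0 u x).
Proof.
move=> p1 r1 q1; rewrite !mulrDl -(mulrA mu) !power_forceM// addrA//.
Qed.

(** Here t stands for l - 1, a for the common rate (n-p)/p and b for n/q; the X are the force terms,
    the I and J integrals against [cutoff] and [cutoff_tail]. After division by t, adding a times
    the energy inequality cancels Ig, Ib and Ic, leaving (a - b) Id and errors. *)
Lemma pohozaev_arith (a b E K mu t e X1 X2 X3 Ig Ib Ic Id Jg Jb Jc Jd : R) :
  0 <= a -> 0 <= E -> 0 <= K -> 0 < t ->
  `|X3 - - b * Id * t| <= (e + 64 * E * Jd) * t ->
  `|X2 - - a * Ic * t| <= (e + 64 * E * Jc) * t ->
  `|X1 - - a * Ib * t| <= (e + 64 * E * Jb) * t ->
  mu * X1 + (X2 + X3) <= (- a * Ig + K * Jg + e) * t ->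
  0 <= Jd -> 0 <= Jc -> 0 <= Jb -> 0 <= Jg ->
  mu * Ib + (Ic + Id) <= Ig + 8 * E * (Jg + Jb) ->
  (a - b) * Id <= (K + 8 * E * a + 64 * E * (`|mu| + 1)) * (Jg + Jb + (Jc + Jd)) +
    (`|mu| + 3) * e.
Proof.
move=> a0 E0 K0 t0; rewrite !mulNr !opprK => h3 h2 h1 h0 Jd0 Jc0 Jb0 Jg0 hE.
have k3 : - ((e + 64 * E * Jd) * t) - b * Id * t <= X3.
  by move: h3; rewrite ler_norml => /andP[+ _]; rewrite lerBlDr.
have k2 : - ((e + 64 * E * Jc) * t) - a * Ic * t <= X2.
  by move: h2; rewrite ler_norml => /andP[+ _]; rewrite lerBlDr.
have k1 : - (`|mu| * ((e + 64 * E * Jb) * t)) - mu * (a * Ib * t) <= mu * X1.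
  have := ler_wpM2l (normr_ge0 mu) h1; rewrite -normrM mulrDr.
  by rewrite ler_norml => /andP[+ _]; rewrite lerBlDr.
have {k1 k2 k3 h0} : (- (`|mu| * (e + 64 * E * Jb)) - mu * (a * Ib) +
   (- (e + 64 * E * Jc) - a * Ic + (- (e + 64 * E * Jd) - b * Id))) * t <=
   (- (a * Ig) + K * Jg + e) * t.
  apply: le_trans h0; apply: le_trans (lerD k1 (lerD k2 k3)).
  by rewrite le_eqVlt; apply/orP; left; apply/eqP; ring.
rewrite ler_pM2r// => k.
have := ler_wpM2l a0 hE => k'.
have M0 := normr_ge0 mu; set M := `|mu| in M0 k *.
have q1 : 0 <= K * (Jb + Jc + Jd) by rewrite mulr_ge0// !addr_ge0.
have q2 : 0 <= E * a * (Jc + Jd) by rewrite !mulr_ge0// addr_ge0.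
have q3 : 0 <= E * M * (Jg + Jc + Jd) by rewrite !mulr_ge0// !addr_ge0.
have q4 : 0 <= E * (Jg + Jb) by rewrite !mulr_ge0// !addr_ge0.
rewrite -subr_ge0; rewrite -subr_ge0 in k; rewrite -subr_ge0 in k'.
(* The difference of the two sides is the slack in [k], plus the slack in [k'], plus non-negative
   tail terms. *)
have -> : (K + 8 * E * a + 64 * E * (M + 1)) * (Jg + Jb + (Jc + Jd)) + (M + 3) * e -
    (a - b) * Id =
  (- (a * Ig) + K * Jg + e - (- (M * (e + 64 * E * Jb)) - mu * (a * Ib) +
   (- (e + 64 * E * Jc) - a * Ic + (- (e + 64 * E * Jd) - b * Id)))) +
  (a * (Ig + 8 * E * (Jg + Jb)) - a * (mu * Ib + (Ic + Id))) +
  (K * (Jb + Jc + Jd) + 8 * (E * a * (Jc + Jd)) + 64 * (E * M * (Jg + Jc + Jd)) +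
   64 * (E * (Jg + Jb))) by ring.
apply: addr_ge0; first exact: addr_ge0.
apply: addr_ge0; last exact: mulr_ge0.
apply: addr_ge0; last exact: mulr_ge0.
by apply: addr_ge0 => //; exact: mulr_ge0.
Qed.

Section solution.
Context (mu p r s q : R) (u : 'rV[R]_n -> R) (G : 'rV[R]_n -> 'rV[R]_n).
Context (p1 : 1 < p) (pn : p < n%:R) (r1 : 1 < r) (q1 : 1 < q).
Context (Du : D1p_gradient p u G) (Hu : Linfty_loc_punctured u).
Context (weak : forall phi, test_function phi ->
  (\int[m]_x (flux p G x (grad phi x))%:E =
   \int[m]_x (source mu p r s q u x * phi x)%:E)%E).

Let p0 : 0 < p. Proof. exact: lt_trans ltr01 p1. Qed.

Let g x := enorm (G x) `^ p.
Let b := power_density p p u.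
Let c := power_density r s u.
Let d := power_density q 0 u.

Let g0 x : 0 <= g x. Proof. exact: powR_ge0. Qed.
Let b0 x : 0 <= b x. Proof. exact: power_density_ge0. Qed.
Let c0 x : 0 <= c x. Proof. exact: power_density_ge0. Qed.
Let d0 x : 0 <= d x. Proof. exact: power_density_ge0. Qed.

(** Boundedness of u on the annulus makes the cut-off integrals of [c] and [d] finite before the
    integrability of [c] and [d] is known. *)
Lemma source_energy N : 0 < N ->
  [/\ L1 m g, L1 m b &
  mu * \int[m]_x (cutoff N x * b x) + (\int[m]_x (cutoff N x * c x) +
    \int[m]_x (cutoff N x * d x)) <= \int[m]_x (cutoff N x * g x) +
  8 * expR 1 * \int[m]_x (cutoff_tail N x * (g x + b x))].
Proof.
move=> N0; have [F F0 HF] := source_annulus mu s p1 r1 q1 N0 Hu.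
have mf := measurable_source mu p r s q Hu.1.
have [Hg Hb Hs H] := energy_cutoff p1 pn N0 F0 Du mf HF weak.
split => //; apply: le_trans H.
have Hcb := L1_cutoff N0 Hb.
have Hcc : L1 m (fun x => cutoff N x * c x) by exact: L1_cutoff_power_density.
have Hcd : L1 m (fun x => cutoff N x * d x) by exact: L1_cutoff_power_density.
rewrite -(intD Hcc Hcd) -(intZ mu Hcb) -(intD (L1Z mu Hcb) (L1D Hcc Hcd)).
rewrite le_eqVlt; apply/orP; left; apply/eqP; congr (Rintegral _ _ _).
by apply/funext => x; rewrite source_mul// /b /c /d; ring.
Qed.

(* Fatou's lemma in [source_energy], whose right-hand side is bounded in [N]. *)
Lemma source_L1 : L1 m c /\ L1 m d.
Proof.
have [Hg Hb _] := source_energy ltr01.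
have n0 : (0 < n)%N by rewrite -(ltr_nat R); exact: lt_trans p0 pn.
have mc : measurable_fun setT c by exact: measurable_power_density Hu.1.
have md : measurable_fun setT d by exact: measurable_power_density Hu.1.
(* A bound free of N: [mu] may have either sign, whence its absolute value, and the tail is at most
   2. *)
set A := \int[m]_x g x + `|mu| * \int[m]_x b x +
  8 * expR 1 * (2 * \int[m]_x (g x + b x)).
have k0 k : 0 < k.+1%:R :> R by [].
have Hcc k : L1 m (fun x => cutoff k.+1%:R x * c x) by exact: L1_cutoff_power_density.
have Hcd k : L1 m (fun x => cutoff k.+1%:R x * d x) by exact: L1_cutoff_power_density.
have cle h k : L1 m h -> (forall x, 0 <= h x) ->
    0 <= \int[m]_x (cutoff k.+1%:R x * h x) <= \int[m]_x h x.
  move=> Hh h0; rewrite int_ge0 => [|x]; last by rewrite mulr_ge0// cutoff_ge0.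
  apply: int_le => // [|x]; first exact: L1_cutoff.
  by rewrite ler_piMl// cutoff_le1.
have [Hcd' _] : L1 m (fun x => c x + d x) /\ \int[m]_x (c x + d x) <= A.
  apply: (@fatou_real _ _ _ m (fun k x => cutoff k.+1%:R x * (c x + d x)) _ (fun=> A)).
  - move=> k; under [X in L1 _ X]eq_fun do rewrite mulrDr.
    exact: L1D.
  - by move=> k x; rewrite mulr_ge0 ?addr_ge0// cutoff_ge0.
  - exact: measurable_funD.
  - by move=> x; rewrite addr_ge0.
  - apply: filterS (ae_neq0 n0) => x x0; rewrite -[X in _ --> X]mul1r.
    by apply: cvgM; [exact: cvg_cutoff|exact: cvg_cst].
  - move=> k; under [X in Rintegral _ _ X]eq_fun do rewrite mulrDr.
    rewrite (intD (Hcc k) (Hcd k)).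
    have [_ _ H] := source_energy (k0 k).
    have /andP[_ Ig] := cle _ k Hg g0; have /andP[Ib0 Ib] := cle _ k Hb b0.
    have Hgb := L1D Hg Hb.
    have T : \int[m]_x (cutoff_tail k.+1%:R x * (g x + b x)) <= 2 * \int[m]_x (g x + b x).
      rewrite -(intZ _ Hgb); apply: int_le => [||x].
      + exact: L1_cutoff_tail.
      + exact: L1Z.
      + by rewrite ler_wpM2r ?addr_ge0// cutoff_tail_le2.
    have E0 : 0 <= 8 * expR 1 :> R by rewrite mulr_ge0 ?expR_ge0.
    have T' := ler_wpM2l E0 T.
    have B' : - (mu * \int[m]_x (cutoff k.+1%:R x * b x)) <= `|mu| * \int[m]_x b x.
      rewrite -mulNr; apply: (@le_trans _ _ (`|mu| * \int[m]_x (cutoff k.+1%:R x * b x))).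
        by rewrite ler_wpM2r// -normrN ler_norm.
      by rewrite ler_wpM2l.
    by rewrite -lerBrDl in H; apply: le_trans H _; rewrite /A; lra.
  - exact: cvg_cst.
split; apply: (L1_le _ Hcd') => // x; first by rewrite ger0_norm// lerDl.
by rewrite ger0_norm// lerDr.
Qed.

(** The two equations for [a] say that the gradient, Hardy and critical terms scale at the same
    rate. [K] is fixed before N; l = 1 + t is chosen after N, within the range of all four
    expansions. *)
Lemma pohozaev_inequality a e : 0 <= s -> s <= n%:R ->
  a = (n%:R - p) / p -> a = (n%:R - s) / r -> 0 < e ->
  exists2 K, 0 <= K & forall N, 0 < N ->
  (a - n%:R / q) * \int[m]_x (cutoff N x * d x) <=
    K * \int[m]_x (cutoff_tail N x * (g x + b x + (c x + d x))) + (`|mu| + 3) * e.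
Proof.
move=> s0 sn ap ar e0; have [Hc Hd] := source_L1.
have [Hg Hb _] := source_energy ltr01.
have a0 : 0 <= a by rewrite ap divr_ge0 ?(ltW p0)// subr_ge0 ltW.
have [K K0 HK] := dilation_cutoff p1 pn e0 Du.
have E0 : 0 <= expR 1 :> R by exact: expR_ge0.
exists (K + 8 * expR 1 * a + 64 * expR 1 * (`|mu| + 1)).
  by rewrite !addr_ge0// !mulr_ge0// addr_ge0.
move=> N N0; have [F F0 HF] := source_annulus mu s p1 r1 q1 N0 Hu.
have mf := measurable_source mu p r s q Hu.1.
have [de0 de00 H0] := HK _ _ _ N0 F0 mf HF weak.
have [de1 de10 H1] := power_force_dilation p1 pn p1 (ltW pn) N0 Du Hu Hb e0.
have [de2 de20 H2] := power_force_dilation p1 pn r1 sn N0 Du Hu Hc e0.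
have n0 : (0 : R) <= n%:R by [].
have [de3 de30 H3] := power_force_dilation p1 pn q1 n0 N0 Du Hu Hd e0.
have [_ _ HE] := source_energy N0.
(* Halving the minimum makes the comparisons with the thresholds strict; the 1 ensures l <= 2. *)
set t := Num.min 1 (Num.min (Num.min de0 de1) (Num.min de2 de3)) / 2.
have t0 : 0 < t by rewrite divr_gt0// !lt_min ltr01 de00 de10 de20.
have [t1 td0 td1 td2 td3] : [/\ t <= 1, t < de0, t < de1, t < de2 & t < de3].
  have tt : t < 2 * t by rewrite ltr_pMl// ltr1n.
  have : 2 * t <= Num.min 1 (Num.min (Num.min de0 de1) (Num.min de2 de3)).
    by rewrite mulrC divfK.
  rewrite !le_min => /and3P[h1 /andP[h2 h3] /andP[h4 h5]].
  by split; [apply/ltW|..]; apply: lt_le_trans tt _.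
have l1 : 1 < 1 + t by rewrite ltrDl.
have l2 : 1 + t <= 2 by rewrite -[leRHS]/(1 + 1) lerD2l.
move: HE; rewrite -/g -/b -/c -/d.
have Hgb := L1_cutoff_tail N0 Hg; have Hbb := L1_cutoff_tail N0 Hb.
have Hcb := L1_cutoff_tail N0 Hc; have Hdb := L1_cutoff_tail N0 Hd.
have -> : \int[m]_x (cutoff_tail N x * (g x + b x)) =
    \int[m]_x (cutoff_tail N x * g x) + \int[m]_x (cutoff_tail N x * b x).
  rewrite -(intD Hgb Hbb); congr (Rintegral _ _ _).
  by apply/funext => x; rewrite mulrDr.
have -> : \int[m]_x (cutoff_tail N x * (g x + b x + (c x + d x))) =
    \int[m]_x (cutoff_tail N x * g x) + \int[m]_x (cutoff_tail N x * b x) +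
    (\int[m]_x (cutoff_tail N x * c x) + \int[m]_x (cutoff_tail N x * d x)).
  rewrite -(intD Hgb Hbb) -(intD Hcb Hdb) -(intD (L1D Hgb Hbb) (L1D Hcb Hdb)).
  congr (Rintegral _ _ _).
  by apply/funext => x; rewrite !mulrDr.
have tail_ge0 h : (forall x, 0 <= h x) -> 0 <= \int[m]_x (cutoff_tail N x * h x).
  by move=> h0; apply: int_ge0 => x; rewrite mulr_ge0// cutoff_tail_ge0.
have := tail_ge0 g g0; have := tail_ge0 b b0.
have := tail_ge0 c c0; have := tail_ge0 d d0.
have := H0 _ l1 l2; rewrite ltrD2l => /(_ td0).
have [X1 ] := H1 _ l1 l2 (etrans (ltrD2l _ _ _) td1).
have [X2 ] := H2 _ l1 l2 (etrans (ltrD2l _ _ _) td2).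
have [X3 ] := H3 _ l1 l2 (etrans (ltrD2l _ _ _) td3).
have -> : \int[m]_x (cutoff N x * (source mu p r s q u x * (u ((1 + t) *: x) - u x))) =
  mu * \int[m]_x (cutoff N x * (power_force p p u x * (u ((1 + t) *: x) - u x))) +
  (\int[m]_x (cutoff N x * (power_force r s u x * (u ((1 + t) *: x) - u x))) +
   \int[m]_x (cutoff N x * (power_force q 0 u x * (u ((1 + t) *: x) - u x)))).
  rewrite -(intD X2 X3) -(intZ mu X1) -(intD (L1Z mu X1) (L1D X2 X3)).
  by congr (Rintegral _ _ _); apply/funext => x; rewrite /source; ring.
rewrite (_ : 1 + t - 1 = t); last by rewrite addrAC subrr add0r.
rewrite -/g -/b -/c -/d.
have -> : (s - n%:R) / r = - a by rewrite ar -mulNr opprB.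
have -> : (p - n%:R) / p = - a by rewrite ap -mulNr opprB.
rewrite sub0r (mulNr n%:R).
exact: pohozaev_arith.
Qed.

End solution.
End pohozaev.

(** * Vanishing of the solution *)

(** [K] in [pohozaev_inequality] depends on the precision, which is therefore held fixed while N
    tends to infinity and sent to 0 afterwards. *)
Lemma supercritical_solution_ae0 (R : realType) (n : nat) (mu p r s q : R)
    (u : 'rV[R]_n -> R) G :
  1 < p -> p < n%:R -> 0 <= s -> s <= n%:R -> 1 < r ->
  (n%:R - s) / r = (n%:R - p) / p -> crit_exp n p < q ->
  D1p_gradient p u G -> Linfty_loc_punctured u ->
  (forall phi, test_function phi ->
    (\int[lebesgue_rV R n]_x (flux p G x (grad phi x))%:E =
     \int[lebesgue_rV R n]_x (source mu p r s q u x * phi x)%:E)%E) ->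
  {ae lebesgue_rV R n, forall x, u x = 0}.
Proof.
move=> p1 pn s0 sn r1 rE pq Du Hu weak.
have p0 : 0 < p by exact: lt_trans p1.
have n0 : (0 < n)%N by rewrite -(ltr_nat R); exact: lt_trans p0 pn.
have q1 : 1 < q by apply: lt_trans (lt_trans p1 (lt_crit_exp p1 pn)) pq.
have q0 : 0 < q by exact: lt_trans q1.
have [Hc Hd] := source_L1 p1 pn r1 q1 Du Hu weak.
have [Hg Hb _] := source_energy p1 pn r1 q1 Du Hu weak ltr01.
have HW := L1D (L1D Hg Hb) (L1D Hc Hd).
set a := (n%:R - p) / p.
have aq : 0 < a - n%:R / q.
  rewrite subr_gt0 /a ltr_pdivrMr// mulrAC ltr_pdivlMr//.
  by move: pq; rewrite /crit_exp ltr_pdivrMr ?subr_gt0// [q * _]mulrC.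
have le0 : \int[lebesgue_rV R n]_x power_density q 0 u x <= 0.
  rewrite -(pmulr_rle0 _ aq); apply/ler_addgt0Pl => e e0; rewrite addr0.
  have M0 : 0 < `|mu| + 3 by rewrite ltr_wpDl.
  have e'0 : 0 < e / (`|mu| + 3) by rewrite divr_gt0.
  have [K K0 HK] := pohozaev_inequality p1 pn r1 q1 Du Hu weak s0 sn (erefl a) (esym rE) e'0.
  have -> : e = K * 0 + (`|mu| + 3) * (e / (`|mu| + 3)).
    by rewrite mulr0 add0r mulrC divfK// gt_eqF.
  apply: (@ler_cvg_to _ \oo _ R
    (fun k => (a - n%:R / q) * \int[lebesgue_rV R n]_x (cutoff k.+1%:R x * power_density q 0 u x))
    (fun k => K * \int[lebesgue_rV R n]_x (cutoff_tail k.+1%:R x * (enorm (G x) `^ p +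
      power_density p p u x + (power_density r s u x + power_density q 0 u x))) +
      (`|mu| + 3) * (e / (`|mu| + 3)))).
  - by apply: cvg_cstM; exact: cvg_int_cutoff.
  - apply: cvgD; last exact: cvg_cst.
    by apply: cvg_cstM; exact: cvg_int_cutoff_tail.
  - by apply: nearW => k; exact: HK.
have := int_eq0_ae Hd (power_density_ge0 q 0 u) le0.
apply: filterS => x; rewrite /power_density powRr0 divr1 => /eqP.
by rewrite powR_eq0 normr_eq0 => /andP[/eqP].
Qed.

Theorem mainTheorem3 (R : realType) (n : nat) (p mu s q : R)
    (u : 'rV[R]_n -> R) :
  (2 <= n)%N -> 1 < p -> p < n%:R ->
  mu < hardy_constant n p ->
  0 < s -> s < p ->
  crit_exp n p < q ->
  D1p p u ->
  Linfty_loc_punctured u ->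
  weak_solution p u (fun x =>
    mu * (`|u x| `^ (p - 2) * u x / enorm x `^ p)
    + `|u x| `^ (crit_exp_s n p s - 2) * u x / enorm x `^ s
    + `|u x| `^ (q - 2) * u x) ->
  {ae lebesgue_rV R n, forall x, u x = 0}.
Proof.
move=> _ p1 pn _ s0 sp pq _ Hu [_ [G Du weak]].
have p0 : 0 < p by exact: lt_trans p1.
have np : 0 < n%:R - p by rewrite subr_gt0.
have ns : 0 < n%:R - s by rewrite subr_gt0; exact: lt_trans sp pn.
(* Since s < p, already (n - s)/(n - p) exceeds 1. *)
have r1 : 1 < crit_exp_s n p s.
  rewrite /crit_exp_s ltr_pdivlMr// mul1r.
  apply: (@lt_trans _ _ (n%:R - s)); first by rewrite ltrD2l ltrN2.
  by rewrite ltr_pMl.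
apply: (@supercritical_solution_ae0 R n mu p (crit_exp_s n p s) s q u G) => //.
- exact: ltW.
- by rewrite ltW// -subr_gt0.
(* The exponent [crit_exp_s n p s] is the one for which |u|^r/|x|^s scales like |grad u|^p. *)
- by rewrite /crit_exp_s; field; rewrite !gt_eqF.
move=> phi tphi; rewrite /flux weak//; apply: eq_integral => x _.
(* The last term has the weight |x|^0, which is 1 at the origin too. *)
by congr ((_ * _)%:E); rewrite /source /power_force powRr0 divr1.
Qed.
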